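(* Let $X$ be a closed subset of $\mathbb{R}^n$, let $p\in\mathbb{N}$, and suppose $X\subset M$, where $M$ is a $\mathcal{C}^p$ submanifold of $\mathbb{R}^n$ and $X$ is the closure of its interior in $M$ (interior and closure taken relative to $M$). Then a function $f:X\to\mathbb{R}$ is the restriction of a $\mathcal{C}^p$ function on $\mathbb{R}^n$ if and only if $\nabla^pf:\tau^p(X)\to\mathbb{R}$.
   Context: Notation. Multiindex notation $\alpha\in\mathbb{N}^n$, $|\alpha|$, $\alpha!$, $x^\alpha$. $\mathcal{P}_p$ is the space of real polynomials on $\mathbb{R}^n$ of degree $\le p$, $\mathcal{P}_p^*$ its dual, $r=\dim\mathcal{P}_p$. For $\xi\in\mathcal{P}_p^*$, $b\in\mathbb{R}^n$, $|\alpha|\le p$: $\xi_\alpha(b):=\xi(\tfrac1{\alpha!}(x-b)^\alpha)$; $\delta_a(P)=P(a)$. A bundle over $X$ with fibres in a vector space $W$ is a subset $E\subset X\times W$ whose fibres $E_a$ are linear subspaces. For a bundle $E\subset X\times\mathcal{P}_p^*$: $\Delta E=\{(a,b,\xi+\eta):a,b\in X,\xi\in E_a,\eta\in E_b,|a-b|^{p-|\alpha|}|\eta_\alpha(b)|\le1\ \forall|\alpha|\le p\}$, $E'=\{(a,\xi):(a,a,\xi)\in\overline{\Delta E}\}$ (closure in $X\times X\times\mathcal{P}_p^*$), $\rho(E)=\{(a,\xi):\xi\in\operatorname{Span}E'_a\}$. With $E_0=\{(a,\lambda\delta_a)\}$, $\rho^i(E_0)$ is constant for $i\ge2r$ and $\tau^p(X):=\rho^{2r}(E_0)$.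 For $f:X\to\mathbb{R}$ and bundles $\Phi\subset X\times(\mathcal{P}_p^*\times\mathbb{R})$: $\Delta\Phi=\{(a,b,\xi+\eta,\lambda+\mu):(\xi,\lambda)\in\Phi_a,(\eta,\mu)\in\Phi_b,|a-b|^{p-|\alpha|}|\eta_\alpha(b)|\le1\ \forall|\alpha|\le p\}$, $\Phi'=\{(a,\xi,\lambda):(a,a,\xi,\lambda)\in\overline{\Delta\Phi}\}$, $\rho(\Phi)$ the fibrewise linear span of $\Phi'$. With $\Phi_0=\{(a,\lambda\delta_a,\lambda f(a))\}$, $\nabla^pf:=\rho^{2(r+1)}(\Phi_0)$ (stable from then on); $\nabla^pf\subset\tau^p(X)\times\mathbb{R}$. ''$\nabla^pf:\tau^p(X)\to\mathbb{R}$'' means that for each $a\in X$, $\xi\in\tau^p_a(X)$ there is exactly one $\lambda$ with $(a,\xi,\lambda)\in\nabla^pf$. *)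

(* Defs.v *)
From HB Require Import structures.
From mathcomp Require Import all_boot all_order all_algebra.
From mathcomp Require Import all_classical all_reals all_analysis.
Set Implicit Arguments. Unset Strict Implicit. Unset Printing Implicit Defensive.
Import Order.TTheory GRing.Theory Num.Theory.
Import numFieldNormedType.Exports.
Local Open Scope classical_set_scope.
Local Open Scope ring_scope.

Section Defs.
Variable R : realType.

Definition enorm (n : nat) (v : 'rV[R]_n) : R := Num.sqrt (\sum_(i < n) v ord0 i ^+ 2).

Definition ei (n : nat) (i : 'I_n) : 'rV[R]_n := delta_mx ord0 i.

Fixpoint pder (n : nat) (F : 'rV[R]_n -> R) (l : seq 'I_n) : 'rV[R]_n -> R :=
  match l with
  | [::] => F
  | i :: l' => fun x => 'D_(ei i) (pder F l') x
  end.

Definition Cp_on (n p : nat) (U : set 'rV[R]_n) (F : 'rV[R]_n -> R) : Prop :=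
  forall l : seq 'I_n, (size l <= p)%N ->
    (forall x, U x -> {for x, continuous (pder F l)}) /\
    ((size l < p)%N -> forall x, U x -> forall i : 'I_n, derivable (pder F l) x (ei i)).

Definition Cp_on_vec (n p : nat) (U : set 'rV[R]_n) (phi : 'rV[R]_n -> 'rV[R]_n) : Prop :=
  forall j : 'I_n, Cp_on p U (fun x => phi x ord0 j).

Definition is_submanifold (n p d : nat) (M : set 'rV[R]_n) : Prop :=
  (d <= n)%N /\
  forall x, M x -> exists (U V : set 'rV[R]_n) (phi psi : 'rV[R]_n -> 'rV[R]_n),
    open U /\ open V /\ U x /\
    (forall y, U y -> V (phi y)) /\ (forall z, V z -> U (psi z)) /\
    (forall y, U y -> psi (phi y) = y) /\ (forall z, V z -> phi (psi z) = z) /\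
    Cp_on_vec p U phi /\ Cp_on_vec p V psi /\
    (forall y, U y -> (M y <-> forall j : 'I_n, (d <= j)%N -> phi y ord0 j = 0)).

Definition rel_interior (n : nat) (M Y : set 'rV[R]_n) : set 'rV[R]_n :=
  [set x | Y x /\ exists e : R, 0 < e /\ forall y, M y -> enorm (y - x) < e -> Y y].
Definition rel_closure (n : nat) (M Y : set 'rV[R]_n) : set 'rV[R]_n :=
  [set x | M x /\ forall e : R, 0 < e -> exists y, Y y /\ enorm (x - y) < e].

Definition mi (n p : nat) := {a : {ffun 'I_n -> 'I_p.+1} | (\sum_(i < n) (a i : nat) <= p)%N}.
Definition mdeg (n p : nat) (a : mi n p) : nat := \sum_(i < n) (val a i : nat).

(* P_p^* identified with R^{multiindices}: xi is represented by beta |-> xi(x^beta) *)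
Definition Dual (n p : nat) := mi n p -> R.

(* xi_alpha(b) = xi((x-b)^alpha / alpha!), expanding (x-b)^alpha binomially *)
Definition xi_at (n p : nat) (xi : Dual n p) (a : mi n p) (b : 'rV[R]_n) : R :=
  (\prod_(i < n) ((val a i : nat)`!)%:R)^-1 *
  \sum_(be : mi n p | [forall i, (val be i <= val a i)%N])
     (\prod_(i < n) (('C(val a i, val be i))%:R * (- b ord0 i) ^+ (val a i - val be i)%N))
     * xi be.

Definition delta (n p : nat) (a : 'rV[R]_n) : Dual n p :=
  fun be => \prod_(i < n) a ord0 i ^+ (val be i : nat).

Definition rdim (n p : nat) : nat := #|{: mi n p}|.

Definition small (n p : nat) (a b : 'rV[R]_n) (eta : Dual n p) : Prop :=
  forall al : mi n p, enorm (a - b) ^+ (p - mdeg al)%N * `|xi_at eta al b| <= 1.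

Definition bundle (n p : nat) := 'rV[R]_n -> Dual n p -> Prop.

Definition DeltaE (n p : nat) (X : set 'rV[R]_n) (E : bundle n p)
  (a b : 'rV[R]_n) (z : Dual n p) : Prop :=
  exists xi eta, X a /\ X b /\ E a xi /\ E b eta /\ small a b eta /\
                 (forall be, z be = xi be + eta be).

(* E' : (a,a,xi) in the closure of Delta E *)
Definition Eprime (n p : nat) (X : set 'rV[R]_n) (E : bundle n p) : bundle n p :=
  fun a xi => forall e : R, 0 < e -> exists a' b' z,
    [/\ DeltaE X E a' b' z, enorm (a' - a) < e, enorm (b' - a) < e &
        forall be, `|z be - xi be| < e].

Definition span_dual (n p : nat) (S : Dual n p -> Prop) : Dual n p -> Prop :=
  fun xi => exists k (c : 'I_k -> R) (w : 'I_k -> Dual n p),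
    (forall i, S (w i)) /\ forall be, xi be = \sum_(i < k) c i * w i be.

Definition rho (n p : nat) (X : set 'rV[R]_n) (E : bundle n p) : bundle n p :=
  fun a => span_dual (Eprime X E a).

Definition E0 (n p : nat) (X : set 'rV[R]_n) : bundle n p :=
  fun a xi => X a /\ exists l : R, forall be, xi be = l * @delta n p a be.

Definition tau (n p : nat) (X : set 'rV[R]_n) : bundle n p :=
  iter (2 * rdim n p) (rho X) (@E0 n p X).

Definition pbundle (n p : nat) := 'rV[R]_n -> Dual n p -> R -> Prop.

Definition DeltaPhi (n p : nat) (X : set 'rV[R]_n) (Phi : pbundle n p)
  (a b : 'rV[R]_n) (z : Dual n p) (nu : R) : Prop :=
  exists xi l eta m, X a /\ X b /\ Phi a xi l /\ Phi b eta m /\ small a b eta /\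
                     (forall be, z be = xi be + eta be) /\ nu = l + m.

Definition Phiprime (n p : nat) (X : set 'rV[R]_n) (Phi : pbundle n p) : pbundle n p :=
  fun a xi l => forall e : R, 0 < e -> exists a' b' z nu,
    DeltaPhi X Phi a' b' z nu /\ enorm (a' - a) < e /\ enorm (b' - a) < e /\
        (forall be, `|z be - xi be| < e) /\ `|nu - l| < e.

Definition span_pair (n p : nat) (S : Dual n p -> R -> Prop) : Dual n p -> R -> Prop :=
  fun xi l => exists k (c : 'I_k -> R) (w : 'I_k -> Dual n p) (v : 'I_k -> R),
    [/\ forall i, S (w i) (v i),
        forall be, xi be = \sum_(i < k) c i * w i be &
        l = \sum_(i < k) c i * v i].

Definition rhoPhi (n p : nat) (X : set 'rV[R]_n) (Phi : pbundle n p) : pbundle n p :=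
  fun a => span_pair (Phiprime X Phi a).

Definition Phi0 (n p : nat) (X : set 'rV[R]_n) (f : 'rV[R]_n -> R) : pbundle n p :=
  fun a xi l => X a /\ exists c : R, (forall be, xi be = c * @delta n p a be) /\ l = c * f a.

Definition nabla (n p : nat) (X : set 'rV[R]_n) (f : 'rV[R]_n -> R) : pbundle n p :=
  iter (2 * (rdim n p).+1) (rhoPhi X) (@Phi0 n p X f).

Definition nabla_is_function (n p : nat) (X : set 'rV[R]_n) (f : 'rV[R]_n -> R) : Prop :=
  forall a, X a -> forall xi : Dual n p, tau X a xi ->
    exists! l : R, @nabla n p X f a xi l.

End Defs.

(* Main.v *)
(* If F is C^p, Taylor's formula shows that <eta, T_b F - T_a F> tends to 0 whenever
   |a - b|^(p - |al|) |eta_al(b)| <= 1; by induction every element of rho^j(Phi_0) over a has the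
   form (xi, <xi, T_a F>), whence one implication.

   Conversely, pull X back by a chart to a set Y with dense interior, through psi, and let
   zeta^l_y be the functional P |-> D^l(P o psi)(y). At interior points zeta^(i,l)_y is a limit of
   difference quotients of zeta^l, and the corresponding values of f stay bounded, since otherwise
   rescaling would put (0, 1) in the gradient of f; so each zeta^l_y with |l| <= p acquires a
   value G_l(y), at interior points after p iterations and on all of Y after one more. The
   Taylor remainder at (y, z) of the field G is the value of c (zeta^l_z - theta), with theta in the
   fibre over y, and by Taylor's formula for P o psi these functionals tend to 0; if Whitney's
   condition failed, a suitable c would produce (0, nonzero) after one further iteration. As
   p + 2 <= 2 (r + 1), no stabilisation theorem is needed. Whitney's extension theorem then
   extends f locally, and cut-off functions glue the local extensions. *)

Require Import Defs.
From HB Require Import structures.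
From mathcomp Require Import all_boot all_order all_algebra.
From mathcomp Require Import all_classical all_reals all_analysis.
From mathcomp Require Import ring lra zify.
Import Order.TTheory GRing.Theory Num.Theory.
Import numFieldNormedType.Exports.
Local Open Scope classical_set_scope.
Local Open Scope ring_scope.
Set Implicit Arguments.
Unset Strict Implicit.
Unset Printing Implicit Defensive.

(** * Calculus of C^p functions *)

(** The exponents decide everything. The functional $\zeta^l_z$ kills $(x-\psi(z))^\alpha$ for
    $|\alpha|>|l|$, so $c\,\zeta^l_z$ meets the smallness condition of $\Delta\Phi$ at
    $(\psi(y),\psi(z))$ once $|c|\,|z-y|^{p-|l|}$ is below a local constant ([small_zeta]). For
    difference quotients $c\sim 1/t$, which is admissible because $|l|<p$; for Whitney's condition
    $c\sim|z-y|^{-(p-|l|)}$, exactly the power in the remainder to be bounded. The other summand of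
    $\Delta\Phi$ carries no restriction and absorbs the Taylor polynomial $\theta$.
    Single-valuedness enters at the zero functional: a pair $(0,\lambda)$ in one of the first $p+2$
    iterates forces $\lambda=0$. As the fibres are linear, this gives boundedness of the
    approximating values, uniqueness of $G_l(y)$, and Whitney's condition. The count $p+2\le 2(r+1)$
    uses $r\ge p+1$, true for $n\ge1$; $n=0$ is treated apart. Derivatives are indexed by words
    rather than multi-indices, so that inductions add one letter at a time; symmetry of mixed
    derivatives makes the two pictures agree. The norm of a row vector is the maximum norm, compared
    with [enorm] where the bundles enter. *)

Lemma is_derive_edP (R : realType) (V : normedModType R) (F : V -> R) (x v : V) (D : R) : is_derive x v F D <->
  forall e : R, 0 < e -> exists2 d : R, 0 < d & forall t : R, `|t| < d ->
    `|F (t *: v + x) - F x - t * D| <= e * `|t|.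
Proof.
split.
  move=> [dF <-] e e0.
  have /cvgrPdist_le /(_ _ e0) /nbhs_normP [d /= d0 hd] := dF.
  exists d => // t td; have [->|t0] := eqVneq t 0.
    by rewrite scale0r add0r subrr mul0r subr0 normr0 mulr0.
  have := hd t; rewrite /= sub0r normrN => /(_ td t0).
  rewrite -/(derive F x v) distrC => h.
  have -> : F (t *: v + x) - F x - t * 'D_v F x =
      t * (t^-1 *: (F (t *: v + x) - F x) - 'D_v F x).
    by rewrite mulrBr -[t^-1 *: _]/(t^-1 * _) mulrA divff // mul1r.
  by rewrite normrM mulrC ler_wpM2r.
move=> h.
have c : (fun t => t^-1 *: (F (t *: v + x) - F x)) t @[t --> 0^'] --> D.
  apply/cvgrPdist_le => e /h [d d0 hd]; apply/nbhs_normP.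
  exists d => //= t /=; rewrite sub0r normrN => td t0.
  rewrite distrC -(ler_pM2r (_ : 0 < `|t|)) ?normr_gt0 // -normrM.
  apply: le_trans (hd t td).
  by rewrite mulrBl -[t^-1 *: _]/(t^-1 * _) mulrAC mulVf // mul1r [D * t]mulrC.
by split; [apply/cvg_ex; exists D|apply: cvg_lim].
Qed.

Section Calculus.
Variables (R : realType) (n : nat).
Implicit Types (x y z v : 'rV[R]_n) (F G : 'rV[R]_n -> R) (U : set 'rV[R]_n) (p q : nat).

Lemma coord_le_norm x i : `|x ord0 i| <= `|x|.
Proof.
rewrite [leRHS]mx_normrE; apply: (le_trans _ (le_bigmax _ _ (ord0, i))) => //=.
Qed.

Lemma norm_le_coord x (e : R) : 0 <= e -> (forall i, `|x ord0 i| <= e) -> `|x| <= e.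
Proof.
move=> e0 h; rewrite [leLHS]mx_normrE; apply: bigmax_le => // -[i j] _ /=.
by rewrite (ord1 i).
Qed.

Lemma norm_ei_le (i : 'I_n) : `|ei R i| <= 1.
Proof.
apply: norm_le_coord => // j; rewrite /ei mxE eqxx /=.
by case: (j == i); rewrite ?normr1 ?normr0.
Qed.

Lemma near_edP x (P : 'rV[R]_n -> Prop) : (\forall y \near x, P y) <->
  exists2 d : R, 0 < d & forall y, `|y - x| < d -> P y.
Proof.
split.
  by move=> /(@nbhs_normP R _ x P) [d /= d0 hd]; exists d => // y; rewrite distrC => /hd.
by move=> [d d0 hd]; apply/(@nbhs_normP R _ x P); exists d => //= y /=; rewrite distrC => /hd.
Qed.

Lemma continuous_edP F x : {for x, continuous F} <->
  forall e : R, 0 < e -> exists2 d : R, 0 < d & forall y, `|y - x| < d -> `|F y - F x| < e.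
Proof.
split.
  move=> c e e0; have c' : F @ (nbhs x) --> F x by exact: c.
  have [d d0 hd] := (near_edP x _).1 (@cvgr_dist_lt R R _ _ _ F (F x) c' e e0).
  by exists d => // y yx; rewrite distrC; apply: hd.
move=> h; apply/(@cvgrPdist_lt R R _ (nbhs x) _ F (F x)) => e /h [d d0 hd].
by apply: (near_edP x _).2; exists d => // y /hd; rewrite distrC.
Qed.

Lemma open_ball_sub U x : open U -> U x ->
  exists2 r : R, 0 < r & forall y, `|y - x| < r -> U y.
Proof.
move=> oU Ux; exact/(near_edP x U)/open_nbhs_nbhs.
Qed.

Lemma open_ballP U :
  (forall x, U x -> exists2 r : R, 0 < r & forall y, `|y - x| < r -> U y) -> open U.
Proof.
move=> h; rewrite openE => x /h hx; exact/(near_edP x U).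
Qed.

Lemma open_ball_normr x (r : R) : open [set y | `|y - x| < r].
Proof.
apply: open_ballP => y /= yx; exists (r - `|y - x|); first by rewrite subr_gt0.
move=> z zy; have := ler_distD y z x; lra.
Qed.

(* Equivalent to [Cp_on p U F], see [Ck_Cp_on]; peeling off the innermost derivative
   first is what makes inductions on p work. *)
Fixpoint Ck p U F : Prop :=
  (forall x, U x -> {for x, continuous F}) /\
  match p with
  | 0 => True
  | q.+1 => forall i, (forall x, U x -> derivable F x (ei R i)) /\
                      Ck q U (fun x => 'D_(ei R i) F x)
  end.

Lemma pder_rcons F l i : pder F (rcons l i) = pder (fun x => 'D_(ei R i) F x) l.
Proof. by elim: l => //= j l ->. Qed.

Lemma Ck_cont p U F x : Ck p U F -> U x -> {for x, continuous F}.
Proof. by case: p => [|p] [h _] Ux; apply: h. Qed.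

Lemma Ck_Cp_on p U F : Ck p U F <-> Cp_on p U F.
Proof.
elim: p F => [|p IH] F; split.
- by move=> [h _] [|i l].
- by move=> /(_ [::] isT) [h _].
- move=> [c h]; elim/last_ind => [_|l i _].
    by split=> // _ x Ux i; case: (h i) => d _; apply: d.
  rewrite size_rcons pder_rcons !ltnS => sl; case: (h i) => _ /IH /(_ l sl).
  by [].
- move=> h; split; first by case: (h [::]).
  move=> i; split; first by case: (h [::]) => // _ d x Ux; apply: d.
  apply/IH => l sl; have := h (rcons l i); rewrite size_rcons pder_rcons ltnS.
  by apply.
Qed.

Lemma Ck_pder p U F l : Ck (p + size l) U F -> Ck p U (pder F l).
Proof.
elim/last_ind: l F => [|l i IH] F; first by rewrite addn0.
by rewrite size_rcons pder_rcons addnS => -[_ /(_ i) [_]] /IH.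
Qed.

Lemma Ck_le p q U F : (p <= q)%N -> Ck q U F -> Ck p U F.
Proof.
move=> pq /Ck_Cp_on h; apply/Ck_Cp_on => l sl; have [c d] := h l (leq_trans sl pq).
by split => // s; apply: d; apply: leq_trans pq.
Qed.

Lemma Ck_sub p U V F : V `<=` U -> Ck p U F -> Ck p V F.
Proof.
move=> VU /Ck_Cp_on h; apply/Ck_Cp_on => l sl; have [c d] := h l sl.
by split => [x /VU|s x /VU]; [apply: c|apply: d].
Qed.

Lemma pder_eq U F G l : open U -> (forall x, U x -> F x = G x) ->
  forall x, U x -> pder F l x = pder G l x.
Proof.
move=> oU; elim: l => [//|i l IH] h x Ux /=; apply: near_eq_derive.
by apply: (filterS _ (open_nbhs_nbhs (conj oU Ux))) => y Uy; apply: IH.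
Qed.

Lemma continuous_eq_open U F G x : open U -> U x -> (forall y, U y -> F y = G y) ->
  {for x, continuous F} -> {for x, continuous G}.
Proof.
move=> oU Ux h /continuous_edP c; apply/continuous_edP => e /c [d d0 hd].
have [r r0 hr] := open_ball_sub oU Ux.
exists (Num.min d r) => [|y]; first by rewrite lt_min d0.
by rewrite lt_min => /andP [/hd + /hr Uy]; rewrite !h.
Qed.

Lemma Ck_eq p U F G : open U -> (forall x, U x -> F x = G x) -> Ck p U F -> Ck p U G.
Proof.
move=> oU; elim: p F G => [|p IH] F G h.
  by move=> [c _]; split=> // x Ux; apply: (continuous_eq_open oU Ux h); apply: c.
move=> [c d]; split.
  by move=> x Ux; apply: (continuous_eq_open oU Ux h); apply: c.
move=> i; have [d1 d2] := d i; split.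
  move=> x Ux; apply: (near_eq_derivable _ (d1 x Ux)).
  by apply: (filterS _ (open_nbhs_nbhs (conj oU Ux))) => y Uy; apply: h.
apply: (IH _ _ _ d2) => x Ux; apply: near_eq_derive.
by apply: (filterS _ (open_nbhs_nbhs (conj oU Ux))) => y Uy; apply: h.
Qed.

Lemma Ck_local p U F :
  (forall x, U x -> exists V, [/\ open V, V x & Ck p V F]) -> Ck p U F.
Proof.
move=> h; apply/Ck_Cp_on => l sl; split.
  move=> x /h [V [_ Vx /Ck_Cp_on /(_ l sl) [c _]]]; exact: c.
move=> s x /h [V [_ Vx /Ck_Cp_on /(_ l sl) [_ d]]]; exact: d.
Qed.

Lemma Ck_intro p U F (D : 'I_n -> 'rV[R]_n -> R) : open U ->
  (forall x, U x -> {for x, continuous F}) ->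
  (forall i x, U x -> is_derive x (ei R i) F (D i x)) ->
  (forall i, Ck p U (D i)) -> Ck p.+1 U F.
Proof.
move=> oU c d h; split=> // i; split; first by move=> x /d-/(_ i)[].
by apply: Ck_eq (h i) => // x /(d i) [_ ->].
Qed.

Lemma Ck_is_derive p U F x i : Ck p.+1 U F -> U x ->
  is_derive x (ei R i) F ('D_(ei R i) F x).
Proof. by move=> [_ /(_ i) [d _]] Ux; apply: derivableP; apply: d. Qed.

Lemma Ck_D p U F i : Ck p.+1 U F -> Ck p U (fun x => 'D_(ei R i) F x).
Proof. by move=> [_ /(_ i) [_]]. Qed.

Lemma Ck_cst p U (c : R) : open U -> Ck p U (fun=> c).
Proof.
move=> oU; elim: p c => [|p IH] c.
  by split=> // x _; apply: cst_continuous.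
apply: (Ck_intro (D := fun _ _ => 0)) => //.
  by move=> x _; apply: cst_continuous.
Qed.

Lemma Ck_add p U F G : open U -> Ck p U F -> Ck p U G -> Ck p U (fun x => F x + G x).
Proof.
move=> oU; elim: p F G => [|p IH] F G hF hG.
  by split=> // x Ux; exact: (continuousD (Ck_cont hF Ux) (Ck_cont hG Ux)).
apply: (Ck_intro (D := fun i x => 'D_(ei R i) F x + 'D_(ei R i) G x)) => //.
- by move=> x Ux; exact: (continuousD (Ck_cont hF Ux) (Ck_cont hG Ux)).
- by move=> i x Ux; exact: (is_deriveD (Ck_is_derive i hF Ux) (Ck_is_derive i hG Ux)).
- by move=> i; apply: IH; apply: Ck_D.
Qed.

Lemma Ck_mul p U F G : open U -> Ck p U F -> Ck p U G -> Ck p U (fun x => F x * G x).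
Proof.
move=> oU; elim: p F G => [|p IH] F G hF hG.
  by split=> // x Ux; exact: (continuousM (Ck_cont hF Ux) (Ck_cont hG Ux)).
apply: (Ck_intro
  (D := fun i x => F x * 'D_(ei R i) G x + G x * 'D_(ei R i) F x)) => //.
- by move=> x Ux; exact: (continuousM (Ck_cont hF Ux) (Ck_cont hG Ux)).
- by move=> i x Ux; exact: (is_deriveM (Ck_is_derive i hF Ux) (Ck_is_derive i hG Ux)).
- move=> i; apply: Ck_add => //; apply: IH.
  + exact: Ck_le (leqnSn p) hF.
  + exact: Ck_D.
  + exact: Ck_le (leqnSn p) hG.
  + exact: Ck_D.
Qed.

Lemma Ck_scale p U F (c : R) : open U -> Ck p U F -> Ck p U (fun x => c * F x).
Proof. by move=> oU; apply: Ck_mul => //; apply: Ck_cst. Qed.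

Lemma Ck_sub_fun p U F G : open U -> Ck p U F -> Ck p U G -> Ck p U (fun x => F x - G x).
Proof.
move=> oU hF hG; apply: (@Ck_eq p U (fun x => F x + (-1) * G x)) => //.
  by move=> x _; rewrite mulN1r.
by apply: Ck_add => //; apply: Ck_scale.
Qed.

Lemma Ck_sum (I : Type) (r : seq I) (P : pred I) p U (F : I -> 'rV[R]_n -> R) :
  open U -> (forall i, P i -> Ck p U (F i)) -> Ck p U (fun x => \sum_(i <- r | P i) F i x).
Proof.
move=> oU h; elim: r => [|i r IH].
  by apply: Ck_eq (Ck_cst p 0 oU) => // x _; rewrite big_nil.
apply: (@Ck_eq _ _ (fun x => (if P i then F i x else 0) + \sum_(i <- r | P i) F i x)) => //.
  by move=> x _; rewrite big_cons; case: (P i); rewrite ?add0r.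
apply: Ck_add => //; case Pi : (P i); [exact: h|exact: Ck_cst].
Qed.

Lemma Ck_prod (I : Type) (r : seq I) (P : pred I) p U (F : I -> 'rV[R]_n -> R) :
  open U -> (forall i, P i -> Ck p U (F i)) -> Ck p U (fun x => \prod_(i <- r | P i) F i x).
Proof.
move=> oU h; elim: r => [|i r IH].
  by apply: Ck_eq (Ck_cst p 1 oU) => // x _; rewrite big_nil.
apply: (@Ck_eq _ _ (fun x => (if P i then F i x else 1) * \prod_(i <- r | P i) F i x)) => //.
  by move=> x _; rewrite big_cons; case: (P i); rewrite ?mul1r.
apply: Ck_mul => //; case Pi : (P i); [exact: h|exact: Ck_cst].
Qed.

Lemma Ck_exp p U F k : open U -> Ck p U F -> Ck p U (fun x => F x ^+ k).
Proof.
move=> oU h; elim: k => [|k IH]; first exact: Ck_cst.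
by apply: (@Ck_eq _ _ (fun x => F x * F x ^+ k)); [|move=> x _; rewrite exprS|apply: Ck_mul].
Qed.

Lemma is_derive_coord x i j :
  is_derive x (ei R i) (fun y : 'rV[R]_n => y ord0 j) ((j == i)%:R).
Proof.
apply/is_derive_edP => e e0; exists 1 => // t _.
rewrite /ei !mxE eqxx /= addrK subrr normr0; exact: mulr_ge0 (ltW e0) _.
Qed.

Lemma Ck_coord p U j : open U -> Ck p U (fun x => x ord0 j).
Proof.
move=> oU; have c x : {for x, continuous (fun x : 'rV[R]_n => x ord0 j)}.
  exact: coord_continuous.
case: p => [|p]; first by split.
apply: (Ck_intro (D := fun i _ => (j == i)%:R)) => //.
  by move=> i x _; apply: is_derive_coord.
by move=> i; apply: Ck_cst.
Qed.

Lemma pder_add U F G l : open U -> Ck (size l) U F -> Ck (size l) U G ->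
  forall x, U x -> pder (fun x => F x + G x) l x = pder F l x + pder G l x.
Proof.
move=> oU; elim/last_ind: l F G => [//|l i IH] F G; rewrite size_rcons => hF hG x Ux.
rewrite !pder_rcons -IH //; try exact: Ck_D.
apply: (pder_eq _ oU) => // y Uy.
exact: (@derive_val _ _ _ _ _ _ _ (is_deriveD (Ck_is_derive i hF Uy) (Ck_is_derive i hG Uy))).
Qed.

Lemma pder_scale U F (c : R) l : open U -> Ck (size l) U F ->
  forall x, U x -> pder (fun x => c * F x) l x = c * pder F l x.
Proof.
move=> oU; elim/last_ind: l F => [//|l i IH] F; rewrite size_rcons => hF x Ux.
rewrite !pder_rcons -IH //; try exact: Ck_D.
apply: (pder_eq _ oU) => // y Uy.
exact: (@derive_val _ _ _ _ _ _ _ (is_deriveZ c (Ck_is_derive i hF Uy))).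
Qed.

Lemma pder_sub U F G l : open U -> Ck (size l) U F -> Ck (size l) U G ->
  forall x, U x -> pder (fun x => F x - G x) l x = pder F l x - pder G l x.
Proof.
move=> oU hF hG x Ux.
rewrite (@pder_eq U _ (fun x => F x + (-1) * G x)) //; last first.
  by move=> y _; rewrite mulN1r.
by rewrite (pder_add oU) // ?(pder_scale _ oU) // ?mulN1r //; apply: Ck_scale.
Qed.

Lemma pder_cst (c : R) l x : pder (fun=> c) l x = if l is [::] then c else 0.
Proof.
elim: l x => [//|i l IH] x /=; case: l IH => [|j l] IH; first exact: derive_cst.
by rewrite (_ : pder _ _ = cst 0) ?derive_cst //; apply/funext => y; rewrite IH.
Qed.

Lemma pder_sum (I : Type) (r : seq I) (P : pred I) U (F : I -> 'rV[R]_n -> R) l :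
  open U -> (forall i, P i -> Ck (size l) U (F i)) -> forall x, U x ->
  pder (fun x => \sum_(i <- r | P i) F i x) l x = \sum_(i <- r | P i) pder (F i) l x.
Proof.
move=> oU h x Ux; elim: r => [|i r IH].
  rewrite (@pder_eq U _ (fun=> 0)) // ?pder_cst ?big_nil; last by move=> y _; rewrite big_nil.
  by case: l {h}.
rewrite (@pder_eq U _ (fun x => (if P i then F i x else 0) + \sum_(i <- r | P i) F i x)) //.
  rewrite (pder_add oU) //; last exact: Ck_sum.
    rewrite IH big_cons; case: (P i) => //=.
    by rewrite pder_cst; case: l {h IH} => [|? ?]; rewrite add0r.
  case Pi : (P i); [exact: h|exact: Ck_cst].
by move=> y _; rewrite big_cons; case: (P i); rewrite ?add0r.
Qed.

End Calculus.

(** Makes a choice of radius uniform over a finite index type: coordinates, multi-indices,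
    interpolation nodes or tuples of letters. *)
Lemma fin_min (R : realType) (I : finType) (Q : I -> R -> Prop) :
  (forall i, exists2 d, 0 < d & Q i d) ->
  (forall i d d', 0 < d' -> d' <= d -> Q i d -> Q i d') ->
  exists2 d, 0 < d & forall i, Q i d.
Proof.
move=> h m; have [f hf] : {f : I -> R & forall i, 0 < f i /\ Q i (f i)}.
  by apply: (@choice _ _ (fun i d => 0 < d /\ Q i d)) => i; have [d d0 Qd] := h i; exists d.
pose d := \big[Num.min/1]_i f i.
have d0 : 0 < d.
  rewrite /d; elim/big_ind: _ => // [x y x0 y0|i _]; first by rewrite lt_min x0.
  by have [] := hf i.
exists d => // i; have [_ Qi] := hf i; apply: m Qi => //.
exact: bigmin_le_cond.
Qed.

Lemma dist_half (R : realType) (a b c c' e : R) :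
  c = c' -> `|c - b| < e / 2 -> `|c' - a| < e / 2 -> `|a - b| <= e.
Proof. by move=> <-; rewrite (distrC c a) => h1 h2; have := ler_distD c a b; lra. Qed.

(** * Mean value estimates, the chain rule and symmetry of mixed derivatives *)

Section MeanValue.
Variables (R : realType) (n : nat).
Implicit Types (x y z v : 'rV[R]_n) (F G : 'rV[R]_n -> R) (U : set 'rV[R]_n) (p q : nat).

Lemma is_derive_line F x v (s D : R) : is_derive (s *: v + x) v F D ->
  is_derive s 1 (fun t : R => F (t *: v + x)) D.
Proof.
move=> /is_derive_edP h; apply/is_derive_edP => e /h [d d0 hd]; exists d => // t /hd.
by rewrite addrA -scalerDl [t *: 1]mulr1.
Qed.

Lemma mvt_dir F x v (t : R) (D : R -> R) :
  (forall s : R, `|s| <= `|t| -> is_derive (s *: v + x) v F (D s)) ->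
  exists2 c, `|c| <= `|t| & F (t *: v + x) - F x = t * D c.
Proof.
move=> h; pose g (s : R) := F (s *: v + x).
have hg (s : R) : `|s| <= `|t| -> is_derive s 1 g (D s).
  by move=> /h; apply: is_derive_line.
have cg (a b : R) : (forall s, s \in `[a, b]%R -> `|s| <= `|t|) ->
    {within `[a, b], continuous g}.
  move=> ab; apply: derivable_within_continuous => s /ab /hg [] //.
have g0 : F x = g 0 by rewrite /g scale0r add0r.
rewrite g0 -/(g t); have [t0|t0] := leP 0 t.
  have ab s : s \in `[0, t]%R -> `|s| <= `|t|.
    by rewrite in_itv /= => /andP [s0 st]; rewrite !ger0_norm // (le_trans s0).
  have [c cab ->] := @MVT_segment _ g D 0 t t0 (fun s hs => hg s (ab s (subset_itv_oo_cc hs))) (cg _ _ ab).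
  by exists c; [apply: ab|rewrite subr0 mulrC].
have ab s : s \in `[t, 0]%R -> `|s| <= `|t|.
  by rewrite in_itv /= => /andP [s0 st]; rewrite !ler0_norm ?lerN2 // ltW.
have [c cab e] := @MVT_segment _ g D t 0 (ltW t0) (fun s hs => hg s (ab s (subset_itv_oo_cc hs))) (cg _ _ ab).
exists c; first exact: ab.
by rewrite -[LHS]opprB e sub0r mulrN opprK mulrC.
Qed.

(** The path from [a] to [x] changes one coordinate at a time. In the maximum norm all its points
    stay in the ball, so control of the partial derivatives suffices; the factor [n] counts the
    steps. *)
Lemma mvt_bound F a (r A : R) : 0 <= A ->
  (forall x, `|x - a| <= r -> forall i, derivable F x (ei R i) /\ `|'D_(ei R i) F x| <= A) ->
  forall x, `|x - a| <= r -> `|F x - F a| <= n%:R * A * `|x - a|.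
Proof.
move=> A0 h x xa.
pose y (k : nat) : 'rV[R]_n := \row_j (if (j < k)%N then x ord0 j else a ord0 j).
have y0 : y 0%N = a by apply/rowP => j; rewrite mxE.
have yn : y n = x by apply/rowP => j; rewrite mxE ltn_ord.
rewrite -{1}yn -{1}y0 -(telescope_sumr (fun k => F (y k))) //.
rewrite big_mkord; apply: le_trans (ler_norm_sum _ _ _) _.
rewrite -mulrA -[n in n%:R]card_ord -sum1_card natr_sum mulr_suml.
apply: ler_sum => k _; rewrite mul1r.
set t := x ord0 k - a ord0 k.
have tx : `|t| <= `|x - a| by have := coord_le_norm (x - a) k; rewrite !mxE.
have -> : y k.+1 = t *: ei R k + y k.
  apply/rowP => j; rewrite !mxE /= ltnS leq_eqVlt.
  have [->|jk] := eqVneq j k; first by rewrite eqxx /= ltnn mulr1 /t subrK.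
  by rewrite mulr0 add0r (negPf (jk : j != k :> nat)).
have hs s : `|s| <= `|t| -> `|s *: ei R k + y k - a| <= r.
  move=> st; apply: le_trans xa; apply: norm_le_coord => // j; rewrite !mxE /=.
  have [->|jk] := eqVneq j k.
    by rewrite mulr1 ltnn addrK (le_trans st).
  rewrite mulr0 add0r; case: ifP => _; last by rewrite subrr normr0.
  by have := coord_le_norm (x - a) j; rewrite !mxE.
have [c ct ->] := @mvt_dir F (y k) (ei R k) t (fun s => 'D_(ei R k) F (s *: ei R k + y k))
  (fun s st => derivableP ((h _ (hs s st) k).1)).
rewrite normrM mulrC; apply: ler_pM => //.
exact: (h _ (hs c ct) k).2.
Qed.

(** After subtracting the linear part at [y], the partial derivatives are small near [y] by
    continuity, and [mvt_bound] applies. *)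
Lemma differentiable_C1 F U y : open U -> U y -> Ck 1 U F ->
  forall e : R, 0 < e -> exists2 d : R, 0 < d & forall z, `|z - y| < d ->
   `|F z - F y - \sum_j 'D_(ei R j) F y * (z ord0 j - y ord0 j)| <= e * `|z - y|.
Proof.
(* Absorbs the factor [n] of [mvt_bound]; the successor keeps the denominator positive when [n] is
   0. *)
move=> oU Uy h e e0; pose e' := e / n.+1%:R.
have e'0 : 0 < e' by rewrite divr_gt0.
have [d d0 hd] : exists2 d : R, 0 < d & forall i : 'I_n, forall z, `|z - y| < d ->
    U z /\ `|'D_(ei R i) F z - 'D_(ei R i) F y| < e'.
  apply: (@fin_min R 'I_n (fun i d => forall z, `|z - y| < d ->
      U z /\ `|'D_(ei R i) F z - 'D_(ei R i) F y| < e')).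
    move=> i; have /continuous_edP /(_ _ e'0) [d d0 hd] := Ck_cont (Ck_D i h) Uy.
    have [r r0 hr] := open_ball_sub oU Uy.
    exists (Num.min d r) => [|z]; first by rewrite lt_min d0.
    by rewrite lt_min => /andP [/hd ? /hr].
  by move=> i d d' _ dd' hd z zd'; apply: hd; apply: lt_le_trans dd'.
exists d => // z zy.
pose G w := F w - \sum_j 'D_(ei R j) F y * w ord0 j.
have dG w i : U w -> is_derive w (ei R i) G ('D_(ei R i) F w - 'D_(ei R i) F y).
  move=> Uw; have -> : G = F - \sum_j ('D_(ei R j) F y \*: (fun w : 'rV[R]_n => w ord0 j)).
    by apply/funext => u; rewrite /G -[in RHS]/((_ - _) u) /= fct_sumE.
  have hs : is_derive w (ei R i) (\sum_j ('D_(ei R j) F y \*: (fun w : 'rV[R]_n => w ord0 j)))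
      (\sum_j ('D_(ei R j) F y * (j == i)%:R)).
    by apply: is_derive_sum => j; apply: is_deriveZ; apply: is_derive_coord.
  have e1 : \sum_j ('D_(ei R j) F y * (j == i)%:R) = 'D_(ei R i) F y.
    by rewrite (bigD1 i) //= eqxx mulr1 big1 ?addr0 // => j /negPf ->; rewrite mulr0.
  by rewrite e1 in hs; exact: (is_deriveB (Ck_is_derive i h Uw) hs).
have := @mvt_bound G y (`|z - y|) e' (ltW e'0) _ z (lexx _).
have -> : G z - G y = F z - F y - \sum_j 'D_(ei R j) F y * (z ord0 j - y ord0 j).
  rewrite /G; under [in RHS]eq_bigr do rewrite mulrBr.
  rewrite sumrB; ring.
move=> H; apply: le_trans (H _) _.
  move=> w wz i; have [Uw b] := hd i w (le_lt_trans wz zy).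
  by have [d1 ->] := dG w i Uw; split => //; apply: ltW.
apply: ler_wpM2r => //; rewrite /e' mulrCA ler_piMr ?(ltW e0) //.
by rewrite ler_pdivrMr // mul1r ler_nat.
Qed.

Lemma is_derive_comp F U (phi : 'rV[R]_n -> 'rV[R]_n) x v (D : 'I_n -> R) :
  open U -> Ck 1 U F -> U (phi x) ->
  (forall j, is_derive x v (fun y => phi y ord0 j) (D j)) ->
  is_derive x v (fun y => F (phi y)) (\sum_j 'D_(ei R j) F (phi x) * D j).
Proof.
move=> oU hF Ux hphi; apply/is_derive_edP => e e0.
(* [B] bounds the growth rate of [phi] along [v], its extra 1 covering the error [e2 <= 1], and [C]
   bounds the gradient of [F]. Half of [e] pays for linearising [F], half for linearising [phi]. *)
pose B := \sum_j `|D j| + 1; pose C := \sum_j `|'D_(ei R j) F (phi x)|.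
have sD0 : 0 <= \sum_j `|D j| by apply: sumr_ge0.
have B0 : 0 < B by rewrite /B; lra.
have C0 : 0 <= C by apply: sumr_ge0.
have e1 : 0 < e / (2 * B) by rewrite divr_gt0 // mulr_gt0.
pose e2 := Num.min 1 (e / (2 * (C + 1))).
have e20 : 0 < e2 by rewrite lt_min ltr01 divr_gt0 // mulr_gt0 //; lra.
have [d1 d10 hd1] := differentiable_C1 oU Ux hF e1.
have [d2 d20 hd2] : exists2 d : R, 0 < d & forall j (t : R), `|t| < d ->
    `|phi (t *: v + x) ord0 j - phi x ord0 j - t * D j| <= e2 * `|t|.
  apply: (@fin_min R 'I_n (fun j d => forall t : R, `|t| < d ->
    `|phi (t *: v + x) ord0 j - phi x ord0 j - t * D j| <= e2 * `|t|)).
    by move=> j; have /is_derive_edP /(_ _ e20) := hphi j.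
  by move=> i d d' _ dd' hd t td; apply: hd; apply: lt_le_trans dd'.
exists (Num.min d2 (d1 / B)) => [|t]; first by rewrite lt_min d20 divr_gt0.
rewrite lt_min ltr_pdivlMr // => /andP [td2 td1].
set k := phi (t *: v + x) - phi x.
have kt : `|k| <= `|t| * B.
  apply: norm_le_coord => [|j]; first by rewrite mulr_ge0 // ltW.
  have := hd2 j t td2; rewrite /k !mxE => hj.
  have le1 : e2 * `|t| <= `|t| by rewrite ler_piMl // ge_min lexx.
  have : `|D j| <= \sum_j `|D j| by rewrite (bigD1 j) //= lerDl sumr_ge0.
  move=> /(ler_wpM2l (normr_ge0 t)); rewrite /B mulrDr mulr1 -normrM => h2.
  set u := (X in `|X - _| <= _) in hj; rewrite -[_ + _]/u.
  have := ler_normD (u - t * D j) (t * D j); rewrite subrK; lra.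
have := hd1 (phi (t *: v + x)); rewrite -/k => /(_ (le_lt_trans kt td1)).
set S1 := \sum_j _ => h1; set S2 := \sum_j _.
have h12 : `|S1 - t * S2| <= C * e2 * `|t|.
  rewrite /S1 /S2 mulr_sumr -sumrB; apply: le_trans (ler_norm_sum _ _ _) _.
  rewrite /C !mulr_suml; apply: ler_sum => j _.
  have := hd2 j t td2; rewrite mulrCA -mulrBr normrM -mulrA.
  exact: ler_wpM2l.
have : `|F (phi (t *: v + x)) - F (phi x) - t * S2| <=
   e / (2 * B) * `|k| + C * e2 * `|t|.
  apply: le_trans (lerD h1 h12).
  by apply: le_trans (ler_normD _ _); rewrite addrA subrK.
move=> /le_trans; apply.
have : e / (2 * B) * `|k| <= e / 2 * `|t|.
  have -> : e / 2 * `|t| = e / (2 * B) * (`|t| * B).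
    by field; rewrite gt_eqF.
  by apply: ler_wpM2l => //; apply: ltW.
have : C * e2 * `|t| <= e / 2 * `|t|.
  apply: ler_wpM2r => //; apply: (@le_trans _ _ ((C + 1) * (e / (2 * (C + 1))))).
    by apply: ler_pM => //; [exact: ltW|lra|rewrite ge_min lexx orbT].
  by rewrite le_eqVlt; apply/orP; left; apply/eqP; field; rewrite gt_eqF //; lra.
lra.
Qed.

Lemma continuous_compose F U (phi : 'rV[R]_n -> 'rV[R]_n) x :
  (forall j, {for x, continuous (fun x => phi x ord0 j)}) ->
  {for phi x, continuous F} -> {for x, continuous (fun x => F (phi x))}.
Proof.
move=> hphi /continuous_edP hF; apply/continuous_edP => e /hF [d d0 hd].
have d20 : 0 < d / 2 by rewrite divr_gt0.
have [r r0 hr] : exists2 r : R, 0 < r & forall j : 'I_n, forall y, `|y - x| < r ->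
    `|phi y ord0 j - phi x ord0 j| < d / 2.
  apply: (@fin_min R 'I_n (fun j r => forall y, `|y - x| < r ->
    `|phi y ord0 j - phi x ord0 j| < d / 2)).
    by move=> j; have /continuous_edP := hphi j; apply.
  by move=> i d1 d' _ dd' h1 t td; apply: h1; apply: lt_le_trans dd'.
exists r => // y yx; apply: hd.
apply: (@le_lt_trans _ _ (d / 2)); last lra.
apply: norm_le_coord => [|j]; first lra.
by have := hr j y yx; rewrite !mxE => /ltW.
Qed.

Lemma Ck_comp p U V F (phi : 'rV[R]_n -> 'rV[R]_n) : open U -> open V ->
  (forall x, U x -> V (phi x)) -> (forall j, Ck p U (fun x => phi x ord0 j)) ->
  Ck p V F -> Ck p U (fun x => F (phi x)).
Proof.
move=> oU oV UV; elim: p F => [|p IH] F hphi hF.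
  split=> // x Ux; apply: (@continuous_compose F U) => [j|].
    exact: (Ck_cont (hphi j) Ux).
  exact: (Ck_cont hF (UV x Ux)).
apply: (Ck_intro (D := fun i x =>
   \sum_j 'D_(ei R j) F (phi x) * 'D_(ei R i) (fun x => phi x ord0 j) x)) => //.
- move=> x Ux; apply: (@continuous_compose F U) => [j|].
    exact: (Ck_cont (hphi j) Ux).
  exact: (Ck_cont hF (UV x Ux)).
- move=> i x Ux; apply: is_derive_comp (oV) _ (UV x Ux) _; first exact: Ck_le hF.
  by move=> j; apply: Ck_is_derive (hphi j) Ux.
- move=> i; apply: Ck_sum => // j _; apply: Ck_mul => //; last exact: (Ck_D i (hphi j)).
  apply: (IH (fun y => 'D_(ei R j) F y)); last exact: Ck_D.
  by move=> k; apply: Ck_le (hphi k).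
Qed.

(** The mean value theorem is applied along [ei R i] to an increment in direction [j], then along
    [ei R j] to the derivative. The left side is symmetric in [i] and [j], so exchanging them gives
    the other mixed derivative, at another nearby point; [schwarz] lets both points tend to [x]. *)
Lemma second_difference U F x i j (t r : R) : open U -> Ck 2 U F ->
  (forall y, `|y - x| < r -> U y) -> 2 * `|t| < r ->
  exists2 w, `|w - x| <= 2 * `|t| &
   F (t *: ei R i + t *: ei R j + x) - F (t *: ei R i + x) - F (t *: ei R j + x) + F x
    = t * t * 'D_(ei R j) ('D_(ei R i) F) w.
Proof.
move=> oU hF hr tr; pose H w := F (w + t *: ei R j) - F w.
have nb (a b : R) : `|a| <= `|t| -> `|b| <= `|t| ->
    `|b *: ei R j + (a *: ei R i + x) - x| <= 2 * `|t|.
  move=> ha hb; rewrite addrA addrK; apply: le_trans (ler_normD _ _) _; rewrite !normrZ.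
  have hi := norm_ei_le R i; have hj := norm_ei_le R j.
  have := ler_pM (normr_ge0 _) (normr_ge0 _) ha hi.
  have := ler_pM (normr_ge0 _) (normr_ge0 _) hb hj.
  by rewrite !mulr1; lra.
have hU (a b : R) : `|a| <= `|t| -> `|b| <= `|t| -> U (b *: ei R j + (a *: ei R i + x)).
  by move=> ha hb; apply: hr; apply: le_lt_trans tr; apply: nb.
have hH (s : R) : `|s| <= `|t| -> is_derive (s *: ei R i + x) (ei R i) H
    ('D_(ei R i) F (t *: ei R j + (s *: ei R i + x)) - 'D_(ei R i) F (s *: ei R i + x)).
  move=> st; have h1 := Ck_is_derive i hF (hU s t st (lexx _)).
  have h2 := hU s 0 st; rewrite normr0 scale0r add0r in h2.
  have {}h2 := Ck_is_derive i hF (h2 (normr_ge0 _)).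
  apply: (is_deriveB _ h2); apply/is_derive_edP => e e0.
  move/is_derive_edP : h1 => /(_ e e0) [d d0 hd]; exists d => // u /hd.
  by rewrite !addrA -!(addrAC _ _ (t *: ei R j)) ![_ + t *: ei R j]addrC !addrA.
have [a ha] := mvt_dir hH.
have [b hb] := @mvt_dir ('D_(ei R i) F) (a *: ei R i + x) (ei R j) t
  (fun b => 'D_(ei R j) ('D_(ei R i) F) (b *: ei R j + (a *: ei R i + x)))
  (fun b hb => Ck_is_derive j (Ck_D i hF) (hU a b ha hb)).
move=> -> E; exists (b *: ei R j + (a *: ei R i + x)); first exact: nb.
rewrite -mulrA -E /H; have -> : t *: ei R i + x + t *: ei R j = t *: ei R i + t *: ei R j + x.
  by rewrite addrAC.
by rewrite (addrC x); ring.
Qed.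

Lemma schwarz U F x i j : open U -> U x -> Ck 2 U F ->
  'D_(ei R i) ('D_(ei R j) F) x = 'D_(ei R j) ('D_(ei R i) F) x.
Proof.
move=> oU Ux hF; apply/eqP; rewrite -subr_eq0 -normr_eq0 eq_le normr_ge0 andbT.
apply/ler_addgt0Pl => e e0; rewrite addr0.
have [r r0 hr] := open_ball_sub oU Ux.
have e20 : 0 < e / 2 by rewrite divr_gt0.
have /continuous_edP /(_ _ e20) [d1 d10 h1] := Ck_cont (Ck_D i (Ck_D j hF)) Ux.
have /continuous_edP /(_ _ e20) [d2 d20 h2] := Ck_cont (Ck_D j (Ck_D i hF)) Ux.
pose m := Num.min r (Num.min d1 d2); have m0 : 0 < m by rewrite !lt_min r0 d10.
pose t := m / 4.
have t0 : 0 < t by rewrite divr_gt0.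
have tm : 2 * `|t| < m by rewrite gtr0_norm // /t; lra.
have : [/\ 2 * `|t| < r, 2 * `|t| < d1 & 2 * `|t| < d2].
  by move: tm; rewrite !lt_min => /andP [-> /andP [-> ->]].
move=> [tr td1 td2].
have [w hw E] := second_difference i j oU hF hr tr.
have [w' hw' E'] := second_difference j i oU hF hr tr.
have : 'D_(ei R j) ('D_(ei R i) F) w = 'D_(ei R i) ('D_(ei R j) F) w'.
  apply: (@mulfI _ (t * t)); first by rewrite mulf_neq0 // gt_eqF.
  apply: (eq_trans (esym E)); apply: eq_trans E'.
  rewrite (addrC (t *: ei R j) (t *: ei R i)); congr (_ + _).
  by rewrite -!addrA; congr (_ + _); rewrite addrC.
move=> ww'.
exact: (dist_half ww' (h2 w (le_lt_trans hw td2)) (h1 w' (le_lt_trans hw' td1))).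
Qed.

(** The first letter of [l] is located in [l'] and carried to its front by adjacent transpositions,
    each an instance of [schwarz]. *)
Lemma pder_perm p U F l l' x : open U -> U x -> Ck p U F -> (size l <= p)%N ->
  perm_eq l l' -> pder F l x = pder F l' x.
Proof.
move=> oU Ux hF; elim: l l' x Ux => [|i l IH] l' x Ux sl /= hp.
  by move/perm_size : hp => /esym /size0nil ->.
have : i \in l' by rewrite -(perm_mem hp) mem_head.
move=> il; case/splitPr : il hp => l2 l3.
rewrite perm_sym -(cat1s i l3) perm_catCA /= perm_cons perm_sym => hp.
have s23 : (size (l2 ++ l3) < p)%N by rewrite -(perm_size hp).
transitivity (pder F (i :: l2 ++ l3) x).
  by apply: (@pder_eq _ _ U (pder F l) (pder F (l2 ++ l3)) [:: i]) => // y Uy; apply: IH => //; apply: ltnW.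
elim: l2 x Ux s23 {hp} => [//|j l2 IH2] x Ux s23 /=.
have h2 : Ck 2 U (pder F (l2 ++ l3)).
  apply: Ck_pder; apply: Ck_le hF; rewrite add2n; exact: s23.
rewrite -[LHS]/('D_(ei R i) ('D_(ei R j) (pder F (l2 ++ l3))) x) (schwarz i j oU Ux h2).
apply: (@pder_eq _ _ U (pder F (i :: l2 ++ l3)) _ [:: j]) => // y Uy.
by apply: IH2 => //; apply: ltnW.
Qed.

End MeanValue.

(** * Jets and Taylor polynomials *)

Section Jets.
Variables (R : realType) (n : nat).
Implicit Types (x y z a v : 'rV[R]_n) (F G : 'rV[R]_n -> R) (U : set 'rV[R]_n) (p q k : nat).
Implicit Types (J : seq 'I_n -> R) (l t : seq 'I_n).

Lemma pder_mul_rcons F G U l i x : open U -> U x -> Ck (size l).+1 U F -> Ck (size l).+1 U G ->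
  pder (fun x => F x * G x) (rcons l i) x =
  pder (fun x => F x * 'D_(ei R i) G x) l x + pder (fun x => G x * 'D_(ei R i) F x) l x.
Proof.
move=> oU Ux hF hG; rewrite pder_rcons -(pder_add oU) //.
- apply: (pder_eq _ oU) => // y Uy.
  exact: (@derive_val _ _ _ _ _ _ _ (is_deriveM (Ck_is_derive i hF Uy) (Ck_is_derive i hG Uy))).
- by apply: Ck_mul => //; [exact: Ck_le hF|exact: Ck_D].
- by apply: Ck_mul => //; [exact: Ck_le hG|exact: Ck_D].
Qed.

(** Leibniz' rule over words has [2 ^+ size l] terms, and the weights [H ^+ size l] multiply. A
    derivative of [F] obeys the same kind of bound with [C * H] for [C], which feeds the
    induction. *)
Lemma pder_mul_bound F G U x (C A H : R) k : open U -> U x -> 0 <= H ->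
  Ck k U F -> Ck k U G ->
  (forall l, (size l <= k)%N -> `|pder F l x| <= C * H ^+ size l) ->
  (forall l, (size l <= k)%N -> `|pder G l x| <= A * H ^+ size l) ->
  forall l, (size l <= k)%N ->
    `|pder (fun x => F x * G x) l x| <= 2 ^+ size l * (C * A) * H ^+ size l.
Proof.
move=> oU Ux H0; elim: k F G C A => [|k IH] F G C A hF hG bF bG.
  move=> [|//] _ /=; rewrite normrM expr0 mul1r mulr1.
  have := bF [::] isT; have := bG [::] isT; rewrite /= !mulr1 => ? ?.
  exact: ler_pM.
elim/last_ind => [_|l i _].
  rewrite /= normrM expr0 mul1r mulr1.
  have := bF [::] isT; have := bG [::] isT; rewrite /= !mulr1 => ? ?.
  exact: ler_pM.
rewrite size_rcons => sl; rewrite (pder_mul_rcons _ oU Ux); first last.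
- exact: Ck_le hG.
- exact: Ck_le hF.
have bD E c (bE : forall l, (size l <= k.+1)%N -> `|pder E l x| <= c * H ^+ size l) t :
    (size t <= k)%N -> `|pder (fun x => 'D_(ei R i) E x) t x| <= c * H * H ^+ size t.
  by move=> st; have := bE (rcons t i); rewrite size_rcons pder_rcons exprS mulrA; apply.
have b1 := IH _ _ _ _ (Ck_le (leqnSn k) hF) (Ck_D i hG)
   (fun t st => bF t (leqW st)) (bD _ _ bG) l sl.
have b2 := IH _ _ _ _ (Ck_le (leqnSn k) hG) (Ck_D i hF)
   (fun t st => bG t (leqW st)) (bD _ _ bF) l sl.
apply: le_trans (ler_normD _ _) _; apply: le_trans (lerD b1 b2) _.
by rewrite !exprS le_eqVlt; apply/orP; left; apply/eqP; ring.
Qed.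

(** Orders of vanishing at a point add under products; one derivative lowers one of the two orders
    by one. *)
Lemma pder_mul_vanish F G U x p j k : open U -> U x -> Ck p U F -> Ck p U G ->
  (forall l, (size l <= p)%N -> (size l < j)%N -> pder F l x = 0) ->
  (forall l, (size l <= p)%N -> (size l < k)%N -> pder G l x = 0) ->
  forall l, (size l <= p)%N -> (size l < j + k)%N -> pder (fun x => F x * G x) l x = 0.
Proof.
move=> oU Ux; elim: p F G j k => [|p IH] F G j k hF hG vF vG.
  move=> [|//] _ /=; case: j vF => [|j] vF; last by move=> _; rewrite [F x](vF [::]) // mul0r.
  by move=> k0; rewrite [G x](vG [::]) // mulr0.
elim/last_ind => [_|l i _].
  case: j vF => [|j] vF; last by move=> _; rewrite /= [F x](vF [::]) // mul0r.
  by move=> k0; rewrite /= [G x](vG [::]) // mulr0.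
rewrite size_rcons => sl slt; rewrite (pder_mul_rcons _ oU Ux); first last.
- exact: Ck_le hG.
- exact: Ck_le hF.
have vD E m (vE : forall l, (size l <= p.+1)%N -> (size l < m)%N -> pder E l x = 0) t :
    (size t <= p)%N -> (size t < m.-1)%N -> pder (fun x => 'D_(ei R i) E x) t x = 0.
  by move=> st sm; rewrite -pder_rcons; apply: vE; rewrite size_rcons //; case: m sm.
rewrite (IH _ _ j k.-1 (Ck_le (leqnSn p) hF) (Ck_D i hG)
   (fun t st => vF t (leqW st)) (vD _ _ vG) l sl); last by lia.
rewrite (IH _ _ k j.-1 (Ck_le (leqnSn p) hG) (Ck_D i hF)
   (fun t st => vG t (leqW st)) (vD _ _ vF) l sl); last by lia.
by rewrite addr0.
Qed.

(** Downward induction on the order of the derivative. Order [p] is bounded by assumption; each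
    lower order is its value at [y] plus the integral effect of the next order over a distance
    [M * h], which costs a factor [1 + n%:R * M]. This one estimate yields Taylor's formula, the
    comparison of Taylor polynomials, and the fact that a function with constant derivatives of
    order [p] is its own Taylor polynomial. *)
Lemma jet_growth p U F y (h M A : R) : 0 <= h -> 0 <= M -> 0 <= A -> Ck p U F ->
  (forall w, `|w - y| <= M * h -> U w) ->
  (forall l, (size l < p)%N -> `|pder F l y| <= A * h ^+ (p - size l)) ->
  (forall w l, `|w - y| <= M * h -> size l = p -> `|pder F l w| <= A) ->
  forall w l, `|w - y| <= M * h -> (size l <= p)%N ->
   `|pder F l w| <= (1 + n%:R * M) ^+ (p - size l) * (A * h ^+ (p - size l)).
Proof.
move=> h0 M0 A0 hF BU hy htop w l wy sl.
have [q eq] : exists q, (p - size l)%N = q by exists (p - size l)%N.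
have nM : 0 <= n%:R * M by rewrite mulr_ge0.
elim: q w l wy sl eq => [|q IH] w l wy sl eq; rewrite eq.
  by rewrite !expr0 mul1r mulr1; apply: htop => //; lia.
have slt : (size l < p)%N by lia.
pose B := (1 + n%:R * M) ^+ q * (A * h ^+ q).
have B0 : 0 <= B by rewrite !mulr_ge0 // exprn_ge0 //; lra.
have H : `|pder F l w - pder F l y| <= n%:R * B * `|w - y|.
  apply: (@mvt_bound _ _ _ _ (M * h)) => // z zy i; split.
    by have /Ck_Cp_on /(_ l sl) [_ /(_ slt)] := hF; apply; apply: BU.
  have e' : (p - size (i :: l))%N = q by rewrite /=; lia.
  by have := IH z (i :: l) zy slt e'; rewrite e'.
have := hy l slt; rewrite eq => hyl.
have {}H : `|pder F l w| <= A * h ^+ q.+1 + n%:R * B * (M * h).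
  have := ler_normD (pder F l w - pder F l y) (pder F l y); rewrite subrK.
  have : n%:R * B * `|w - y| <= n%:R * B * (M * h) by rewrite ler_wpM2l // mulr_ge0.
  lra.
apply: le_trans H _; have -> : n%:R * B * (M * h) = n%:R * M * (1 + n%:R * M) ^+ q * (A * h ^+ q.+1).
  by rewrite /B exprS; ring.
rewrite -{1}[A * _]mul1r -mulrDl; apply: ler_wpM2r; first by rewrite mulr_ge0 // exprn_ge0.
rewrite [leRHS]exprS mulrDl mul1r lerD2r; apply: exprn_ege1; lra.
Qed.

(* [Sk k J a x] is the sum of J l (x - a)^l over all words l of length k. Summing over
   words instead of multi-indices makes [Tay] the Taylor polynomial with the plain
   factors 1/k!, and its derivatives shift J by one letter when J is symmetric. *)
Fixpoint Sk k J a x : R :=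
  if k is k'.+1 then \sum_i (x ord0 i - a ord0 i) * Sk k' (fun t => J (i :: t)) a x else J [::].

Definition Tay p J a x : R := \sum_(k < p.+1) (k`!%:R)^-1 * Sk k J a x.

Definition sym_jet q J := forall l t, perm_eq l t -> (size l <= q)%N -> J l = J t.

Lemma Ck_Sk q k J a : Ck q setT (Sk k J a).
Proof.
elim: k J => [|k IH] J; first exact: Ck_cst openT.
apply: Ck_sum => [|i _]; first exact: openT.
apply: Ck_mul => //; first exact: openT.
by apply: Ck_sub_fun; [exact: openT|apply: Ck_coord; exact: openT|apply: Ck_cst; exact: openT].
Qed.

Lemma Ck_Tay q p J a : Ck q setT (Tay p J a).
Proof.
apply: Ck_sum => [|i _]; first exact: openT.
by apply: Ck_scale; [exact: openT|exact: Ck_Sk].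
Qed.

Lemma Sk_ext k J J' a x : (forall t, size t = k -> J t = J' t) -> Sk k J a x = Sk k J' a x.
Proof.
elim: k J J' => [|k IH] J J' h /=; first exact: h.
by apply: eq_bigr => i _; congr (_ * _); apply: IH => t st; apply: h; rewrite /= st.
Qed.

Lemma Tay_ext p J J' a x : (forall t, (size t <= p)%N -> J t = J' t) ->
  Tay p J a x = Tay p J' a x.
Proof.
move=> h; apply: eq_bigr => k _; congr (_ * _); apply: Sk_ext => t st.
by apply: h; rewrite st -ltnS.
Qed.

Lemma is_derive_Sk k J a x i : sym_jet k J ->
  is_derive x (ei R i) (Sk k J a) (k%:R * Sk k.-1 (fun t => J (i :: t)) a x).
Proof.
elim: k J => [|k IH] J sJ; first by rewrite mul0r; apply: is_derive_cst.
have sJ' j : sym_jet k (fun t => J (j :: t)).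
  by move=> l t lt sl; apply: sJ => //; rewrite perm_cons.
have -> : Sk k.+1 J a = \sum_j ((fun x => x ord0 j - a ord0 j) * Sk k (fun t => J (j :: t)) a).
  by apply/funext => y; rewrite fct_sumE.
have h : is_derive x (ei R i) (\sum_j ((fun x => x ord0 j - a ord0 j) * Sk k (fun t => J (j :: t)) a))
   (\sum_j ((x ord0 j - a ord0 j) * (k%:R * Sk k.-1 (fun t => J (j :: i :: t)) a x)
     + Sk k (fun t => J (j :: t)) a x * (j == i)%:R)).
  apply: is_derive_sum => j; apply: is_deriveM; last exact: (IH _ (sJ' j)).
  have := is_deriveB (is_derive_coord x i j) (is_derive_cst (a ord0 j) x (ei R i)).
  by rewrite subr0.
apply: (is_derive_eq h); rewrite big_split /=.
rewrite [X in _ + X](bigD1 i) //= eqxx mulr1 [X in _ + (_ + X)]big1 ?addr0; last first.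
  by move=> j /negPf ->; rewrite mulr0.
rewrite -natr1 mulrDl mul1r; congr (_ + _).
case: k {IH sJ' h} sJ => [|k] sJ /=; first by rewrite mul0r big1 // => j _; rewrite mul0r mulr0.
rewrite mulr_sumr; apply: eq_bigr => j _; rewrite mulrCA; congr (_ * (_ * _)).
apply: Sk_ext => t st; apply: sJ; last by rewrite /= st.
by rewrite -(cat1s j) -(cat1s i) -[_ :: _ :: t](cat1s i) -(cat1s j t) perm_catCA.
Qed.

Lemma is_derive_Tay p J a x i : sym_jet p J ->
  is_derive x (ei R i) (Tay p J a) (if p is p'.+1 then Tay p' (fun t => J (i :: t)) a x else 0).
Proof.
move=> sJ.
have -> : Tay p J a = \sum_(k < p.+1) ((k`!%:R)^-1 \*: Sk k J a).
  by apply/funext => y; rewrite fct_sumE.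
have h : is_derive x (ei R i) (\sum_(k < p.+1) ((k`!%:R)^-1 \*: Sk k J a))
   (\sum_(k < p.+1) (k`!%:R)^-1 * (k%:R * Sk k.-1 (fun t => J (i :: t)) a x)).
  apply: is_derive_sum => k; apply: is_deriveZ; apply: is_derive_Sk => l t lt sl.
  by apply: sJ => //; apply: leq_trans sl _; rewrite -ltnS.
apply: (is_derive_eq h); case: p {h} sJ => [|p] sJ.
  by rewrite big_ord_recl big_ord0 mul0r mulr0 addr0.
rewrite big_ord_recl mul0r mulr0 add0r; apply: eq_bigr => k _ /=.
rewrite mulrA; congr (_ * _); rewrite factS natrM invfM -mulrA mulrC -mulrA divff ?mulr1 //.
by rewrite pnatr_eq0.
Qed.

Lemma pder_Tay p J a l x : sym_jet p J ->
  pder (Tay p J a) l x =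
  if (size l <= p)%N then Tay (p - size l) (fun t => J (l ++ t)) a x else 0.
Proof.
elim/last_ind: l p J => [|l i IH] p J sJ; first by rewrite subn0.
rewrite pder_rcons size_rcons.
have -> : (fun y => 'D_(ei R i) (Tay p J a) y) =
   (fun y => if p is p'.+1 then Tay p' (fun t => J (i :: t)) a y else 0).
  by apply/funext => y; have [_ ->] := is_derive_Tay a y i sJ.
case: p sJ => [|p] sJ; first by rewrite pder_cst; case: l {IH}.
rewrite IH ?ltnS ?subSS.
  case: ifP => // sl; apply: Tay_ext => t st; apply: sJ; last by rewrite /= size_cat; lia.
  by rewrite -cats1 -catA perm_sym -(cat1s i (l ++ t)) perm_catCA.
by move=> l1 l2 l12 s1; apply: sJ => //; rewrite perm_cons.
Qed.

Lemma Tay_base p J a : Tay p J a a = J [::].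
Proof.
rewrite /Tay big_ord_recl /= fact0 invr1 mul1r big1 ?addr0 // => k _ /=.
by rewrite big1 ?mulr0 // => i _; rewrite subrr mul0r.
Qed.

Lemma Tay0 J a x : Tay 0 J a x = J [::].
Proof. by rewrite /Tay big_ord_recl big_ord0 /= fact0 invr1 mul1r addr0. Qed.

Lemma sym_pder p U F x : open U -> U x -> Ck p U F -> sym_jet p (fun l => pder F l x).
Proof. by move=> oU Ux hF l t lt sl; apply: (pder_perm oU Ux hF). Qed.

(** Uniformity in the base point [y] comes from the oscillation of the order-[p] derivatives near
    [y0]: the function minus its Taylor polynomial at [y] has zero jet at [y] and small derivatives
    of order [p], so [jet_growth] applies with [M = 1] and [h] the distance from [y] to [z]. *)
Lemma uniform_taylor p U F y0 : open U -> U y0 -> Ck p U F ->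
  forall e : R, 0 < e -> exists2 d : R, 0 < d & forall y z, `|y - y0| < d -> `|z - y0| < d ->
    [/\ U y, U z & forall l, (size l <= p)%N ->
     `|pder F l z - Tay (p - size l) (fun t => pder F (l ++ t) y) y z|
        <= e * `|z - y| ^+ (p - size l)].
Proof.
move=> oU Uy0 hF e e0.
have N0 : 0 < (1 + n%:R * 1) ^+ p :> R.
  by apply: exprn_gt0; rewrite mulr1; apply: (lt_le_trans ltr01); rewrite lerDl.
pose e' := e / (1 + n%:R * 1) ^+ p.
have e'0 : 0 < e' by rewrite divr_gt0.
have [d d0 hd] : exists2 d : R, 0 < d & forall l : p.-tuple 'I_n, forall w, `|w - y0| < d ->
    `|pder F l w - pder F l y0| < e' / 2.
  apply: (@fin_min R {: p.-tuple 'I_n} (fun (l : p.-tuple 'I_n) (d : R) => forall w, `|w - y0| < d ->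
     `|pder F l w - pder F l y0| < e' / 2)).
    move=> l; have /Ck_Cp_on /(_ l) := hF; rewrite size_tuple => /(_ (leqnn _)) [c _].
    have /continuous_edP := c y0 Uy0; apply; rewrite divr_gt0 //.
  by move=> i d d' _ dd' hd z zd'; apply: hd; apply: lt_le_trans dd'.
have [r r0 hr] := open_ball_sub oU Uy0.
pose m := Num.min d r; have m0 : 0 < m by rewrite lt_min d0.
(* The ball around [y] through [z] then stays within distance [m] of [y0]: its radius is below
   [2 * m / 3], and its centre is within [m / 3]. *)
exists (m / 3) => [|y z yd zd]; first by rewrite divr_gt0.
have hm w : `|w - y| <= 1 * `|z - y| -> `|w - y0| < m.
  rewrite mul1r => wy; have := ler_distD y w y0; have := ler_distD y0 z y.
  by rewrite (distrC y0 y); lra.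
have hmU w : `|w - y| <= 1 * `|z - y| -> U w.
  by move=> /hm; rewrite lt_min => /andP [_ /hr].
have Uy : U y by apply: hmU; rewrite subrr normr0 mul1r.
have Uz : U z by apply: hmU; rewrite mul1r.
split=> // l sl; pose J t := pder F t y.
have sJ : sym_jet p J by apply: sym_pder hF.
pose Q x := F x - Tay p J y x.
have hQ : Ck p U Q.
  by apply: Ck_sub_fun => //; apply: Ck_sub (Ck_Tay _ _ _ _).
have eQ t x : (size t <= p)%N -> U x ->
    pder Q t x = pder F t x - Tay (p - size t) (fun s => J (t ++ s)) y x.
  move=> st Ux; rewrite /Q (pder_sub oU) //; first by rewrite pder_Tay // st.
    exact: Ck_le hF.
  by apply: Ck_sub (Ck_Tay _ _ _ _).
have := @jet_growth p U Q y `|z - y| 1 e' (normr_ge0 _) ler01 (ltW e'0) hQ hmU.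
move=> H; have {H} := H _ _ z l _ sl; rewrite mul1r eQ //.
rewrite /J => H; apply: le_trans (H _ _ (lexx _)) _.
- move=> t st; rewrite eQ //; last exact: ltnW.
  rewrite Tay_base /J cats0 subrr normr0 mulr_ge0 ?exprn_ge0 //; exact: ltW.
- move=> w t wz st; rewrite mul1r in hm hmU; rewrite eQ ?st //; last exact: hmU.
  rewrite subnn Tay0 /J cats0.
  have h1 := hd (Tuple (introT eqP st)) w; have h2 := hd (Tuple (introT eqP st)) y.
  have {}h1 : `|pder F t w - pder F t y0| < e' / 2.
    by apply: h1; have := hm w wz; rewrite lt_min => /andP [].
  have {}h2 : `|pder F t y - pder F t y0| < e' / 2.
    by apply: h2; have := hm y; rewrite subrr normr0 => /(_ (normr_ge0 _)); rewrite lt_min => /andP [].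
  have := ler_distD (pder F t y0) (pder F t w) (pder F t y); rewrite (distrC (pder F t y0)); lra.
- rewrite mulrA ler_wpM2r ?exprn_ge0 // /e' mulrCA ler_piMr ?(ltW e0) //.
  rewrite ler_pdivrMr // mul1r ler_weXn2l ?leq_subr // mulr1 lerDl //.
Qed.

End Jets.

(** * Whitney's extension theorem *)

Section Bump.
Variables (R : realType) (n : nat).
Implicit Types (x y z a v c : 'rV[R]_n) (F G : 'rV[R]_n -> R) (U : set 'rV[R]_n) (p q k : nat).
Implicit Types (l : seq 'I_n).

Lemma norm_lt_coord x (e : R) : 0 < e -> (forall i, `|x ord0 i| < e) -> `|x| < e.
Proof.
move=> e0 h; rewrite [ltLHS]mx_normrE; apply: bigmax_lt => // -[i j] _ /=.
by rewrite (ord1 i).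
Qed.

Lemma is_derive_comp1 (f : R -> R) F x v (a b : R) :
  is_derive (F x) 1 f a -> is_derive x v F b -> is_derive x v (fun y => f (F y)) (a * b).
Proof.
move=> hf hF; have hF0 : is_derive (0 : R) 1 (fun t : R => F (t *: v + x)) b.
  by apply: is_derive_line; rewrite scale0r add0r.
have F0 : F (0 *: v + x) = F x by rewrite scale0r add0r.
have {}hf : is_derive (F (0 *: v + x)) 1 f a by rewrite F0.
have /is_derive_edP h := is_derive1_comp hf hF0.
apply/is_derive_edP => e /h [d d0 hd]; exists d => // t /hd.
by rewrite /= addr0 [t *: 1]mulr1 F0.
Qed.

Lemma is_derive_pospow k (t : R) :
  is_derive t 1 (fun s : R => Num.max s 0 ^+ k.+2) (k.+2%:R * Num.max t 0 ^+ k.+1).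
Proof.
have z0 m : m%:R * 0 ^+ k.+1 = 0 :> R by rewrite exprS mul0r mulr0.
have [t0|t0|->] := ltgtP t 0.
- rewrite z0.
  apply: (@near_eq_is_derive _ _ _ (fun=> 0)).
  apply: filterS (lt_nbhsl t0) => s s0.
  by rewrite (max_idPr (ltW s0)) expr0n.
- apply: (@near_eq_is_derive _ _ _ (fun s : R => s ^+ k.+2)).
    by apply: filterS (lt_nbhsr t0) => s s0; rewrite (max_idPl (ltW s0)).
  apply: DeriveDef; first exact: exprn_derivable.
  by rewrite exp_derive [_ *: 1]mulr1.
- rewrite z0; apply/is_derive_edP => e e0.
  exists (Num.min 1 e) => [|s]; first by rewrite lt_min ltr01.
  rewrite lt_min => /andP [/ltW s1 /ltW se].
  rewrite [s *: 1]mulr1 addr0 maxxx expr0n subr0 mulr0 subr0 normrX.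
  have m0 : 0 <= Num.max s 0 by rewrite le_max lexx orbT.
  have ms : `|Num.max s 0| <= `|s|.
    by rewrite (ger0_norm m0) ge_max ler_norm normr_ge0.
  apply: le_trans (_ : `|s| ^+ k.+2 <= _); first by rewrite lerXn2r // nnegrE.
  rewrite exprS mulrC; apply: ler_wpM2r => //; apply: le_trans se.
  by rewrite exprS ler_piMr // exprn_ile1.
Qed.

Lemma continuous_pospow k F x : {for x, continuous F} ->
  {for x, continuous (fun x => Num.max (F x) 0 ^+ k)}.
Proof.
move=> /continuous_edP hF; have c1 : {for x, continuous (fun x => Num.max (F x) 0)}.
  apply/continuous_edP => e /hF [d d0 hd].
  exists d => // y /hd; apply: le_lt_trans.
  rewrite /Num.max; case: ltP => h1; case: ltP => h2; rewrite ?subr0 ?sub0r ?subrr ?normr0 //.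
    by rewrite normrN (ger0_norm h2); have := ler_norm (F x - F y); rewrite distrC; lra.
  by rewrite (ger0_norm h1); have := ler_norm (F y - F x); lra.
elim: k => [|k IHk]; first exact: cst_continuous.
have -> : (fun x => Num.max (F x) 0 ^+ k.+1) =
    (fun x => Num.max (F x) 0) * (fun x => Num.max (F x) 0 ^+ k).
  by apply/funext => y; rewrite exprS.
exact: (continuousM c1 IHk).
Qed.

Lemma Ck_pospow p k U F : open U -> (p < k)%N -> Ck p U F ->
  Ck p U (fun x => Num.max (F x) 0 ^+ k).
Proof.
move=> oU; elim: p k F => [|p IH] k F pk hF.
  by split=> // x Ux; apply/continuous_pospow/(Ck_cont hF Ux).
case: k pk => [//|[//|k]] pk.
apply: (Ck_intro (D := fun i x => (k.+2%:R * Num.max (F x) 0 ^+ k.+1) * 'D_(ei R i) F x)) => //.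
- by move=> x Ux; apply/continuous_pospow/(Ck_cont hF Ux).
- by move=> i x Ux; apply: (is_derive_comp1 (is_derive_pospow k _) (Ck_is_derive i hF Ux)).
- move=> i; apply: Ck_mul => //; last exact: Ck_D.
  by apply: Ck_scale => //; apply: IH => //; apply: Ck_le hF.
Qed.

(** Powers of the positive part are smooth enough, since only [p] derivatives are ever required;
    nesting two of them makes the step exactly constant on both sides of the unit interval. *)
Definition smooth_step p (t : R) : R :=
  1 - Num.max (1 - Num.max t 0 ^+ p.+1) 0 ^+ p.+1.

Lemma smooth_step0 p (t : R) : t <= 0 -> smooth_step p t = 0.
Proof.
by move=> /max_idPr t0; rewrite /smooth_step t0 expr0n subr0 (max_idPl ler01) expr1n subrr.
Qed.

Lemma smooth_step1 p (t : R) : 1 <= t -> smooth_step p t = 1.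
Proof.
move=> t1; have t0 : 0 <= t := le_trans ler01 t1.
rewrite /smooth_step (max_idPl t0) (max_idPr _) ?expr0n ?subr0 // subr_le0.
exact: exprn_ege1.
Qed.

Lemma Ck_smooth_step p U F : open U -> Ck p U F -> Ck p U (fun x => smooth_step p (F x)).
Proof.
move=> oU hF; apply: Ck_sub_fun (oU) (Ck_cst _ _ oU) _; apply: Ck_pospow => //.
by apply: Ck_sub_fun (oU) (Ck_cst _ _ oU) _; apply: Ck_pospow.
Qed.

Definition plateau p x : R :=
  \prod_i (smooth_step p (3 - x ord0 i) * smooth_step p (3 + x ord0 i)).

Lemma Ck_plateau p : Ck p setT (plateau p).
Proof.
apply: Ck_prod openT _ => i _; apply: Ck_mul openT _ _; apply: Ck_smooth_step openT _.
  by apply: Ck_sub_fun openT (Ck_cst _ _ openT) (Ck_coord _ _ openT).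
by apply: Ck_add openT (Ck_cst _ _ openT) (Ck_coord _ _ openT).
Qed.

Lemma plateau1 p x : `|x| <= 2 -> plateau p x = 1.
Proof.
move=> x2; rewrite /plateau big1 // => i _.
have := le_trans (coord_le_norm x i) x2; rewrite ler_norml => /andP [h1 h2].
by rewrite !smooth_step1 ?mulr1 //; lra.
Qed.

Lemma plateau0 p x : 3 <= `|x| -> plateau p x = 0.
Proof.
move=> x3; have [i hi] : exists i, 3 <= `|x ord0 i|.
  apply: contrapT => /forallNP h; move: x3; apply/negP; rewrite -ltNge.
  by apply: norm_lt_coord => // i; rewrite ltNge; apply/negP.
rewrite /plateau (bigD1 i) //=; have [t0|t0] := leP 0 (x ord0 i).
  by rewrite smooth_step0 ?mul0r //; move: hi; rewrite ger0_norm //; lra.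
have h3 : 3 + x ord0 i <= 0 by move: hi; rewrite ltr0_norm //; lra.
by rewrite (smooth_step0 p h3) mulr0 mul0r.
Qed.

Lemma pder_bounded_support F l (r : R) : Ck (size l) setT F ->
  (forall x, r < `|x| -> F x = 0) -> exists C : R, forall x, `|pder F l x| <= C.
Proof.
move=> hF h0.
(* The enlarged radius puts every point outside [A] in the open set [r < |y|] where [F] vanishes
   identically, hence so do its derivatives. *)
pose A := [set x : 'rV[R]_n | `|x| <= `|r| + 1].
have cA : compact A.
  apply: bounded_closed_compact.
    by exists (`|r| + 1); split => // M hM x /= hx; apply: le_trans hx (ltW hM).
  rewrite -openC; apply: open_ballP => x /negP; rewrite -ltNge => hx.
  exists (`|x| - (`|r| + 1)); first by rewrite subr_gt0.
  move=> y yx; rewrite /A /= => hy; have := ler_normD (x - y) y; rewrite subrK distrC; lra.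
have A0 : A !=set0 by exists 0; rewrite /A /= normr0 addr_ge0.
have c : {within A, continuous (fun x => `|pder F l x|)}.
  apply: continuous_subspaceT => x.
  have cx := Ck_cont (Ck_pder (p := 0) (l := l) hF) (I : setT x).
  exact: (continuous_comp cx (@norm_continuous _ _ _)).
have [x0 _ hx0] := EVT_max_rV A0 cA c.
exists (`|pder F l x0|) => x; have [hx|hx] := leP `|x| (`|r| + 1).
  by apply: hx0; rewrite inE.
have -> : pder F l x = 0; last by rewrite normr0.
have oU : open [set y : 'rV[R]_n | r < `|y|].
  apply: open_ballP => y /= ry; exists (`|y| - r); first by rewrite subr_gt0.
  move=> z zy; have := ler_normD (y - z) z; rewrite subrK distrC; lra.
rewrite (pder_eq (G := fun=> 0) l oU) //; first by rewrite pder_cst; case: (l).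
by rewrite /=; have := ler_norm r; lra.
Qed.

(** The analogue of [fin_min] for bounds over words of length at most [p], by induction on [p] and
    the first letter. *)
Lemma list_bound p (Q : seq 'I_n -> R -> Prop) :
  (forall l, (size l <= p)%N -> exists C, Q l C) ->
  (forall l C C', C <= C' -> Q l C -> Q l C') ->
  exists C, 1 <= C /\ forall l, (size l <= p)%N -> Q l C.
Proof.
elim: p Q => [|p IH] Q h m.
  have [C hC] := h [::] isT; exists (Num.max 1 C); split; first by rewrite le_max lexx.
  by move=> [|//] _; apply: m hC; rewrite le_max lexx orbT.
have h' i : exists C, 1 <= C /\ forall l, (size l <= p)%N -> Q (i :: l) C.
  by apply: IH => [l sl|l C C'] ; [apply: h|apply: m].
have [f hf] := choice h'.
have [C hC] := h [::] isT.
exists (1 + `|C| + \sum_i f i); have f0 i : 0 <= f i by have [] := hf i; lra.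
have s0 : 0 <= \sum_i f i by apply: sumr_ge0.
have C0 := normr_ge0 C; have C1 := ler_norm C.
split; first lra.
move=> [|i l] sl; first by apply: m hC; lra.
have [_ /(_ l sl)] := hf i; apply: m.
have : f i <= \sum_i f i by rewrite (bigD1 i) //= lerDl sumr_ge0.
lra.
Qed.

Lemma plateau_bounded p : exists C : R, 1 <= C /\ forall l, (size l <= p)%N -> forall x, `|pder (plateau p) l x| <= C.
Proof.
apply: (@list_bound p (fun l C => forall x, `|pder (plateau p) l x| <= C)).
  move=> l sl; apply: (@pder_bounded_support _ _ 3); first exact: Ck_le sl (Ck_plateau p).
  by move=> x /ltW; apply: plateau0.
by move=> l C C' CC' h x; apply: le_trans CC'.
Qed.

Lemma is_derive_affine F v x c (s D : R) : is_derive (s *: (x - c)) v F D ->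
  is_derive x v (fun y => F (s *: (y - c))) (s * D).
Proof.
move=> /is_derive_edP h; apply/is_derive_edP => e e0.
have s1 : 0 < `|s| + 1 by apply: ltr_wpDl.
have [d d0 hd] := h (e / (`|s| + 1)) (divr_gt0 e0 s1).
exists (d / (`|s| + 1)) => [|t]; first exact: divr_gt0.
rewrite ltr_pdivlMr // => td.
have : `|s * t| < d.
  apply: le_lt_trans td; rewrite normrM mulrC; apply: ler_wpM2l => //; lra.
move=> /hd; have -> : s *: (t *: v + x - c) = (s * t) *: v + s *: (x - c).
  by rewrite -addrA scalerDr scalerA.
rewrite (mulrC s t) -[t * s * D]mulrA => /le_trans; apply.
rewrite normrM mulrA mulrAC; apply: ler_wpM2r => //.
rewrite mulrAC ler_pdivrMr // ler_wpM2l ?(ltW e0) //; lra.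
Qed.

Lemma Ck_affine p F c (s : R) : Ck p setT F -> Ck p setT (fun y => F (s *: (y - c))).
Proof.
move=> hF; apply: (@Ck_comp _ _ p setT setT F (fun y => s *: (y - c))) => //; try exact: openT.
move=> j; apply: (@Ck_eq _ _ _ _ (fun y => s * (y ord0 j - c ord0 j))); first exact: openT.
  by move=> y _; rewrite !mxE.
apply: Ck_scale openT _.
by apply: Ck_sub_fun openT (Ck_coord _ _ openT) (Ck_cst _ _ openT).
Qed.

Lemma pder_affine F c (s : R) l x : Ck (size l) setT F ->
  pder (fun y => F (s *: (y - c))) l x = s ^+ size l * pder F l (s *: (x - c)).
Proof.
elim/last_ind: l F => [|l i IH] F; first by rewrite mul1r.
rewrite size_rcons !pder_rcons => hF.
rewrite (pder_eq (G := fun y => s * 'D_(ei R i) F (s *: (y - c))) l openT) //; last first.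
  move=> y _; exact: (@derive_val _ _ _ _ _ _ _ (is_derive_affine (Ck_is_derive i hF I))).
have hD := Ck_D i hF.
rewrite (pder_scale _ openT (Ck_affine c s hD)) // (IH _ hD) exprS mulrA //.
Qed.

End Bump.

(** * Successive blending and its effect on jets *)

Section Gluing.
Variables (R : realType) (n p : nat).
Implicit Types (x y z a c : 'rV[R]_n) (F G chi T P : 'rV[R]_n -> R) (U : set 'rV[R]_n).
Implicit Types (l : seq 'I_n).

(** The size of the jet at length scale [1 / H]. A fixed bump rescaled to cubes of side [1 / H]
    satisfies such a bound with [A] independent of [H]. *)
Definition jet_le F x (A H : R) := forall l, (size l <= p)%N -> `|pder F l x| <= A * H ^+ size l.

Lemma jet_le_add F G x (A B H : R) : Ck p setT F -> Ck p setT G ->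
  jet_le F x A H -> jet_le G x B H -> jet_le (fun y => F y + G y) x (A + B) H.
Proof.
move=> hF hG bF bG l sl; rewrite (pder_add openT (Ck_le sl hF) (Ck_le sl hG)) // mulrDl.
by apply: le_trans (ler_normD _ _) _; apply: lerD; [apply: bF|apply: bG].
Qed.

Lemma jet_le_sub F G x (A B H : R) : Ck p setT F -> Ck p setT G ->
  jet_le F x A H -> jet_le G x B H -> jet_le (fun y => F y - G y) x (A + B) H.
Proof.
move=> hF hG bF bG l sl; rewrite (pder_sub openT (Ck_le sl hF) (Ck_le sl hG)) // mulrDl.
by apply: le_trans (ler_normB _ _) _; apply: lerD; [apply: bF|apply: bG].
Qed.

Lemma jet_le_mul F G x (A B H : R) : 0 <= A -> 0 <= B -> 0 <= H ->
  Ck p setT F -> Ck p setT G ->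
  jet_le F x A H -> jet_le G x B H -> jet_le (fun y => F y * G y) x (2 ^+ p * (A * B)) H.
Proof.
move=> A0 B0 H0 hF hG bF bG l sl.
apply: le_trans (pder_mul_bound openT _ H0 hF hG bF bG sl) _ => //.
apply: ler_wpM2r; first exact: exprn_ge0.
apply: ler_wpM2r; first exact: mulr_ge0.
by apply: ler_weXn2l => //; rewrite ler1n.
Qed.

Lemma jet_le_near U F G x (A H : R) : open U -> U x -> (forall y, U y -> F y = G y) ->
  jet_le F x A H -> jet_le G x A H.
Proof. by move=> oU Ux FG bF l sl; rewrite -(pder_eq l oU FG Ux); apply: bF. Qed.

Lemma jet_le_mono F x (A B H : R) : 0 <= H -> A <= B -> jet_le F x A H -> jet_le F x B H.
Proof.
move=> H0 AB bF l sl; apply: le_trans (bF l sl) _; apply: ler_wpM2r => //.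
exact: exprn_ge0.
Qed.

(* Successive blending plays the role of a partition of unity: a step leaves G unchanged
   where chi = 0, and forgets all previous steps where chi = 1. *)
Definition blend chi T G x := G x + chi x * (T x - G x).

Lemma Ck_blend chi T G : Ck p setT chi -> Ck p setT T -> Ck p setT G -> Ck p setT (blend chi T G).
Proof.
move=> hc hT hG; apply: (Ck_add openT hG); apply: (Ck_mul openT hc).
exact: (Ck_sub_fun openT hT hG).
Qed.

(** Blending turns $G-P$ into $(G-P)+\chi\,((T-P)-(G-P))$: the summand 1 is for $G-P$, the factor
    $2^p$ is Leibniz' constant, [C] bounds the jet of $\chi$, and 2 counts the two differences. *)
Definition blend_cst (C : R) := 1 + 2 ^+ p * (C * 2).

Lemma blend_cst_ge1 (C : R) : 0 <= C -> 1 <= blend_cst C.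
Proof. by move=> C0; rewrite lerDl mulr_ge0 ?exprn_ge0 // mulr_ge0. Qed.

Lemma jet_le_blend chi T G P x (C A B H : R) : 0 <= H -> 0 <= C -> 0 <= B -> A <= B ->
  Ck p setT chi -> Ck p setT T -> Ck p setT G -> Ck p setT P ->
  jet_le chi x C H -> jet_le (fun y => T y - P y) x A H ->
  jet_le (fun y => G y - P y) x B H ->
  jet_le (fun y => blend chi T G y - P y) x (blend_cst C * B) H.
Proof.
move=> H0 C0 B0 AB hc hT hG hP bc bT bG.
have hTP := Ck_sub_fun openT hT hP; have hGP := Ck_sub_fun openT hG hP.
have hTG := Ck_sub_fun openT hTP hGP.
have b1 := jet_le_sub hTP hGP (jet_le_mono H0 AB bT) bG.
have b2 := jet_le_mul C0 (addr_ge0 B0 B0) H0 hc hTG bc b1.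
have := jet_le_add hGP (Ck_mul openT hc hTG) bG b2.
have -> : B + 2 ^+ p * (C * (B + B)) = blend_cst C * B by rewrite /blend_cst; ring.
apply: (@jet_le_near setT) => //; first exact: openT.
by move=> y _; rewrite /blend; ring.
Qed.

Variable I : eqType.
Implicit Types (s : seq I) (X Y : I -> 'rV[R]_n -> R).

Fixpoint blend_seq X Y s G := if s is i :: s' then blend_seq X Y s' (blend (X i) (Y i) G) else G.

Lemma blend_seq_cat X Y s1 s2 G :
  blend_seq X Y (s1 ++ s2) G = blend_seq X Y s2 (blend_seq X Y s1 G).
Proof. by elim: s1 G => //= i s1 IH G. Qed.

Lemma Ck_blend_seq X Y s G : (forall i, i \in s -> Ck p setT (X i)) ->
  (forall i, i \in s -> Ck p setT (Y i)) -> Ck p setT G -> Ck p setT (blend_seq X Y s G).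
Proof.
elim: s G => //= i s IH G hX hY hG; apply: IH => [j js|j js|].
- by apply: hX; rewrite inE js orbT.
- by apply: hY; rewrite inE js orbT.
- by apply: Ck_blend => //; [apply: hX|apply: hY]; apply: mem_head.
Qed.

Lemma blend_seq_irrelevant X Y s G x : (forall i, i \in s -> X i x = 0) ->
  blend_seq X Y s G x = G x.
Proof.
elim: s G => //= i s IH G h; rewrite IH; last by move=> j js; apply: h; rewrite inE js orbT.
by rewrite /blend h ?mem_head // mul0r addr0.
Qed.

Lemma blend_seq_eq X Y s G (f : 'rV[R]_n -> R) x : G x = f x ->
  (forall i, i \in s -> X i x = 0 \/ Y i x = f x) -> blend_seq X Y s G x = f x.
Proof.
elim: s G => //= i s IH G hG h; apply: IH; last by move=> j js; apply: h; rewrite inE js orbT.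
rewrite /blend hG; case: (h i (mem_head _ _)) => ->; first by rewrite mul0r addr0.
by rewrite subrr mulr0 addr0.
Qed.

Lemma blend_seq_eq_cover X Y s G (f : 'rV[R]_n -> R) x :
  (exists2 i, i \in s & X i x = 1) ->
  (forall i, i \in s -> X i x = 0 \/ Y i x = f x) -> blend_seq X Y s G x = f x.
Proof.
move=> [i0 i0s Xi0] h; case/splitPr : i0s h => s1 s2 h.
rewrite blend_seq_cat /=; apply: blend_seq_eq.
  have i0s : i0 \in s1 ++ i0 :: s2 by rewrite mem_cat mem_head orbT.
  have [/eqP|e] := h i0 i0s; first by rewrite Xi0 oner_eq0.
  by rewrite /blend e Xi0 mul1r addrC subrK.
by move=> i is2; apply: h; rewrite mem_cat inE is2 !orbT.
Qed.

(* Near x, step i is either invisible, or counted by r and then controlled at scale 1 / H. *)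
Definition tame X Y (r : pred I) P x (C A H : R) i :=
  [/\ Ck p setT (X i), Ck p setT (Y i),
   ~~ r i -> exists U, [/\ open U, U x & forall y, U y -> X i y = 0] &
   r i -> jet_le (X i) x C H /\ jet_le (fun y => Y i y - P y) x A H].

Lemma jet_le_blend_seq X Y (r : pred I) s G P x (C A B H : R) :
  0 <= H -> 0 <= C -> 0 <= A -> A <= B -> Ck p setT G -> Ck p setT P ->
  (forall i, i \in s -> tame X Y r P x C A H i) ->
  jet_le (fun y => G y - P y) x B H ->
  jet_le (fun y => blend_seq X Y s G y - P y) x (blend_cst C ^+ count r s * B) H.
Proof.
move=> H0 C0 A0 AB hG hP; elim: s G B AB hG => [|i s IH] G B AB hG h bG.
  by rewrite mul1r.
have [hX hY hz hr] := h i (mem_head _ _); have hg := Ck_blend hX hY hG.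
have hs j : j \in s -> tame X Y r P x C A H j by move=> js; apply: h; rewrite inE js orbT.
have B0 := le_trans A0 AB; rewrite /= addnC exprD -mulrA.
have [ri|ri] := boolP (r i); last first.
  have [U [oU Ux X0]] := hz ri; rewrite mul1r; apply: IH => //.
  by apply: jet_le_near oU Ux _ bG => y Uy; rewrite /blend X0 // mul0r addr0.
have [b1 b2] := hr ri.
apply: IH => //; last exact: jet_le_blend b1 b2 bG.
by rewrite expr1; apply: le_trans AB _; rewrite ler_peMl // blend_cst_ge1.
Qed.

(** At the step [i0] the blend equals [Y i0] near [x]. Whatever preceded it is lost, so no estimate
    for [G] enters; only the later steps multiply the bound. *)
Lemma jet_le_blend_seq_reset X Y (r : pred I) s G P x (C A H : R) i0 :
  0 <= H -> 0 <= C -> 0 <= A -> Ck p setT G -> Ck p setT P ->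
  (forall i, i \in s -> tame X Y r P x C A H i) -> i0 \in s ->
  (exists U, [/\ open U, U x & forall y, U y -> X i0 y = 1]) ->
  jet_le (fun y => Y i0 y - P y) x A H ->
  jet_le (fun y => blend_seq X Y s G y - P y) x (blend_cst C ^+ count r s * A) H.
Proof.
move=> H0 C0 A0 hG hP h i0s [U [oU Ux X1]] b0.
case/splitPr : i0s h => s1 s2 h.
have t0 : tame X Y r P x C A H i0 by apply: h; rewrite mem_cat mem_head orbT.
have h1 i : i \in s1 -> tame X Y r P x C A H i by move=> is1; apply: h; rewrite mem_cat is1.
have h2 i : i \in s2 -> tame X Y r P x C A H i.
  by move=> is2; apply: h; rewrite mem_cat inE is2 !orbT.
have [hX hY _ _] := t0.
have hG1 : Ck p setT (blend_seq X Y s1 G).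
  by apply: Ck_blend_seq hG => i /h1 [].
rewrite blend_seq_cat /=.
have b1 : jet_le (fun y => blend (X i0) (Y i0) (blend_seq X Y s1 G) y - P y) x A H.
  by apply: jet_le_near oU Ux _ b0 => y Uy; rewrite /blend X1 //; ring.
apply: jet_le_mono (jet_le_blend_seq H0 C0 A0 (lexx _) (Ck_blend hX hY hG1) hP h2 b1) => //.
apply: ler_wpM2r => //; rewrite count_cat /=.
by apply: ler_weXn2l; [apply: blend_cst_ge1|lia].
Qed.

End Gluing.

(** * Counting the grid cubes that meet a point *)

Section GridCount.
Variable R : realType.

(** An interval of length 6 contains at most seven integers; subtracting the least admissible index
    injects the set into ['I_7]. *)
Lemma count_near N (u : R) : (#|[pred j : 'I_N | (`|u - (j : nat)%:R| <= 3)%R]| <= 7)%N.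
Proof.
set S := [pred j | _].
have [j0 j0S|S0] := pickP S; last by rewrite eq_card0.
have [j1 j1S jmin] := @arg_minnP _ j0 S (fun j : 'I_N => j : nat) j0S.
have inj : {in S &, injective (fun j : 'I_N => inord (j - j1) : 'I_7)}.
  have b (j : 'I_N) : j \in S -> (j - j1 < 7)%N.
    move=> jS; move: (jS) (j1S); rewrite !inE !ler_norml => /andP [h0 h1] /andP [h2 h3].
    have := jmin j jS; rewrite ltn_subLR => [_|]; last exact: jmin.
    rewrite -(ltr_nat R) natrD; lra.
  move=> i j iS jS /(congr1 val); rewrite /= !inordK ?b // => e.
  by apply: val_inj => /=; have := jmin i iS; have := jmin j jS; lia.
rewrite -[leqRHS](card_ord 7) -(card_in_image inj); exact: max_card.
Qed.

Lemma count_near_grid (n N : nat) (u : 'I_n -> R) :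
  (count (fun m : {ffun 'I_n -> 'I_N} => [forall i, (`|u i - (m i : nat)%:R| <= 3)%R])
    (enum {ffun 'I_n -> 'I_N}) <= 7 ^ n)%N.
Proof.
rewrite -sum1_count big_enum_cond sum1_card.
pose F (i : 'I_n) := [pred j : 'I_N | (`|u i - (j : nat)%:R| <= 3)%R].
rewrite (_ : #|_| = #|family F|); last first.
  by apply: eq_card => m; rewrite !inE; apply: eq_forallb => i; rewrite !inE.
rewrite card_family /image_mem -[X in (_ <= 7 ^ X)%N]card_ord cardE.
elim: (enum _) => //= i s IH; rewrite expnS; apply: leq_mul => //; exact: count_near.
Qed.

End GridCount.

Lemma expr_div_sub (R : fieldType) (s : R) (p i : nat) : s != 0 -> (i <= p)%N ->
  s ^+ i / s ^+ p = s^-1 ^+ (p - i).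
Proof.
move=> s0 ip; have -> : s ^+ p = s ^+ (p - i) * s ^+ i by rewrite -exprD subnK.
by rewrite invfM mulrCA divff ?expf_neq0 // mulr1 exprVn.
Qed.

Section TayGrowth.
Variables (R : realType) (n p : nat).
Implicit Types (x y z a b c : 'rV[R]_n) (l : seq 'I_n) (J : seq 'I_n -> R).

(** Whitney's condition is a bound on the jet at [b] of the difference of the two Taylor
    polynomials. Their derivatives of order [p] are constant, so [jet_growth] spreads the bound to
    distance [h]. *)
Lemma Tay_diff_growth (Ja Jb : seq 'I_n -> R) a b (h e : R) :
  sym_jet p Ja -> sym_jet p Jb -> 0 <= e -> `|b - a| <= h ->
  (forall l, (size l <= p)%N ->
     `|Jb l - Tay (p - size l) (fun t => Ja (l ++ t)) a b| <= e * `|b - a| ^+ (p - size l)) ->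
  forall x, `|x - b| <= h -> forall l, (size l <= p)%N ->
    `|pder (fun y => Tay p Jb b y - Tay p Ja a y) l x|
       <= (1 + n%:R) ^+ p * (e * h ^+ (p - size l)).
Proof.
move=> sa sb e0 bah w x xb l sl.
have h0 : 0 <= h := le_trans (normr_ge0 _) bah.
have E t y : (size t <= p)%N -> pder (fun y => Tay p Jb b y - Tay p Ja a y) t y =
   Tay (p - size t) (fun s => Jb (t ++ s)) b y - Tay (p - size t) (fun s => Ja (t ++ s)) a y.
  move=> st; rewrite (pder_sub openT (Ck_Tay _ _ _ _) (Ck_Tay _ _ _ _)) //.
  by rewrite !pder_Tay // st.
have wb t : (size t <= p)%N ->
    `|pder (fun y => Tay p Jb b y - Tay p Ja a y) t b| <= e * h ^+ (p - size t).
  move=> st; rewrite E // Tay_base cats0; apply: le_trans (w t st) _.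
  apply: ler_wpM2l => //; by apply: lerXn2r => //; rewrite nnegrE.
have hC : Ck p setT (fun y => Tay p Jb b y - Tay p Ja a y).
  by apply: (Ck_sub_fun openT); apply: Ck_Tay.
have H := @jet_growth R n p setT _ b h 1 e h0 ler01 e0 hC (fun _ _ => I).
apply: le_trans (H _ _ x l _ sl) _; rewrite ?mul1r //.
- by move=> t st; apply: wb; apply: ltnW.
- move=> z t zb st; have := wb t; rewrite st subnn expr0 mulr1 => /(_ (leqnn _)).
  by rewrite !E ?st // subnn !Tay0.
- apply: ler_wpM2r; first by rewrite mulr_ge0 ?exprn_ge0.
  by rewrite mulr1; apply: ler_weXn2l; rewrite ?leq_subr // lerDl.
Qed.

End TayGrowth.

(** * The dyadic construction of Whitney's extension *)

Section Whitney.
Variables (R : realType) (n p : nat) (K : set 'rV[R]_n) (B : nat).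
Variable J : 'rV[R]_n -> seq 'I_n -> R.
Hypothesis K_closed : closed K.
Hypothesis K_bounded : forall a, K a -> `|a| <= B%:R.
Hypothesis J_sym : forall a, K a -> sym_jet p (J a).
Implicit Types (x y z a b c : 'rV[R]_n) (l : seq 'I_n) (k j : nat).

(* At level k, the cubes of side 2^-k near K each carry the Taylor polynomial of the field at
   a nearby point of K. A point x at distance about 2^-k from K is covered by a cube of
   level k, where all earlier levels are forgotten, and only meets cubes of levels k, k + 1
   and k + 2, at most 7^n of each. *)
Let S k : R := 2 ^+ k.
(** Grid points of step $2^{-k}$ starting at $-(B+4)$ and filling the interval up to $B+4$ in each
    coordinate: this covers, with a margin, all points within distance 2 of [K]. *)
Let N k := ((2 * B + 8) * 2 ^ k)%N.
Let idx k : finType := {ffun 'I_n -> 'I_(N k)}.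
Let ctr k (m : idx k) : 'rV[R]_n := \row_i ((m i : nat)%:R / S k - (B%:R + 4)).
Let cube_near k (m : idx k) a := K a /\ `|ctr m - a| <= 3 / S k.
Let pt k (m : idx k) : 'rV[R]_n := xget 0 (cube_near m).
Let cube_bump k (m : idx k) x := plateau p (S k *: (x - ctr m)).
Let cube_tay k (m : idx k) := Tay p (J (pt m)) (pt m).
Let cubes k := [seq m <- enum (idx k) | `[< exists a, cube_near m a >]].

Fixpoint approx k : 'rV[R]_n -> R :=
  if k is j.+1 then blend_seq (@cube_bump j) (@cube_tay j) (cubes j) (approx j) else fun=> 0.

(** A bump of level [j] lives within $3/2^j$ of its centre, which lies within $3/2^j$ of [K]; hence
    the 6. Off the closed set [K] a suitable level exists, and by [approx_stationary] its choice
    does not affect the value. *)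
Definition whitney_ext x : R :=
  if `[< K x >] then J x [::]
  else approx (xget 0%N [set k | forall a, K a -> 6 / S k < `|x - a|]) x.

Let S_gt0 k : 0 < S k. Proof. exact: exprn_gt0. Qed.
Let SV_gt0 k : 0 < (S k)^-1. Proof. by rewrite invr_gt0. Qed.
Let S_ge1 k : 1 <= S k. Proof. by apply: exprn_ege1; rewrite ler1n. Qed.
Let SV_le j k : (k <= j)%N -> (S j)^-1 <= (S k)^-1.
Proof. by move=> kj; rewrite lef_pV2 ?posrE //; apply: ler_weXn2l => //; rewrite ler1n. Qed.

Lemma pt_near k (m : idx k) : m \in cubes k -> cube_near m (pt m).
Proof. by rewrite mem_filter => /andP [/asboolP h _]; apply: xgetPex. Qed.

Lemma Ck_cube_bump k (m : idx k) : Ck p setT (cube_bump m).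
Proof. exact/Ck_affine/Ck_plateau. Qed.

Lemma Ck_approx k : Ck p setT (approx k).
Proof.
elim: k => [|k IH] /=; first exact: Ck_cst openT.
by apply: Ck_blend_seq IH => m _; [apply: Ck_cube_bump|apply: Ck_Tay].
Qed.

Lemma approx_stationary x k j : (forall a, K a -> 6 / S k < `|x - a|) -> (k <= j)%N ->
  approx j x = approx k x.
Proof.
move=> h; elim: j => [|j IH]; first by rewrite leqn0 => /eqP ->.
rewrite leq_eqVlt => /orP [/eqP -> //|]; rewrite ltnS => kj; rewrite -(IH kj) /=.
apply: blend_seq_irrelevant => m /pt_near [Ka ma]; apply: plateau0.
have xa := h _ Ka; have SS := SV_le kj.
have := ler_distD (ctr m) x (pt m) => xm.
have : 3 / S j <= `|x - ctr m|.
  have : 6 / S j <= 6 / S k by rewrite ler_wpM2l.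
  lra.
by rewrite normrZ (gtr0_norm (S_gt0 j)) ler_pdivrMr // mulrC.
Qed.

Lemma whitney_ext_far x k : (forall a, K a -> 6 / S k < `|x - a|) ->
  whitney_ext x = approx k x.
Proof.
move=> h; rewrite /whitney_ext; case: asboolP => [Kx|nKx].
  have := h x Kx; rewrite subrr normr0 => /lt_gtF.
  by rewrite divr_gt0.
set P := [set _ | _]; have hP : P (xget 0%N P) by apply: xgetPex; exists k.
set k' := xget _ _ in hP *.
rewrite -(@approx_stationary x k (maxn k k')) ?leq_maxl //.
by rewrite (@approx_stationary x k' (maxn k k')) ?leq_maxr.
Qed.

Lemma whitney_ext_near x k : (forall a, K a -> (S k)^-1 < `|x - a|) ->
  forall y, `|y - x| < (S k)^-1 / 4 -> whitney_ext y = approx k.+3 y.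
Proof.
move=> h y yx; apply: whitney_ext_far => a Ka; have := h a Ka.
(* Three more levels turn 6 into three quarters of $2^{-k}$; the last quarter is the distance
   allowed between [x] and [y]. *)
have -> : 6 / S k.+3 = (S k)^-1 * (6 / 8) :> R.
  by rewrite /S !exprS; field; rewrite gt_eqF // S_gt0.
have := ler_distD y x a; rewrite (distrC x y); lra.
Qed.

Lemma pow2_small (e : R) : 0 < e -> exists k, (S k)^-1 < e.
Proof.
move=> e0; have e1 : 0 <= e^-1 by rewrite invr_ge0 ltW.
exists (Num.bound e^-1); rewrite -[ltRHS]invrK ltf_pV2 ?posrE ?invr_gt0 //.
apply: lt_trans (archi_boundP e1) _.
by rewrite /S -natrX ltr_nat ltn_expl.
Qed.

Lemma away_scale x : ~ K x -> exists k, forall a, K a -> (S k)^-1 < `|x - a|.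
Proof.
move=> nKx; have oK : open (~` K) by rewrite openC.
have [r r0 hr] := open_ball_sub oK nKx; have [k hk] := pow2_small r0.
exists k => a Ka; rewrite ltNge; apply/negP => h; apply: (hr a) => //.
by rewrite distrC; apply: le_lt_trans hk.
Qed.

Lemma Ck_whitney_ext : Ck p (~` K) whitney_ext.
Proof.
apply: Ck_local => x nKx; have [k hk] := away_scale nKx.
exists [set y | `|y - x| < (S k)^-1 / 4]; split; first exact: open_ball_normr.
  by rewrite /= subrr normr0 divr_gt0.
apply: (@Ck_eq _ _ _ _ (approx k.+3)); first exact: open_ball_normr.
  by move=> y /= yx; rewrite (whitney_ext_near hk).
exact: Ck_sub (Ck_approx _).
Qed.

Let Cb : R := xget 0 [set C : R | 1 <= C /\
  forall l, (size l <= p)%N -> forall x, `|pder (@plateau R n p) l x| <= C].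
Let CbP : 1 <= Cb /\ forall l, (size l <= p)%N -> forall x, `|pder (@plateau R n p) l x| <= Cb.
Proof. exact: (xgetPex 0 (@plateau_bounded R n p)). Qed.

Let rel j x (m : idx j) :=
  [forall i, (`|S j * (x ord0 i + (B%:R + 4)) - (m i : nat)%:R| <= 3)%R].

Let scaled_coord j x (m : idx j) i :
  (S j *: (x - ctr m)) ord0 i = S j * (x ord0 i + (B%:R + 4)) - (m i : nat)%:R.
Proof. by rewrite !mxE; field; rewrite gt_eqF // S_gt0. Qed.

(** The factor [4 ^+ p] compares the scale of levels up to [k.+2] with that of level [k]. The 8 is 3
    + 3 + 2: from [x] to the centre, from the centre to [pt m], and from [x] to [a]. Dividing by
    [S k ^+ p] writes the estimate of [Tay_diff_growth] in the weighted form of [jet_le]. *)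
Lemma cube_tame j k x a (e : R) (m : idx j) : (k <= j <= k.+2)%N -> K a ->
  `|x - a| <= 2 / S k -> 0 <= e ->
  (forall b, K b -> `|b - a| <= 8 / S k -> forall l, (size l <= p)%N ->
     `|J b l - Tay (p - size l) (fun t => J a (l ++ t)) a b| <= e * `|b - a| ^+ (p - size l)) ->
  m \in cubes j ->
  tame p (@cube_bump j) (@cube_tay j) (@rel j x) (Tay p (J a) a) x (Cb * 4 ^+ p)
    ((1 + n%:R) ^+ p * 8 ^+ p * e / S k ^+ p) (S k) m.
Proof.
move=> /andP [kj jk] Ka xa e0 hw ms; have [Kpt mpt] := pt_near ms.
have [Cb1 CbB] := CbP.
split.
- exact: Ck_cube_bump.
- exact: Ck_Tay.
- rewrite negb_forall => /existsP [i]; rewrite -ltNge => hi.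
  exists [set y | 3 < `|S j *: (y - ctr m)|]; split.
  + apply: open_ballP => y /= hy; exists ((`|S j *: (y - ctr m)| - 3) / S j).
      by rewrite divr_gt0 // subr_gt0.
    move=> z; rewrite ltr_pdivlMr // => zy.
    have := ler_normD (S j *: (y - z)) (S j *: (z - ctr m)).
    have -> : `|S j *: (y - z)| = `|z - y| * S j.
      by rewrite normrZ (gtr0_norm (S_gt0 j)) distrC mulrC.
    rewrite -scalerDr addrA subrK; lra.
  + rewrite /= -scaled_coord in hi *; apply: lt_le_trans hi _; exact: coord_le_norm.
  + by move=> y /= /ltW; apply: plateau0.
- move=> /forallP hr; split.
    move=> l sl; rewrite /cube_bump pder_affine; last exact: (Ck_le sl (Ck_plateau _ _ p)).
    rewrite normrM normrX (gtr0_norm (S_gt0 j)).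
    have SS : S j <= 4 * S k.
      apply: le_trans (_ : S k.+2 <= _); first by apply: ler_weXn2l => //; rewrite ler1n.
      by rewrite /S !exprS; lra.
    apply: le_trans (_ : (4 * S k) ^+ size l * Cb <= _).
      apply: ler_pM => //; [by rewrite exprn_ge0 // ltW| |exact: CbB].
      by apply: lerXn2r => //; rewrite nnegrE ?mulr_ge0 // ltW.
    rewrite exprMn mulrC mulrA; apply: ler_wpM2r; first by rewrite exprn_ge0 // ltW.
    apply: ler_wpM2l; first lra.
    by apply: ler_weXn2l => //; rewrite ler1n.
  have xc : `|x - ctr m| <= 3 / S j.
    rewrite ler_pdivlMr // mulrC -{1}(gtr0_norm (S_gt0 j)) -normrZ.
    by apply: norm_le_coord => // i; rewrite scaled_coord.
  have SS := SV_le kj.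
  have h1 := ler_distD (ctr m) x (pt m); have h2 := ler_distD x (pt m) a.
  have h3 : 3 / S j <= 3 / S k by rewrite ler_wpM2l.
  have xpt : `|x - pt m| <= 8 / S k by move: (SV_gt0 k); lra.
  have pta : `|pt m - a| <= 8 / S k by rewrite (distrC (pt m) x) in h2; lra.
  move=> l sl; apply: le_trans (Tay_diff_growth (J_sym Ka) (J_sym Kpt) e0 pta (hw _ Kpt pta) xpt sl) _.
  have -> : (1 + n%:R) ^+ p * 8 ^+ p * e / S k ^+ p * S k ^+ size l =
     (1 + n%:R) ^+ p * (e * (8 ^+ p * ((S k)^-1) ^+ (p - size l))) :> R.
    by rewrite -expr_div_sub ?gt_eqF //; ring.
  apply: ler_wpM2l; first by rewrite exprn_ge0 // addr_ge0.
  apply: ler_wpM2l => //; rewrite exprMn; apply: ler_wpM2r; first by rewrite exprn_ge0 // ltW.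
  by apply: ler_weXn2l; rewrite ?leq_subr // ler1n.
Qed.

Lemma cube_cover k x a : K a -> `|x - a| <= 2 / S k ->
  exists2 m : idx k, m \in cubes k &
    rel x m /\ exists U, [/\ open U, U x & forall y, U y -> cube_bump m y = 1].
Proof.
move=> Ka xa; have S1 := S_ge1 k.
have xa2 : `|x - a| <= 2.
  by apply: le_trans xa _; rewrite ler_pdivrMr // ler_peMr.
have xB : `|x| <= B%:R + 2.
  by have := ler_normD (x - a) a; rewrite subrK; have := K_bounded Ka; lra.
pose u i := S k * (x ord0 i + (B%:R + 4)).
have xi i : - (B%:R + 2) <= x ord0 i <= B%:R + 2.
  by rewrite -ler_norml; apply: le_trans xB; apply: coord_le_norm.
have u0 i : 0 <= u i.
  by rewrite mulr_ge0 //; [exact: ltW|have := xi i; lra].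
have uN i : (Num.truncn (u i) < N k)%N.
  have /andP [h1 h2] := truncn_itv (u0 i).
  rewrite -(ltr_nat R); apply: le_lt_trans h1 _.
  have -> : (N k)%:R = S k * (2 * B%:R + 8) :> R.
    by rewrite /N natrM natrX natrD natrM mulrC.
  by rewrite ltr_pM2l //; have := xi i; lra.
(* Rounding the scaled coordinates of [x] down gives a centre at distance at most $2^{-k}$, hence at
   most $3/2^k$ from [a]. The bump stays 1 on a further $2^{-k}$ around [x], because it is 1 up to
   the scaled distance 2. *)
pose m : idx k := [ffun i => Ordinal (uN i)].
have hm i : 0 <= u i - (m i : nat)%:R <= 1.
  rewrite ffunE /=; have /andP [h1 h2] := truncn_itv (u0 i).
  rewrite -natr1 in h2; lra.
have xm : `|S k *: (x - ctr m)| <= 1.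
  apply: norm_le_coord => // i; rewrite scaled_coord -/(u i) ler_norml.
  by have := hm i; lra.
have xm' : `|x - ctr m| <= (S k)^-1.
  by move: xm; rewrite normrZ (gtr0_norm (S_gt0 k)) -ler_pdivlMl // mulr1.
exists m.
  rewrite mem_filter mem_enum andbT; apply/asboolP; exists a; split => //.
  have := ler_distD x (ctr m) a; rewrite (distrC (ctr m) x); lra.
split; first by apply/forallP => i; rewrite -/(u i) ler_norml; have := hm i; lra.
exists [set y | `|y - x| < (S k)^-1]; split; first exact: open_ball_normr.
  by rewrite /= subrr normr0.
move=> y /= yx; apply: plateau1.
have -> : y - ctr m = (y - x) + (x - ctr m) by rewrite addrA subrK.
rewrite scalerDr; apply: le_trans (ler_normD _ _) _; rewrite normrZ (gtr0_norm (S_gt0 k)).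
by move: yx; rewrite -[_^-1]mulr1 ltr_pdivlMl // => /ltW; lra.
Qed.

(** The cube counts at the levels [k], [k.+1] and [k.+2] give the exponents [7 ^ n] and 3; the last
    factor is the one of [cube_tame]. *)
Definition whitney_cst : R :=
  (blend_cst p (Cb * 4 ^+ p) ^+ (7 ^ n)) ^+ 3 * ((1 + n%:R) ^+ p * 8 ^+ p).

Lemma whitney_cst_ge0 : 0 <= whitney_cst.
Proof.
have [Cb1 _] := CbP.
have : 0 <= blend_cst p (Cb * 4 ^+ p).
  by apply: le_trans ler01 (blend_cst_ge1 _ _); rewrite mulr_ge0 ?exprn_ge0 //; lra.
by move=> g; rewrite !mulr_ge0 ?exprn_ge0 // addr_ge0.
Qed.

(** The distance of [x] from [K] is comparable to $2^{-k}$. Level [k] has a cube whose bump is 1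
    near [x], which discards [approx k]; two more levels perturb the result boundedly; after that
    the extension is final near [x]. *)
Lemma whitney_ext_jet k x a (e : R) : K a -> `|x - a| <= 2 / S k -> 0 <= e ->
  (forall b, K b -> (S k)^-1 < `|x - b|) ->
  (forall b, K b -> `|b - a| <= 8 / S k -> forall l, (size l <= p)%N ->
     `|J b l - Tay (p - size l) (fun t => J a (l ++ t)) a b| <= e * `|b - a| ^+ (p - size l)) ->
  forall l, (size l <= p)%N ->
   `|pder whitney_ext l x - pder (Tay p (J a) a) l x| <= whitney_cst * (e * (S k)^-1 ^+ (p - size l)).
Proof.
move=> Ka xa e0 far hw l sl; have [Cb1 _] := CbP.
pose P := Tay p (J a) a; have hP : Ck p setT P by apply: Ck_Tay.
pose A : R := (1 + n%:R) ^+ p * 8 ^+ p * e / S k ^+ p.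
pose Q : R := blend_cst p (Cb * 4 ^+ p) ^+ (7 ^ n).
have C0 : 0 <= Cb * 4 ^+ p by rewrite mulr_ge0 ?exprn_ge0 //; lra.
have g1 := blend_cst_ge1 p C0.
have Q1 : 1 <= Q by apply: exprn_ege1.
have Q0 : 0 <= Q := le_trans ler01 Q1.
have A0 : 0 <= A.
  by rewrite mulr_ge0 ?invr_ge0 ?exprn_ge0 ?mulr_ge0 ?exprn_ge0 ?addr_ge0 // ltW.
have S0 : 0 <= S k := ltW (S_gt0 k).
have cnt j : blend_cst p (Cb * 4 ^+ p) ^+ (count (@rel j x) (cubes j)) <= Q.
  apply: ler_weXn2l => //; apply: leq_trans (count_near_grid (N j) (fun i => S j * (x ord0 i + (B%:R + 4)))).
  by rewrite /cubes count_filter; apply: sub_count => m /= /andP [].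
have tm j (kj : (k <= j <= k.+2)%N) m := @cube_tame j k x a e m kj Ka xa e0 hw.
have [m0 m0s [rm0 cov]] := cube_cover Ka xa.
have k0 : (k <= k <= k.+2)%N by rewrite leqnn !leqW.
have k1 : (k <= k.+1 <= k.+2)%N by rewrite leqnSn ltnS leqnSn.
have k2 : (k <= k.+2 <= k.+2)%N by rewrite leqnn !leqW.
have [_ _ _ /(_ rm0) [_ b0]] := tm k k0 m0 m0s.
have B1 := jet_le_blend_seq_reset S0 C0 A0 (Ck_approx k) hP (tm k k0) m0s cov b0.
have {}B1 : jet_le p (fun y => approx k.+1 y - P y) x (Q * A) (S k).
  by apply: jet_le_mono B1 => //; apply: ler_wpM2r => //; apply: cnt.
have AQ : A <= Q * A by rewrite ler_peMl.
have B2 := jet_le_blend_seq S0 C0 A0 AQ (Ck_approx k.+1) hP (tm k.+1 k1) B1.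
have {}B2 : jet_le p (fun y => approx k.+2 y - P y) x (Q * (Q * A)) (S k).
  by apply: jet_le_mono B2 => //; apply: ler_wpM2r; [rewrite mulr_ge0|apply: cnt].
have AQ2 : A <= Q * (Q * A) by apply: le_trans AQ _; rewrite ler_peMl // mulr_ge0.
have B3 := jet_le_blend_seq S0 C0 A0 AQ2 (Ck_approx k.+2) hP (tm k.+2 k2) B2.
have {}B3 : jet_le p (fun y => approx k.+3 y - P y) x (Q * (Q * (Q * A))) (S k).
  apply: jet_le_mono B3 => //; apply: ler_wpM2r; last exact: cnt.
  by rewrite (mulr_ge0 Q0) // mulr_ge0.
have -> : pder whitney_ext l x = pder (approx k.+3) l x.
  apply: (@pder_eq _ _ [set y | `|y - x| < (S k)^-1 / 4]); first exact: open_ball_normr.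
    by move=> y /= yx; rewrite (whitney_ext_near far).
  by rewrite /= subrr normr0 divr_gt0.
rewrite -(pder_sub openT (Ck_le sl (Ck_approx _)) (Ck_le sl hP)) //.
apply: le_trans (B3 l sl) _.
rewrite le_eqVlt; apply/orP; left; apply/eqP.
by rewrite /A /whitney_cst -/Q -expr_div_sub ?gt_eqF //; ring.
Qed.

End Whitney.

(** * Smoothness of the extension across the closed set *)

Section Assembly.
Variables (R : realType) (n p : nat) (K : set 'rV[R]_n).
Variable J : 'rV[R]_n -> seq 'I_n -> R.
Implicit Types (x y z a b c : 'rV[R]_n) (l : seq 'I_n) (F : 'rV[R]_n -> R).

Definition whitney_field := forall a0, K a0 -> forall e : R, 0 < e ->
  exists2 d : R, 0 < d & forall a b, K a -> K b -> `|a - a0| < d -> `|b - a0| < d ->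
    forall l, (size l <= p)%N ->
     `|J b l - Tay (p - size l) (fun t => J a (l ++ t)) a b| <= e * `|b - a| ^+ (p - size l).

(** The candidates [Fl l] join the given field on [K] to the derivatives of [F] outside. Whitney's
    condition on [K] and the estimate outside combine into one Taylor estimate around each point of
    [K], from which [Fl l] has partial derivatives [Fl (i :: l)] and is continuous; induction on the
    word identifies it with [pder F l]. *)
Lemma whitney_assembly F : open (~` K) -> (forall a, K a -> sym_jet p (J a)) ->
  whitney_field -> Ck p (~` K) F -> (forall a, K a -> F a = J a [::]) ->
  (forall a0, K a0 -> forall e : R, 0 < e ->
    exists2 d : R, 0 < d & forall x, ~ K x -> `|x - a0| < d ->
    forall l, (size l <= p)%N ->
     `|pder F l x - pder (Tay p (J a0) a0) l x| <= e * `|x - a0| ^+ (p - size l)) ->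
  Ck p setT F.
Proof.
move=> oK sJ WF cF F0 W.
pose Fl l x := if `[< K x >] then J x l else pder F l x.
have FlK a l : K a -> Fl l a = J a l by move=> Ka; rewrite /Fl asboolT.
have FlC x l : ~ K x -> Fl l x = pder F l x by move=> Kx; rewrite /Fl asboolF.
have TK a l : K a -> (size l <= p)%N -> pder (Tay p (J a) a) l a = J a l.
  by move=> Ka sl; rewrite pder_Tay ?sl ?Tay_base ?cats0 //; apply: sJ.
have W' a : K a -> forall e : R, 0 < e -> exists2 d : R, 0 < d & forall x, `|x - a| < d ->
    forall l, (size l <= p)%N ->
     `|Fl l x - pder (Tay p (J a) a) l x| <= e * `|x - a| ^+ (p - size l).
  move=> Ka e e0; have [d1 d10 h1] := WF a Ka e e0; have [d2 d20 h2] := W a Ka e e0.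
  exists (Num.min d1 d2) => [|x]; first by rewrite lt_min d10.
  rewrite lt_min => /andP [xd1 xd2] l sl.
  have [Kx|Kx] := EM (K x); last by rewrite FlC //; apply: h2.
  rewrite FlK // pder_Tay ?sl; last exact: sJ.
  by apply: h1; rewrite ?subrr ?normr0.
have cT a l x : {for x, continuous (pder (Tay p (J a) a) l)}.
  exact: (Ck_cont (Ck_pder (p := 0) (Ck_Tay _ _ _ _)) (I : setT x)).
have dFl l i x : pder F l = Fl l -> (size l < p)%N -> is_derive x (ei R i) (Fl l) (Fl (i :: l) x).
  move=> El sl; have [Kx|Kx] := EM (K x); last first.
    rewrite FlC // -El /=; have /Ck_Cp_on /(_ l (ltnW sl)) [_ d] := cF.
    by apply: derivableP; apply: d.
  rewrite FlK //.
  (* Minus the Taylor polynomial at [x], the increment along [ei R i] is at most [e * |t|], because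
     [size l < p] leaves at least one power of the distance; so that part has derivative 0. *)
  have -> : Fl l = (fun y => Fl l y - pder (Tay p (J x) x) l y) + pder (Tay p (J x) x) l.
    by apply/funext => y; rewrite -[in RHS]/((_ + _) y) /= -[(_ + _) y]/(_ + _) subrK.
  rewrite -[J x (i :: l)]add0r; apply: is_deriveD; last first.
    rewrite -(TK x (i :: l)) //=.
    exact: (@Ck_is_derive _ _ 0 setT _ x i (Ck_pder (p := 1) (Ck_Tay _ _ _ _)) I).
  apply/is_derive_edP => e e0; have [d d0 hd] := W' x Kx e e0.
  exists (Num.min d 1) => [|t]; first by rewrite lt_min d0 ltr01.
  rewrite lt_min => /andP [td /ltW t1].
  have te : `|t *: ei R i + x - x| <= `|t|.
    by rewrite addrK normrZ ler_piMr // norm_ei_le.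
  have := hd (t *: ei R i + x) (le_lt_trans te td) l (ltnW sl).
  rewrite (FlK x) // TK // ?(ltnW sl) // subrr subr0 mulr0 subr0 => /le_trans; apply.
  apply: (ler_wpM2l (ltW e0)); apply: (fun h => le_trans h te).
  rewrite -(subnSK sl) exprS; apply: ler_piMr => //.
  by apply: exprn_ile1 => //; exact: (le_trans te t1).
have EF l : (size l <= p)%N -> pder F l = Fl l.
  elim: l => [_|i l IH sl].
    apply/funext => x; have [Kx|Kx] := EM (K x); first by rewrite FlK //= F0.
    by rewrite FlC.
  have El := IH (ltnW sl); apply/funext => x /=; rewrite El.
  by have [_ ->] := dFl l i x El sl.
apply/Ck_Cp_on => l sl; split; last first.
  by move=> slt x _ i; rewrite EF //; have [] := dFl l i x (EF l sl) slt.
move=> x _; rewrite EF //; have [Kx|Kx] := EM (K x); last first.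
  rewrite -EF //; have /Ck_Cp_on /(_ l sl) [c _] := cF; exact: c.
apply/continuous_edP => e e0; have e20 : 0 < e / 2 by rewrite divr_gt0.
have [d d0 hd] := W' x Kx _ e20.
have /continuous_edP /(_ _ e20) [r r0 hr] := cT x l x.
exists (Num.min (Num.min d 1) r) => [|y]; first by rewrite !lt_min d0 r0 ltr01.
rewrite !lt_min => /andP [/andP [yd /ltW y1] yr].
have h1 := hd y yd l sl; have h2 := hr y yr; rewrite TK // in h2; rewrite (FlK x) //.
have h3 : e / 2 * `|y - x| ^+ (p - size l) <= e / 2.
  by rewrite ler_piMr ?(ltW e20) // exprn_ile1.
have := ler_distD (pder (Tay p (J x) x) l y) (Fl l y) (J x l); lra.
Qed.

Lemma whitney_extension : closed K -> (exists B : nat, forall a, K a -> `|a| <= B%:R) ->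
  (forall a, K a -> sym_jet p (J a)) -> whitney_field ->
  exists F, Ck p setT F /\ forall a, K a -> F a = J a [::].
Proof.
move=> cK [B hB] sJ WF; pose F := whitney_ext p K B J.
have F0 a : K a -> F a = J a [::] by move=> Ka; rewrite /F /whitney_ext asboolT.
exists F; split => //.
apply: whitney_assembly => //; [by rewrite openC|exact: Ck_whitney_ext|].
move=> a0 Ka0 e e0.
pose C := whitney_cst R n p; have C0 : 0 <= C := whitney_cst_ge0 R n p.
(* Two comparisons are made at [x]: the extension with the polynomial at a point [a] of [K] near
   [x], costing [C], and that polynomial with the one at [a0], costing the second term. The 1 makes
   [D] positive. *)
pose D := C + (1 + n%:R) ^+ p * 3 ^+ p + 1.
have q0 : 0 <= (1 + n%:R) ^+ p * 3 ^+ p :> R by rewrite mulr_ge0 ?exprn_ge0 // addr_ge0.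
have D0 : 0 < D by rewrite /D; lra.
have e'0 : 0 < e / D by rewrite divr_gt0.
have [d0 d00 hd0] := WF a0 Ka0 _ e'0.
(* With [r] the distance from [x] to [a0], the point [a] below lies within [3 * r] of [a0], and the
   points [b] that matter within [11 * r], so all of them fall in the range of [hd0]. *)
exists (Num.min d0 1 / 21) => [|x Kx]; first by rewrite divr_gt0 // lt_min d00 ltr01.
set d := Num.min d0 1; move=> xa0.
have dd0 : d <= d0 by rewrite ge_min lexx.
have d1 : d <= 1 by rewrite ge_min lexx orbT.
set r := `|x - a0| in xa0 *.
(* The last level before the first failure of a point of [K] within $2/2^k$ of [x]; failure at the
   next level is precisely the lower bound $2^{-k}$. *)
have [k [[a Ka xa] far]] : exists k : nat, (exists2 a, K a & `|x - a| <= 2 / 2 ^+ k) /\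
    forall b, K b -> (2 ^+ k)^-1 < `|x - b|.
  have [k1 hk1] := away_scale cK Kx.
  have ex : exists k, `[< ~ exists2 a, K a & `|x - a| <= 2 / 2 ^+ k >].
    exists k1.+1; apply/asboolP => -[a Ka]; apply/negP; rewrite -ltNge.
    by rewrite exprS invfM mulrA divff // mul1r; apply: hk1.
  case: (ex_minnP ex) => -[|m] /asboolP hm mmin.
    exfalso; apply: hm; exists a0 => //; rewrite expr0 divr1 -/r; lra.
  exists m; split.
    apply: contrapT => nh; have := mmin m; rewrite ltnn => /(_ _)/negP; apply.
      by apply/asboolP.
    by [].
  move=> b Kb; rewrite ltNge; apply/negP => h; apply: hm; exists b => //.
  by rewrite exprS invfM mulrA divff // mul1r.
move=> l sl; have far0 := far a0 Ka0.
set s := (2 ^+ k)^-1 in xa far far0 *; rewrite -/r in far0.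
have s0 : 0 <= s by rewrite invr_ge0 exprn_ge0.
have aa0 := ler_distD x a a0; rewrite (distrC a x) -/r in aa0.
have hw b : K b -> `|b - a| <= 8 * s -> forall l, (size l <= p)%N ->
     `|J b l - Tay (p - size l) (fun t => J a (l ++ t)) a b| <= e / D * `|b - a| ^+ (p - size l).
  move=> Kb ba; apply: hd0 => //; first lra.
  have := ler_distD a b a0; lra.
have H1 := whitney_ext_jet hB sJ Ka xa (ltW e'0) far hw sl; rewrite -/F -/C -/s in H1.
have H2 := @Tay_diff_growth R n p (J a0) (J a) a0 a (3 * r) (e / D) (sJ _ Ka0) (sJ _ Ka) (ltW e'0).
have {}H2 : `|pder (fun y => Tay p (J a) a y - Tay p (J a0) a0 y) l x| <=
    (1 + n%:R) ^+ p * (e / D * (3 * r) ^+ (p - size l)).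
  apply: H2 => //; [lra| |lra].
  apply: hd0 => //; first by rewrite subrr normr0.
  lra.
rewrite (pder_sub openT (Ck_Tay _ _ _ _) (Ck_Tay _ _ _ _)) // in H2.
set q := (p - size l)%N in H1 H2 *.
have r0 : 0 <= r by apply: normr_ge0.
have rq : 0 <= r ^+ q by apply: exprn_ge0.
have K1 : C * (e / D * s ^+ q) <= C * (e / D * r ^+ q).
  apply: ler_wpM2l => //; apply: ler_wpM2l; first exact: ltW.
  by apply: lerXn2r; rewrite ?nnegrE // ltW.
have K2 : (1 + n%:R) ^+ p * (e / D * (3 * r) ^+ q) <= (1 + n%:R) ^+ p * (3 ^+ p) * (e / D * r ^+ q).
  rewrite -[leRHS]mulrA; apply: ler_wpM2l; first by rewrite exprn_ge0 // addr_ge0.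
  rewrite mulrCA; apply: ler_wpM2l; first exact: ltW.
  rewrite exprMn; apply: ler_wpM2r => //.
  by apply: ler_weXn2l; rewrite ?leq_subr // ler1n.
have -> : e * r ^+ q = D * (e / D * r ^+ q) by field; rewrite gt_eqF.
have E0 : 0 <= e / D * r ^+ q by rewrite mulr_ge0 // ltW.
have := ler_distD (pder (Tay p (J a) a) l x) (pder F l x) (pder (Tay p (J a0) a0) l x).
move: K1 K2 E0; set X := e / D * r ^+ q => K1 K2 E0.
have -> : D * X = C * X + (1 + n%:R) ^+ p * 3 ^+ p * X + X by rewrite /D !mulrDl mul1r.
lra.
Qed.

End Assembly.

(** * Gluing local extensions *)

Section Globalization.
Variables (R : realType) (n p : nat) (X : set 'rV[R]_n) (f : 'rV[R]_n -> R).
Implicit Types (x y z a b c : 'rV[R]_n) (F : 'rV[R]_n -> R).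

Lemma compact_closed_ball (A : set 'rV[R]_n) (r : R) : closed A -> (forall x, A x -> `|x| <= r) ->
  compact A.
Proof.
move=> cA h; apply: bounded_closed_compact => //; exists r; split; first exact: num_real.
by move=> M hM x /= hx; apply: le_trans (h x hx) (ltW hM).
Qed.

Lemma closed_normr_le (r : R) : closed [set x : 'rV[R]_n | `|x| <= r].
Proof.
rewrite -openC; apply: open_ballP => x /negP; rewrite -ltNge => hx.
exists (`|x| - r); first by rewrite subr_gt0.
move=> y yx /= hy; have := ler_normD (x - y) y; rewrite subrK distrC; lra.
Qed.

Definition extendable_at x := exists (r : R) F,
  [/\ 0 < r, Ck p setT F & forall y, X y -> `|y - x| < r -> F y = f y].

(** Balls of a third of the local radius cover the compact part. The bumps are 1 on two thirds of
    the radius and vanish beyond it, where the local extension need not agree with [f]; so every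
    blending step keeps the value [f x] once it is reached. *)
Lemma extend_bounded (r : R) : closed X -> (forall x, X x -> extendable_at x) ->
  exists F, Ck p setT F /\ forall x, X x -> `|x| <= r -> F x = f x.
Proof.
move=> cX loc.
have loc' x : exists rF : R * ('rV[R]_n -> R),
    0 < rF.1 /\ Ck p setT rF.2 /\ (X x -> forall y, X y -> `|y - x| < rF.1 -> rF.2 y = f y).
  have [/loc [s [F [s0 cF hF]]]|nXx] := EM (X x); first by exists (s, F).
  by exists (1, fun=> 0); split => //=; split => //; apply: Ck_cst openT.
have [g hg] := choice loc'.
pose A := X `&` [set x | `|x| <= r].
have cA : compact A.
  apply: (@compact_closed_ball A r) => [|x [_ hx] //].
  by apply: closedI => //; apply: closed_normr_le.
pose V x := [set y : 'rV[R]_n | `|y - x| < (g x).1 / 3].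
rewrite compact_cover in cA; have [||D DA cov] := cA _ A V.
- by move=> x _; apply: open_ball_normr.
- move=> x Ax; exists x => //; rewrite /V /= subrr normr0 divr_gt0 //.
  by have [] := hg x.
pose chi x y := plateau p ((3 / (g x).1) *: (y - x)).
have nchi x y : `|(3 / (g x).1) *: (y - x)| = 3 * `|y - x| / (g x).1.
  have [g0 _] := hg x.
  by rewrite normrZ gtr0_norm ?divr_gt0 // mulrAC.
exists (blend_seq chi (fun x => (g x).2) (finmap.enum_fset D) (fun=> 0)); split.
  apply: Ck_blend_seq => [x _|x _|]; last exact: Ck_cst openT.
    exact/Ck_affine/Ck_plateau.
  by have [_ []] := hg x.
move=> x Xx xr; apply: blend_seq_eq_cover.
  have [c Dc xc] := cov x (conj Xx xr); exists c => //.
  have [g0 _] := hg c; apply: plateau1; rewrite nchi ler_pdivrMr //.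
  by move: xc; rewrite /V /=; lra.
move=> c Dc; have [g0 [_ hc]] := hg c.
have [xc|xc] := leP (g c).1 `|x - c|.
  by left; apply: plateau0; rewrite nchi ler_pdivlMr //; lra.
right; apply: hc => //; have := DA c Dc; rewrite inE => -[] //.
Qed.

(** [G k] is correct for $|x|\le 4\cdot2^k$, while [G k.+1] copies [G k] for $|x|\le 2\cdot2^k$ and
    leaves it altogether for $|x|\ge 3\cdot2^k$. Hence the sequence is locally stationary. *)
Lemma extend_global : closed X -> (forall x, X x -> extendable_at x) ->
  exists F, Ck p setT F /\ forall x, X x -> F x = f x.
Proof.
move=> cX loc; have [H hH] := choice (fun r => extend_bounded r cX loc).
pose chi k x := plateau p ((2 ^+ k)^-1 *: (x - 0)) : R.
pose fix G (k : nat) : 'rV[R]_n -> R := if k is j.+1 then blend (chi j) (G j) (H (4 * 2 ^+ k)) else H 4.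
have S0 k : 0 < 2 ^+ k :> R by apply: exprn_gt0.
have nchi k x : `|(2 ^+ k)^-1 *: (x - 0)| = `|x| / 2 ^+ k.
  by rewrite subr0 normrZ gtr0_norm ?invr_gt0 // mulrC.
have cG k : Ck p setT (G k).
  elim: k => [|k IH]; first by case: (hH 4).
  apply: Ck_blend => //; last by case: (hH (4 * 2 ^+ k.+1)).
  exact/Ck_affine/Ck_plateau.
have Gf k x : X x -> `|x| <= 4 * 2 ^+ k -> G k x = f x.
  move=> Xx; elim: k => [|k IH] xk; first by rewrite mulr1 in xk; exact: (hH 4).2.
  rewrite /= /blend; have [_ -> //] := hH (4 * 2 ^+ k.+1).
  have [h|h] := leP `|x| (4 * 2 ^+ k); first by rewrite IH // subrr mulr0 addr0.
  rewrite /chi plateau0 ?mul0r ?addr0 // nchi ler_pdivlMr //.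
  by have := S0 k; lra.
have Gs k j x : (k <= j)%N -> `|x| <= 2 * 2 ^+ k -> G j x = G k x.
  move=> kj xk; elim: j kj => [|j IH]; first by rewrite leqn0 => /eqP ->.
  rewrite leq_eqVlt => /orP [/eqP -> //|]; rewrite ltnS => kj; rewrite -IH //=.
  rewrite /blend /chi plateau1 ?mul1r; first by rewrite addrC subrK.
  rewrite nchi ler_pdivrMr //; apply: le_trans xk _.
  by rewrite ler_wpM2l // ler_weXn2l // ler1n.
pose F x := G (xget 0%N [set k | `|x| <= 2 * 2 ^+ k]) x.
have FG k x : `|x| <= 2 * 2 ^+ k -> F x = G k x.
  move=> xk; set P := [set k | `|x| <= 2 * 2 ^+ k].
  have : P (xget 0%N P) by apply: xgetPex; exists k.
  rewrite /F -/P; set k' := xget _ _ => xk'.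
  by rewrite -(Gs k (maxn k k')) ?leq_maxl // (Gs k' (maxn k k')) ?leq_maxr.
have ex x : exists k, `|x| < 2 * 2 ^+ k.
  have x1 : 0 < `|x| + 1 by apply: ltr_wpDl.
  have [k hk] := @pow2_small R (`|x| + 1)^-1 (etrans (invr_gt0 _) x1).
  exists k; have h := S0 k; move: hk; rewrite ltf_pV2 ?posrE //; lra.
exists F; split; last first.
  move=> x Xx; have [k /ltW hk] := ex x; rewrite (FG k) //; apply: Gf => //.
  by have := S0 k; lra.
apply: Ck_local => x _; have [k hk] := ex x.
exists [set y | `|y - 0| < 2 * 2 ^+ k]; split; first exact: open_ball_normr.
  by rewrite /= subr0.
apply: (@Ck_eq _ _ _ _ (G k)); first exact: open_ball_normr.
  by move=> y /=; rewrite subr0 => /ltW /FG.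
exact: Ck_sub (cG k).
Qed.

End Globalization.

(** * Functionals on polynomials and C^p functions *)

Section Pairing.
Variables (R : realType) (n p : nat).
Implicit Types (x y z a b c u v : 'rV[R]_n) (l s t : seq 'I_n) (ga be : mi n p) (xi eta : Dual R n p).
Implicit Types (Q : 'rV[R]_n -> R).

Lemma norm_le_enorm v : `|v| <= enorm v.
Proof.
apply: norm_le_coord; first exact: sqrtr_ge0.
move=> i; rewrite -sqrtr_sqr; apply: ler_wsqrtr.
by rewrite (bigD1 i) //= lerDl sumr_ge0 // => j _; apply: sqr_ge0.
Qed.

Lemma enorm_le v : enorm v <= n%:R * `|v|.
Proof.
have nv : 0 <= n%:R * `|v| by rewrite mulr_ge0.
rewrite -(ger0_norm nv) -sqrtr_sqr; apply: ler_wsqrtr.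
apply: (@le_trans _ _ (\sum_(i < n) `|v| ^+ 2)).
  apply: ler_sum => i _; rewrite -[leLHS]ger0_norm ?sqr_ge0 // normrX.
  by apply: lerXn2r; rewrite ?nnegrE // coord_le_norm.
rewrite sumr_const card_ord -[leLHS]mulr_natl exprMn; apply: ler_wpM2r; first exact: exprn_ge0.
by rewrite -natrX ler_nat; case: (n) => // m; rewrite leq_pmulr.
Qed.

Lemma enorm_ge0 v : 0 <= enorm v. Proof. exact: sqrtr_ge0. Qed.

(** Passing from multi-indices of degree at most [p] to all exponent functions allows a sum of
    products to be rewritten as a product of sums. *)
Lemma sum_mi (F : {ffun 'I_n -> 'I_p.+1} -> R) (P : pred {ffun 'I_n -> 'I_p.+1}) :
  (forall f : {ffun 'I_n -> 'I_p.+1}, ~~ (\sum_(i < n) (f i : nat) <= p)%N -> P f -> F f = 0) ->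
  \sum_(be : mi n p | P (val be)) F (val be) = \sum_(f | P f) F f.
Proof.
move=> h; pose A : {pred {ffun 'I_n -> 'I_p.+1}} := fun f => (\sum_(i < n) (f i : nat) <= p)%N.
rewrite -(big_sub_cond A P F) [RHS](bigID A) /=.
rewrite [X in _ = _ + X]big1 ?addr0; last by move=> f /andP [Pf nA]; apply: h.
by apply: eq_bigl => f; rewrite andbC.
Qed.

Lemma shifted_monomial ga (u b : 'I_n -> R) :
  \prod_i (u i - b i) ^+ (val ga i : nat) =
  \sum_(be : mi n p | [forall i, (val be i <= val ga i)%N])
     (\prod_(i < n) (('C(val ga i, val be i))%:R * (- b i) ^+ (val ga i - val be i)%N))
     * \prod_i u i ^+ (val be i : nat).
Proof.
pose F (f : {ffun 'I_n -> 'I_p.+1}) := (\prod_(i < n) (('C(val ga i, f i))%:R * (- b i) ^+ (val ga i - f i)%N))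
     * \prod_i u i ^+ (f i : nat).
rewrite (sum_mi (F := F) (P := fun f : {ffun 'I_n -> 'I_p.+1} => [forall i, (f i <= val ga i)%N])); last first.
  move=> f /negP nf /forallP hf; case: nf; apply: leq_trans (valP ga).
  by apply: leq_sum => i _; apply: hf.
have -> : \sum_(f : {ffun 'I_n -> 'I_p.+1} | [forall i, (f i <= val ga i)%N]) F f = \sum_f F f.
  rewrite [RHS](bigID (fun f : {ffun 'I_n -> 'I_p.+1} => [forall i, (f i <= val ga i)%N])) /=.
  rewrite [X in _ = _ + X]big1 ?addr0 // => f.
  rewrite negb_forall => /existsP [i]; rewrite -ltnNge => hi.
  by rewrite /F (bigD1 i) //= bin_small // !mul0r.
transitivity (\prod_i \sum_(j < p.+1)
   ('C(val ga i, j))%:R * (- b i) ^+ (val ga i - j)%N * u i ^+ j).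
  apply: eq_bigr => i _; rewrite addrC exprDn.
  have le : (val ga i < p.+1)%N by apply: ltn_ord.
  rewrite (big_ord_widen p.+1 (fun j => (- b i) ^+ (val ga i - j) * u i ^+ j *+ 'C(val ga i, j))) //.
  rewrite [RHS](bigID (fun j : 'I_p.+1 => (j < (val ga i).+1)%N)) /=.
  rewrite [X in _ = _ + X]big1 ?addr0; last first.
    by move=> j; rewrite -leqNgt => hj; rewrite bin_small // !mul0r.
  by apply: eq_bigr => j _; rewrite -mulr_natl mulrA.
rewrite bigA_distr_bigA; apply: eq_bigr => f _; rewrite /F -big_split.
by apply: eq_bigr.
Qed.

Definition vdm : 'M[R]_p.+1 := Vandermonde p.+1 (\row_j (j : nat)%:R).

Lemma vdm_unit : vdm \in unitmx.
Proof.
rewrite unitmxE det_Vandermonde unitfE; apply/prodf_neq0 => i _; apply/prodf_neq0 => j ij.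
by rewrite !mxE subr_eq0 eqr_nat neq_ltn ij orbT.
Qed.

(** For a polynomial $q$ of degree at most $p$ in one variable, summing [vdm_coef m j] times $q(j)$
    over [j] returns the coefficient of $t^m$. *)
Definition vdm_coef (m j : 'I_p.+1) : R := invmx vdm j m.

Lemma vdm_coefP (k m : 'I_p.+1) : \sum_j vdm_coef m j * (j : nat)%:R ^+ k = (k == m)%:R.
Proof.
have /matrixP /(_ k m) := mulmxV vdm_unit; rewrite !mxE => <-.
by apply: eq_bigr => j _; rewrite !mxE mulrC.
Qed.

Definition node (g : {ffun 'I_n -> 'I_p.+1}) : 'rV[R]_n := \row_i (g i : nat)%:R.

Definition weight (g : {ffun 'I_n -> 'I_p.+1}) xi : R :=
  \sum_ga xi ga * \prod_i vdm_coef (val ga i) (g i).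

(* Interpolation at the nodes {0..p}^n extends xi to a functional on all functions; it is
   linear in xi and in Q, and agrees with xi on P_p. *)
Definition pairing xi Q : R := \sum_g weight g xi * Q (node g).

Lemma pairing_monomial xi be : pairing xi (fun x => \prod_i x ord0 i ^+ (val be i : nat)) = xi be.
Proof.
rewrite /pairing; under eq_bigr => g _ do rewrite /weight mulr_suml.
rewrite exchange_big /= (bigD1 be) //= [X in _ + X]big1 ?addr0.
  under eq_bigr => g _.
    rewrite -mulrA -big_split /=.
    under eq_bigr => i _ do rewrite mxE.
    over.
  rewrite -mulr_sumr -(bigA_distr_bigA (fun i j => vdm_coef (val be i) j * (j : nat)%:R ^+ (val be i))).
  by rewrite big1 ?mulr1 // => i _; rewrite vdm_coefP eqxx.
move=> ga gb; under eq_bigr => g _.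
  rewrite -mulrA -big_split /=.
  under eq_bigr => i _ do rewrite mxE.
  over.
rewrite -mulr_sumr -(bigA_distr_bigA (fun i j => vdm_coef (val ga i) j * (j : nat)%:R ^+ (val be i))).
have [i hi] : exists i, val be i != val ga i.
  apply/existsP; apply: contraR gb; rewrite negb_exists => /forallP h.
  by apply/eqP/val_inj/ffunP => i; have := h i; rewrite negbK => /eqP.
by rewrite (bigD1 i) //= vdm_coefP (negPf hi) mul0r mulr0.
Qed.

Lemma pairing_sum (I : Type) (r : seq I) (P : pred I) xi (F : I -> 'rV[R]_n -> R) :
  pairing xi (fun x => \sum_(i <- r | P i) F i x) = \sum_(i <- r | P i) pairing xi (F i).
Proof. by rewrite exchange_big; apply: eq_bigr => g _; rewrite mulr_sumr. Qed.

Lemma pairing_scale xi (c : R) Q : pairing xi (fun x => c * Q x) = c * pairing xi Q.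
Proof. by rewrite mulr_sumr; apply: eq_bigr => g _; rewrite mulrCA. Qed.

Lemma pairing_sub xi Q Q' : pairing xi (fun x => Q x - Q' x) = pairing xi Q - pairing xi Q'.
Proof. by rewrite -sumrB; apply: eq_bigr => g _; rewrite mulrBr. Qed.

Lemma pairing_ext xi Q Q' : Q =1 Q' -> pairing xi Q = pairing xi Q'.
Proof. by move=> h; apply: eq_bigr => g _; rewrite h. Qed.

Lemma pairing_shifted xi ga b :
  pairing xi (fun x => \prod_i (x ord0 i - b ord0 i) ^+ (val ga i : nat)) =
  (\prod_(i < n) ((val ga i : nat)`!)%:R) * xi_at xi ga b.
Proof.
rewrite /xi_at mulrA divff ?mul1r; last first.
  by apply/prodf_neq0 => i _; rewrite pnatr_eq0 -lt0n fact_gt0.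
rewrite (@pairing_ext _ _ (fun x => \sum_(be : mi n p | [forall i, (val be i <= val ga i)%N])
  (\prod_(i < n) (('C(val ga i, val be i))%:R * (- b ord0 i) ^+ (val ga i - val be i)%N))
     * \prod_i x ord0 i ^+ (val be i : nat))); last by move=> x; apply: shifted_monomial.
by rewrite pairing_sum; apply: eq_bigr => be _; rewrite pairing_scale pairing_monomial.
Qed.

Definition lmono b l x : R := \prod_(j <- l) (x ord0 j - b ord0 j).

Lemma lmono_count b l x : lmono b l x = \prod_i (x ord0 i - b ord0 i) ^+ count_mem i l.
Proof.
elim: l => [|j l IH]; first by rewrite /lmono big_nil big1.
rewrite /lmono big_cons -/(lmono b l x) IH.
under [RHS]eq_bigr => i _ do rewrite /= exprD.
rewrite big_split /=; congr (_ * _).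
by rewrite (bigD1 j) //= eqxx expr1 big1 ?mulr1 // => i /negPf; rewrite eq_sym => ->.
Qed.

Lemma sum_count l : (\sum_i count_mem i l)%N = size l.
Proof.
elim: l => [|j l IH]; first by rewrite big1.
rewrite /= big_split /= IH (bigD1 j) //= eqxx big1 ?addn0 //.
by move=> i /negPf; rewrite eq_sym => ->.
Qed.

Lemma mi_of_list l : (size l <= p)%N ->
  exists ga, mdeg ga = size l /\ forall i, (val ga i : nat) = count_mem i l.
Proof.
move=> sl; have lt i : (count_mem i l < p.+1)%N.
  by rewrite ltnS; apply: leq_trans sl; apply: count_size.
pose f : {ffun 'I_n -> 'I_p.+1} := [ffun i => Ordinal (lt i)].
have fE : (\sum_(i < n) (f i : nat))%N = size l.
  by rewrite -(sum_count l); apply: eq_bigr => i _; rewrite ffunE.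
have fp : (\sum_(i < n) (f i : nat) <= p)%N by rewrite fE.
by exists (exist _ f fp); split => // i; rewrite /= ffunE.
Qed.

Lemma pairing_lmono xi b l : (size l <= p)%N -> exists2 ga, mdeg ga = size l &
  pairing xi (lmono b l) = (\prod_(i < n) ((val ga i : nat)`!)%:R) * xi_at xi ga b.
Proof.
move=> /mi_of_list [ga [dg hg]]; exists ga => //; rewrite -pairing_shifted.
by apply: pairing_ext => x; rewrite lmono_count; apply: eq_bigr => i _; rewrite hg.
Qed.

(** The induction moves one letter at a time from the sum into the prefix [s], until the pairing is
    with a single product of linear factors; there are [n ^ k] of these. *)
Lemma pairing_Sk_bound xi b k J s (C E : R) :
  (forall t, size t = k -> `|J t| <= C) ->
  (forall t, size t = k -> `|pairing xi (lmono b (s ++ t))| <= E) ->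
  `|pairing xi (fun x => lmono b s x * Sk k J b x)| <= n%:R ^+ k * (C * E).
Proof.
elim: k J s => [|k IH] J s hJ hE.
  rewrite mul1r /=; rewrite (@pairing_ext _ _ (fun x => J [::] * lmono b (s ++ [::]) x)); last first.
    by move=> x; rewrite cats0 mulrC.
  by rewrite pairing_scale normrM; apply: ler_pM => //; [apply: hJ|apply: hE].
rewrite (@pairing_ext _ _ (fun x => \sum_i lmono b (rcons s i) x * Sk k (fun t => J (i :: t)) b x)).
  rewrite pairing_sum; apply: le_trans (ler_norm_sum _ _ _) _.
  apply: (@le_trans _ _ (\sum_(i < n) n%:R ^+ k * (C * E))).
    apply: ler_sum => i _; apply: IH => t st; first by apply: hJ; rewrite /= st.
    by rewrite cat_rcons; apply: hE; rewrite /= st.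
  by rewrite sumr_const card_ord exprS -mulrA -[leLHS]mulr_natl.
move=> x; rewrite /= mulr_sumr; apply: eq_bigr => i _.
by rewrite mulrA /lmono -cats1 big_cat big_seq1.
Qed.

Lemma pairing_Tay_bound xi b J (C : nat -> R) (E : nat -> R) :
  (forall t, (size t <= p)%N -> `|J t| <= C (size t)) ->
  (forall t, (size t <= p)%N -> `|pairing xi (lmono b t)| <= E (size t)) ->
  `|pairing xi (Tay p J b)| <= \sum_(k < p.+1) n%:R ^+ k * (C k * E k).
Proof.
move=> hJ hE; rewrite pairing_sum; apply: le_trans (ler_norm_sum _ _ _) _.
apply: ler_sum => k _; rewrite pairing_scale normrM.
have H := @pairing_Sk_bound xi b k J [::] (C k) (E k).
have {}H : `|pairing xi (Sk k J b)| <= n%:R ^+ k * (C k * E k).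
  rewrite (@pairing_ext _ _ (fun x => lmono b [::] x * Sk k J b x)); last first.
    by move=> x; rewrite /lmono big_nil mul1r.
  by apply: H => t st; [have := hJ t|have := hE t]; rewrite st -ltnS => /(_ (ltn_ord _)).
apply: le_trans H; apply: ler_piMl => //.
by rewrite ger0_norm ?invr_ge0 // invf_le1 ?ltr0n ?fact_gt0 // ler1n fact_gt0.
Qed.

(** [pairing] samples at the fixed nodes and not at [a]; evaluation at [a] is recovered by expanding
    each factor in monomials. The terms of positive degree vanish by [pairing_Sk_bound] with
    [E = 0]. *)
Lemma pairing_delta_Tay a J : pairing (delta a) (Tay p J a) = J [::].
Proof.
have dm l : (size l <= p)%N -> pairing (delta a) (lmono a l) = if l is [::] then 1 else 0.
  move=> sl; have -> : pairing (delta a) (lmono a l) = lmono a l a.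
    have [ga [_ hg]] := mi_of_list sl.
    rewrite (@pairing_ext _ _ (fun x => \sum_(be : mi n p | [forall i, (val be i <= val ga i)%N])
      (\prod_(i < n) (('C(val ga i, val be i))%:R * (- a ord0 i) ^+ (val ga i - val be i)%N))
      * \prod_i x ord0 i ^+ (val be i : nat))); last first.
      move=> x; rewrite -shifted_monomial lmono_count.
      by apply: eq_bigr => i _; rewrite hg.
    rewrite pairing_sum lmono_count.
    have -> : \prod_i (a ord0 i - a ord0 i) ^+ count_mem i l =
       \prod_i (a ord0 i - a ord0 i) ^+ (val ga i : nat) by apply: eq_bigr => i _; rewrite hg.
    rewrite (shifted_monomial ga (fun i => a ord0 i) (fun i => a ord0 i)).
    by apply: eq_bigr => be _; rewrite pairing_scale pairing_monomial.
  by case: l {sl} => [|i l]; rewrite /lmono ?big_nil // big_cons subrr mul0r.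
rewrite /Tay pairing_sum big_ord_recl /= fact0 invr1.
rewrite (@pairing_ext _ _ (fun x => J [::] * lmono a [::] x)); last first.
  by move=> x; rewrite /lmono big_nil mul1r mulr1.
rewrite pairing_scale dm // mulr1 big1 ?addr0 // => k _.
rewrite pairing_scale; apply/eqP; rewrite mulf_eq0; apply/orP; right.
rewrite -normr_le0.
rewrite (@pairing_ext _ _ (fun x => lmono a [::] x * Sk (bump 0 k) J a x)); last first.
  by move=> x; rewrite /lmono big_nil mul1r.
have [C [_ hC]] := @list_bound R n (bump 0 k) (fun t C => `|J t| <= C)
  (fun t _ => ex_intro _ `|J t| (lexx _)) (fun l C C' CC' h => le_trans h CC').
rewrite -(mulr0 (n%:R ^+ bump 0 k)) -(mulr0 C); apply: pairing_Sk_bound.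
  by move=> t st; apply: hC; rewrite st.
move=> t st; rewrite dm ?st //; case: t st => [|//]; first by [].
by move=> *; rewrite normr0.
Qed.

End Pairing.

(** * The gradient of the restriction of a C^p function *)

Section Forward.
Variables (R : realType) (n p : nat) (F : 'rV[R]_n -> R).
Hypothesis F_Ck : Ck p setT F.
Implicit Types (x y z a b : 'rV[R]_n) (l t : seq 'I_n) (ga be : mi n p) (xi eta : Dual R n p).
Implicit Types (Q : 'rV[R]_n -> R) (X : set 'rV[R]_n).

Lemma polynomial_taylor Q b : Ck p setT Q ->
  (forall l x, size l = p -> pder Q l x = pder Q l b) ->
  forall x, Q x = Tay p (fun l => pder Q l b) b x.
Proof.
move=> hQ htop x; pose J l := pder Q l b.
have sJ : sym_jet p J := sym_pder openT I hQ.
have hD : Ck p setT (fun x => Q x - Tay p J b x) := Ck_sub_fun openT hQ (Ck_Tay _ _ _ _).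
have E t y : (size t <= p)%N -> pder (fun x => Q x - Tay p J b x) t y =
   pder Q t y - Tay (p - size t) (fun s => J (t ++ s)) b y.
  move=> st; rewrite (pder_sub openT (Ck_le st hQ) (Ck_Tay _ _ _ _)) //.
  by rewrite pder_Tay // st.
have := @jet_growth R n p setT _ b `|x - b| 1 0 (normr_ge0 _) ler01 (lexx _) hD (fun _ _ => I).
move=> H; have {H} := H _ _ x [::] _ isT; rewrite mul0r mulr0 normr_le0 subr_eq0 => H.
apply/eqP; apply: H => [t st|y t _ st|]; last by rewrite mul1r.
  by rewrite E ?(ltnW st) // Tay_base /J cats0 subrr normr0 mul0r.
by rewrite E ?st // subnn Tay0 /J cats0 htop // subrr normr0.
Qed.

Definition jetpoly a := Tay p (fun l => pder F l a) a.

Let sJ a : sym_jet p (fun l => pder F l a).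
Proof. exact: sym_pder openT I F_Ck. Qed.

(** [n ^ k] counts the words of length [k]; [p!^n] bounds every $\alpha!$. *)
Definition jump_cst : R := \sum_(k < p.+1) n%:R ^+ k * (p`!%:R ^+ n).

Lemma jump_cst_ge0 : 0 <= jump_cst.
Proof. by apply: sumr_ge0 => k _; rewrite mulr_ge0 // exprn_ge0. Qed.

(** The difference of the two Taylor polynomials is expanded at [b]. Its coefficients of order [k]
    are at most [e * h ^+ (p - k)] by Taylor's formula, and smallness bounds [eta] on the
    corresponding monomials by a constant over [h ^+ (p - k)], so the powers of [h] cancel. *)
Lemma pairing_jump a b eta (e : R) : small a b eta -> 0 <= e ->
  (forall l, (size l <= p)%N ->
   `|pder F l b - Tay (p - size l) (fun t => pder F (l ++ t) a) a b| <= e * `|b - a| ^+ (p - size l)) ->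
  `|pairing eta (jetpoly b) - pairing eta (jetpoly a)| <= e * jump_cst.
Proof.
move=> sm e0 hT; have [ab|ab] := eqVneq a b.
  by rewrite ab subrr normr0 mulr_ge0 // jump_cst_ge0.
set h := enorm (a - b).
have h0 : 0 < h.
  apply: lt_le_trans (norm_le_enorm _); by rewrite normr_gt0 subr_eq0.
have bah : `|b - a| <= h by rewrite distrC norm_le_enorm.
pose Q x := jetpoly b x - jetpoly a x.
have hQ : Ck p setT Q by apply: (Ck_sub_fun openT); apply: Ck_Tay.
have E t y : (size t <= p)%N -> pder Q t y =
   Tay (p - size t) (fun s => pder F (t ++ s) b) b y - Tay (p - size t) (fun s => pder F (t ++ s) a) a y.
  move=> st; rewrite (pder_sub openT (Ck_Tay _ _ _ _) (Ck_Tay _ _ _ _)) //.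
  by rewrite !pder_Tay // st.
rewrite -pairing_sub (@pairing_ext _ _ _ _ _ (Tay p (fun l => pder Q l b) b)); last first.
  apply: polynomial_taylor => // l x sl; by rewrite !E ?sl // subnn !Tay0.
pose Cf : R := p`!%:R ^+ n.
have Cf0 : 0 <= Cf by rewrite exprn_ge0.
have := @pairing_Tay_bound R n p eta b (fun l => pder Q l b) (fun k => e * h ^+ (p - k))
  (fun k => Cf / h ^+ (p - k)) => H.
apply: le_trans (H _ _) _.
- move=> t st; rewrite E // Tay_base cats0; apply: le_trans (hT t st) _.
  by apply: ler_wpM2l => //; apply: lerXn2r; rewrite ?nnegrE // ltW.
- move=> t st; have [ga dg ->] := pairing_lmono eta b st.
  rewrite ler_pdivlMr ?exprn_gt0 // normrM -mulrA.
  apply: (@le_trans _ _ (Cf * 1)); last by rewrite mulr1.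
  apply: ler_pM => //; [by rewrite mulr_ge0 // exprn_ge0 // ltW| |by have := sm ga; rewrite dg mulrC].
  rewrite ger0_norm ?prodr_ge0 //.
  have -> : Cf = \prod_(i < n) p`!%:R by rewrite prodr_const card_ord.
  apply: ler_prod => i _; rewrite ler0n ler_nat /=.
  have : (val ga i <= p)%N by rewrite -ltnS.
  elim: p (nat_of_ord _) => [|q IH] m; first by rewrite leqn0 => /eqP ->.
  rewrite leq_eqVlt => /orP [/eqP -> //|]; rewrite ltnS => /IH /leq_trans; apply.
  by rewrite factS leq_pmull.
- rewrite /jump_cst mulr_sumr; apply: ler_sum => k _.
  rewrite le_eqVlt; apply/orP; left; apply/eqP; rewrite -/Cf; field.
  by rewrite expf_neq0 // gt_eqF.
Qed.

Lemma jetpoly_continuous x a : {for a, continuous (fun b => jetpoly b x)}.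
Proof.
have c k (J : 'rV[R]_n -> seq 'I_n -> R) : (forall l, (size l <= k)%N -> Ck 0 setT (fun b => J b l)) ->
    Ck 0 setT (fun b => Sk k (J b) b x).
  elim: k J => [|k IH] J hJ; first exact: hJ.
  apply: (Ck_sum _ openT) => i _; apply: (Ck_mul openT).
    exact: (Ck_sub_fun openT (Ck_cst _ _ openT) (Ck_coord _ _ openT)).
  by apply: IH => l sl; apply: hJ.
apply: (@Ck_cont _ _ 0 setT) => //; apply: (Ck_sum _ openT) => k _.
apply: (Ck_scale _ openT); apply: c => l sl; apply: Ck_pder; apply: Ck_le F_Ck.
by rewrite add0n; apply: leq_trans sl _; rewrite -ltnS.
Qed.

(** Only the sum of [xi] and [eta] is near [z]; separately they may be unbounded. So [eta] is first
    moved from [b'] to [a'] by [pairing_jump]; the sum is then replaced by [z], and [a'] by [a],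
    using continuity at the finitely many nodes. Each move costs at most a third of [e]. *)
Lemma pairing_close a (z : Dual R n p) (e : R) : 0 < e -> exists2 d : R, 0 < d &
  forall a' b' xi eta, small a' b' eta -> `|a' - a| < d -> `|b' - a| < d ->
    (forall be, `|xi be + eta be - z be| < d) ->
    `|pairing xi (jetpoly a') + pairing eta (jetpoly b') - pairing z (jetpoly a)| < e.
Proof.
move=> e0.
pose W (g : {ffun 'I_n -> 'I_p.+1}) : R := \sum_(ga : mi n p) `|\prod_i vdm_coef R (val ga i) (g i)|.
pose A1 := \sum_g W g * (`|jetpoly a (node R g)| + 1).
pose A2 := \sum_g `|weight g z|.
have W0 g : 0 <= W g by apply: sumr_ge0.
have A10 : 0 <= A1 by apply: sumr_ge0 => g _; rewrite mulr_ge0 // addr_ge0.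
have A20 : 0 <= A2 by apply: sumr_ge0.
have C0 := jump_cst_ge0.
have e1 : 0 < e / 3 / (A2 + 1) by rewrite !divr_gt0 //; lra.
pose e2 := Num.min 1 (e / 3 / (A2 + 1)).
have e20 : 0 < e2 by rewrite lt_min ltr01.
have [d1 d10 h1] : exists2 d : R, 0 < d & forall g : {ffun 'I_n -> 'I_p.+1}, forall b, `|b - a| < d ->
    `|jetpoly b (node R g) - jetpoly a (node R g)| < e2.
  apply: (@fin_min R {ffun 'I_n -> 'I_p.+1} (fun g (d : R) => forall b, `|b - a| < d ->
    `|jetpoly b (node R g) - jetpoly a (node R g)| < e2)).
    by move=> g; have /continuous_edP /(_ _ e20) := @jetpoly_continuous (node R g) a.
  by move=> g d d' _ dd' hd b bd; apply: hd; apply: lt_le_trans dd'.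
have e3 : 0 < e / 3 / (jump_cst + 1) by rewrite !divr_gt0 //; lra.
have [d2 d20 h2] := uniform_taylor openT (I : setT a) F_Ck e3.
have e4 : 0 < e / 3 / (A1 + 1) by rewrite !divr_gt0 //; lra.
exists (Num.min (Num.min d1 d2) (e / 3 / (A1 + 1))); first by rewrite !lt_min d10 d20.
move=> a' b' xi eta sm; rewrite !lt_min => /andP [/andP [a1 a2] _] /andP [/andP [b1 b2] _] hz.
have [_ _ hT] := h2 a' b' a2 b2.
have J1 := pairing_jump sm (ltW e3) hT.
have {}J1 : `|pairing eta (jetpoly b') - pairing eta (jetpoly a')| <= e / 3.
  apply: le_trans J1 _; rewrite -mulrA ler_piMr //; first lra.
  by rewrite mulrC ler_pdivrMr; lra.
have wE g xi' eta' : weight g xi' + weight g eta' = weight g (fun be => xi' be + eta' be).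
  by rewrite /weight -big_split; apply: eq_bigr => ga _; rewrite mulrDl.
have wE' g xi' eta' : weight g xi' - weight g eta' = weight g (fun be => xi' be - eta' be).
  by rewrite /weight -sumrB; apply: eq_bigr => ga _; rewrite mulrBl.
have J2 : `|pairing xi (jetpoly a') + pairing eta (jetpoly a') - pairing z (jetpoly a')| <= e / 3 * (A1 / (A1 + 1)).
  have -> : pairing xi (jetpoly a') + pairing eta (jetpoly a') - pairing z (jetpoly a') =
      \sum_g weight g (fun be => xi be + eta be - z be) * jetpoly a' (node R g).
    by rewrite /pairing -big_split -sumrB; apply: eq_bigr => g _ /=; rewrite -wE' -wE; ring.
  have -> : e / 3 * (A1 / (A1 + 1)) = e / 3 / (A1 + 1) * A1 by rewrite [LHS]mulrA [LHS]mulrAC.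
  rewrite /A1 mulr_sumr; apply: le_trans (ler_norm_sum _ _ _) _.
  apply: ler_sum => g _; rewrite normrM mulrA; apply: ler_pM => //.
    rewrite /W mulr_sumr; apply: le_trans (ler_norm_sum _ _ _) _.
    apply: ler_sum => ga _; rewrite normrM; apply: ler_wpM2r => //; apply: ltW.
    by have := hz ga; rewrite !lt_min => /andP [].
  have := h1 g a' a1; rewrite lt_min => /andP [/ltW k1 _].
  have := ler_normD (jetpoly a' (node R g) - jetpoly a (node R g)) (jetpoly a (node R g)).
  rewrite subrK; lra.
have J3 : `|pairing z (jetpoly a') - pairing z (jetpoly a)| <= e / 3 * (A2 / (A2 + 1)).
  rewrite -sumrB; apply: le_trans (ler_norm_sum _ _ _) _.
  have -> : e / 3 * (A2 / (A2 + 1)) = A2 * (e / 3 / (A2 + 1)) by rewrite [LHS]mulrCA.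
  rewrite /A2 mulr_suml; apply: ler_sum => g _; rewrite -mulrBr normrM; apply: ler_wpM2l => //.
  by have := h1 g a' a1; rewrite lt_min => /andP [_ /ltW].
have e30 : 0 < e / 3 by rewrite divr_gt0.
have frac1 (A : R) : 0 <= A -> e / 3 * (A / (A + 1)) < e / 3.
  move=> A0; have A1' : 0 < A + 1 by rewrite ltr_wpDl.
  by rewrite gtr_pMr // ltr_pdivrMr // mul1r ltrDl.
have K1 := frac1 _ A10; have K2 := frac1 _ A20.
have -> : pairing xi (jetpoly a') + pairing eta (jetpoly b') - pairing z (jetpoly a) =
  (pairing eta (jetpoly b') - pairing eta (jetpoly a')) +
  ((pairing xi (jetpoly a') + pairing eta (jetpoly a') - pairing z (jetpoly a')) +
   (pairing z (jetpoly a') - pairing z (jetpoly a))) by ring.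
apply: le_lt_trans (ler_normD _ _) _; have := ler_normD
 (pairing xi (jetpoly a') + pairing eta (jetpoly a') - pairing z (jetpoly a'))
 (pairing z (jetpoly a') - pairing z (jetpoly a)); lra.
Qed.

Variables (X : set 'rV[R]_n) (f : 'rV[R]_n -> R).
Hypothesis F_ext : forall x, X x -> F x = f x.

Lemma pairing_sum_dual (I : Type) (r : seq I) (c : I -> R) (w : I -> Dual R n p) Q :
  pairing (fun be => \sum_(i <- r) c i * w i be) Q = \sum_(i <- r) c i * pairing (w i) Q.
Proof.
rewrite /pairing; under [RHS]eq_bigr => i _ do rewrite mulr_sumr.
rewrite exchange_big; apply: eq_bigr => g _ /=.
have -> : weight g (fun be => \sum_(i <- r) c i * w i be) = \sum_(i <- r) c i * weight g (w i).
  rewrite /weight; under [RHS]eq_bigr => i _ do rewrite mulr_sumr.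
  rewrite exchange_big; apply: eq_bigr => ga _ /=; rewrite mulr_suml.
  by apply: eq_bigr => i _; rewrite mulrA.
by rewrite mulr_suml; apply: eq_bigr => i _; rewrite mulrA.
Qed.

Lemma pairing_dual_ext xi xi' Q : xi =1 xi' -> pairing xi Q = pairing xi' Q.
Proof.
move=> h; apply: eq_bigr => g _; congr (_ * _).
by apply: eq_bigr => ga _; rewrite h.
Qed.

Lemma Phi_value j a xi (la : R) :
  iter j (rhoPhi X) (Phi0 X f) a xi la -> la = pairing xi (jetpoly a).
Proof.
elim: j a xi la => [|j IH] a xi la.
  move=> [Xa [c [hxi ->]]]; rewrite (pairing_dual_ext _ hxi).
  have -> : pairing (fun be => c * delta a be) (jetpoly a) = c * pairing (@delta R n p a) (jetpoly a).
    rewrite /pairing mulr_sumr; apply: eq_bigr => g _; rewrite mulrA; congr (_ * _).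
    by rewrite /weight mulr_sumr; apply: eq_bigr => ga _; rewrite mulrA.
  by rewrite pairing_delta_Tay /= F_ext.
move=> [k [c [w [v [hw hxi ->]]]]]; rewrite (pairing_dual_ext _ hxi) pairing_sum_dual.
apply: eq_bigr => i _; congr (_ * _).
apply/eqP; rewrite -subr_eq0 -normr_le0; apply/ler_addgt0Pl => e e0; rewrite addr0.
have [d d0 hd] := pairing_close a (w i) (divr_gt0 e0 (ltr0n R 2)).
have m0 : 0 < Num.min d (e / 2) by rewrite lt_min d0 divr_gt0.
have [a' [b' [z [nu [[xi' [l [eta [m [Xa' [Xb' [h1 [h2 [sm [hz hnu]]]]]]]]]] [ha [hb [hzw hv]]]]]]]] :=
  hw i _ m0.
move: ha hb hv; rewrite !lt_min => /andP [ha _] /andP [hb _] /andP [_ hv].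
have := hd a' b' xi' eta sm (le_lt_trans (norm_le_enorm _) ha) (le_lt_trans (norm_le_enorm _) hb).
have hzd be : `|xi' be + eta be - w i be| < d.
  by have := hzw be; rewrite hz lt_min => /andP [].
move=> /(_ hzd); rewrite -(IH _ _ _ h1) -(IH _ _ _ h2) -hnu => H.
have := ler_distD nu (v i) (pairing (w i) (jetpoly a)); rewrite (distrC (v i) nu).
lra.
Qed.

Lemma Phi_exists j a xi :
  iter j (rho X) (E0 X) a xi -> iter j (rhoPhi X) (Phi0 X f) a xi (pairing xi (jetpoly a)).
Proof.
elim: j a xi => [|j IH] a xi.
  move=> [Xa [c hxi]]; split => //; exists c; split => //.
  by apply: esym; apply: (@Phi_value 0 a); split => //; exists c.
move=> [k [c [w [hw hxi]]]]; exists k, c, w, (fun i => pairing (w i) (jetpoly a)); split => //.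
  move=> i e e0; have [d d0 hd] := pairing_close a (w i) e0.
  have m0 : 0 < Num.min d e by rewrite lt_min d0.
  have [a' [b' [z [[xi' [eta [Xa' [Xb' [h1 [h2 [sm hz]]]]]]] ha hb hzw]]]] := hw i _ m0.
  move: ha hb; rewrite !lt_min => /andP [ha ha'] /andP [hb hb'].
  exists a', b', z, (pairing xi' (jetpoly a') + pairing eta (jetpoly b')); split.
    exists xi', (pairing xi' (jetpoly a')), eta, (pairing eta (jetpoly b')).
    do 2 (split => //); split; first exact: IH.
    by split; first exact: IH.
  do 2 (split => //); split.
    by move=> be; have := hzw be; rewrite lt_min => /andP [].
  apply: (hd a' b' xi' eta sm (le_lt_trans (norm_le_enorm _) ha) (le_lt_trans (norm_le_enorm _) hb)).
  by move=> be; have := hzw be; rewrite hz lt_min => /andP [].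
by rewrite (pairing_dual_ext _ hxi) pairing_sum_dual.
Qed.

End Forward.

(** * The bundles rho^j(Phi_0) *)

Section PhiLinear.
Variables (R : realType) (n p : nat) (X : set 'rV[R]_n) (f : 'rV[R]_n -> R).
Implicit Types (x y z a b : 'rV[R]_n) (l t : seq 'I_n) (ga be : mi n p) (xi eta : Dual R n p).

Definition Phi_iter j : pbundle R n p := iter j (rhoPhi X) (Phi0 X f).

Lemma xi_at_scale (c : R) xi ga b : xi_at (fun be => c * xi be) ga b = c * xi_at xi ga b.
Proof.
rewrite /xi_at [RHS]mulrCA; congr (_ * _); rewrite mulr_sumr.
by apply: eq_bigr => be _; rewrite mulrCA.
Qed.

Lemma small_scale (c : R) a b eta : `|c| <= 1 -> small a b eta -> small a b (fun be => c * eta be).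
Proof.
move=> c1 sm ga; rewrite xi_at_scale normrM mulrCA; apply: le_trans (sm ga).
by rewrite ler_piMl // mulr_ge0 // exprn_ge0 // enorm_ge0.
Qed.

Lemma small0 a b : small a b (fun _ : mi n p => 0 : R).
Proof.
move=> ga; have -> : xi_at (fun _ : mi n p => 0 : R) ga b = 0.
  by rewrite /xi_at [X in _ * X]big1 ?mulr0 // => be _; rewrite mulr0.
by rewrite normr0 mulr0.
Qed.

Lemma Phi_scale j a xi (la c : R) : Phi_iter j a xi la ->
  Phi_iter j a (fun be => c * xi be) (c * la).
Proof.
case: j => [|j].
  move=> [Xa [c' [h ->]]]; split => //; exists (c * c'); split; last by rewrite mulrA.
  by move=> be; rewrite h mulrA.
move=> [k [e [w [v [hw h ->]]]]]; exists k, (fun i => c * e i), w, v; split => //.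
  by move=> be; rewrite h mulr_sumr; apply: eq_bigr => i _; rewrite mulrA.
by rewrite mulr_sumr; apply: eq_bigr => i _; rewrite mulrA.
Qed.

Lemma Phi_add j a xi xi' (la la' : R) : Phi_iter j a xi la -> Phi_iter j a xi' la' ->
  Phi_iter j a (fun be => xi be + xi' be) (la + la').
Proof.
case: j => [|j].
  move=> [Xa [c [h ->]]] [_ [c' [h' ->]]]; split => //; exists (c + c'); split; last by rewrite mulrDl.
  by move=> be; rewrite h h' mulrDl.
move=> [k [e [w [v [hw h ->]]]]] [k' [e' [w' [v' [hw' h' ->]]]]].
exists (k + k')%N, (fun i => match fintype.split i with inl i => e i | inr i => e' i end),
  (fun i => match fintype.split i with inl i => w i | inr i => w' i end),
  (fun i => match fintype.split i with inl i => v i | inr i => v' i end); split.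
- by move=> i; case: (fintype.split i).
- move=> be; rewrite h h' big_split_ord /=; congr (_ + _); apply: eq_bigr => i _.
    by rewrite (unsplitK (inl i)).
  by rewrite (unsplitK (inr i)).
- rewrite big_split_ord /=; congr (_ + _); apply: eq_bigr => i _.
    by rewrite (unsplitK (inl i)).
  by rewrite (unsplitK (inr i)).
Qed.

Lemma Phi_zero j a : X a -> Phi_iter j a (fun=> 0) 0.
Proof.
move=> Xa; case: j => [|j]; first by split => //; exists 0; split => [be|]; rewrite mul0r.
exists 0%N, (fun=> 0), (fun _ _ => 0), (fun=> 0).
by split => [[]//|be|]; rewrite big_ord0.
Qed.

Lemma Phi_prime_sub j a xi (la : R) : Phiprime X (Phi_iter j) a xi la -> Phi_iter j.+1 a xi la.
Proof.
move=> h; exists 1%N, (fun=> 1), (fun=> xi), (fun=> la).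
by split => [//|be|]; rewrite big_ord1 mul1r.
Qed.

Lemma enorm0 : enorm (0 : 'rV[R]_n) = 0.
Proof. by rewrite /enorm big1 ?sqrtr0 // => i _; rewrite mxE expr0n. Qed.

Lemma Phi_mono1 j a xi (la : R) : X a -> Phi_iter j a xi la -> Phi_iter j.+1 a xi la.
Proof.
move=> Xa h; apply: Phi_prime_sub => e e0; exists a, a, xi, la; split.
  exists xi, la, (fun=> 0), 0; split => //; split => //; split => //.
  split; first exact: Phi_zero.
  by split; [apply: small0|split => [be|]; rewrite addr0].
by rewrite !subrr enorm0 normr0; do 3 split => //; move=> be; rewrite subrr normr0.
Qed.

Lemma Phi_mono j k a xi (la : R) : X a -> (j <= k)%N -> Phi_iter j a xi la -> Phi_iter k a xi la.
Proof.
move=> Xa; elim: k => [|k IH]; first by rewrite leqn0 => /eqP ->.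
rewrite leq_eqVlt => /orP [/eqP -> //|]; rewrite ltnS => jk h.
exact: Phi_mono1 (IH jk h).
Qed.

Lemma Delta_scale j a b (z : Dual R n p) (nu c : R) : `|c| <= 1 -> DeltaPhi X (Phi_iter j) a b z nu ->
  DeltaPhi X (Phi_iter j) a b (fun be => c * z be) (c * nu).
Proof.
move=> c1 [xi [l [eta [m [Xa [Xb [h1 [h2 [sm [hz ->]]]]]]]]]].
exists (fun be => c * xi be), (c * l), (fun be => c * eta be), (c * m).
do 2 (split => //); split; first exact: Phi_scale.
split; first exact: Phi_scale.
split; first exact: small_scale.
by split => [be|]; rewrite ?hz mulrDr.
Qed.

(** Membership in [Phiprime] with the condition on the value removed, so that the set of
    approximating values can be studied for boundedness. *)
Definition close_to j a xi (e nu : R) := exists a' b' (z : Dual R n p),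
  [/\ DeltaPhi X (Phi_iter j) a' b' z nu, enorm (a' - a) < e, enorm (b' - a) < e &
    forall be, `|z be - xi be| < e].

(* If the values nu were unbounded, rescaling by 1 / nu would put (0, 1) in Phi'. *)
Lemma Phi_closure j a xi :
  (forall la : R, Phiprime X (Phi_iter j) a (fun=> 0) la -> la = 0) ->
  (forall e : R, 0 < e -> exists nu, close_to j a xi e nu) ->
  exists la, Phiprime X (Phi_iter j) a xi la.
Proof.
move=> uniq h.
have [[e0 e00 [A hA]]|nb] := EM (exists2 e0 : R, 0 < e0 & exists A : R, forall nu,
    close_to j a xi e0 nu -> `|nu| <= A); last first.
  suff /uniq /eqP : Phiprime X (Phi_iter j) a (fun=> 0) 1 by rewrite oner_eq0.
  move=> e e0; pose B := \sum_be `|xi be| + 1.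
  have B0 : 0 < B by rewrite ltr_wpDl // sumr_ge0.
  (* [B] bounds the entries of [z], so this threshold makes [z / nu] smaller than [e], and the 1
     makes the rescaling a contraction, which preserves smallness. *)
  have [nu [nuB [a' [b' [z [hD ha hb hz]]]]]] :
      exists nu, 1 + B / e < `|nu| /\ close_to j a xi (Num.min 1 e) nu.
    apply: contrapT => hn; apply: nb; exists (Num.min 1 e); first by rewrite lt_min ltr01.
    exists (1 + B / e) => nu hnu; rewrite leNgt; apply/negP => lt.
    by apply: hn; exists nu.
  have Be : 0 < B / e by rewrite divr_gt0.
  have nu0 : nu != 0 by rewrite -normr_gt0; lra.
  have nu1 : `|nu^-1| <= 1 by rewrite normfV invf_le1 ?normr_gt0 //; lra.
  exists a', b', (fun be => nu^-1 * z be), (nu^-1 * nu); split; first exact: Delta_scale.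
  move: ha hb; rewrite !lt_min => /andP [_ ha] /andP [_ hb].
  do 2 (split => //); split; last by rewrite mulVf // subrr normr0.
  move=> be; rewrite subr0 normrM normfV mulrC ltr_pdivrMr ?normr_gt0 //.
  have := hz be; rewrite lt_min => /andP [hz1 _].
  have := ler_normD (z be - xi be) (xi be); rewrite subrK => h2.
  have : `|xi be| <= \sum_be `|xi be| by rewrite (bigD1 be) //= lerDl sumr_ge0.
  have : B < e * `|nu| by rewrite -ltr_pdivrMl // mulrC; lra.
  rewrite /B; lra.
have S0 k : 0 < Num.min e0 (2 ^+ k)^-1 :> R by rewrite lt_min e00 invr_gt0 exprn_gt0.
have [u hu] := choice (fun k => h _ (S0 k)).
have uA k : `|u k| <= A.
  have [a' [b' [z [hD ha hb hz]]]] := hu k; apply: hA; exists a', b', z.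
  move: ha hb; rewrite !lt_min => /andP [? _] /andP [? _]; split => // be.
  by have := hz be; rewrite lt_min => /andP [].
have cK : compact `[-A, A]%classic by apply: segment_compact.
have [|l [_ cl]] := cK (u @ \oo) _.
  exists 0%N => // k _ /=; rewrite in_itv /= -ler_norml; exact: uA.
exists l => e e1; have [N hN] := pow2_small e1.
have hF : (u @ \oo) [set u k | k in [set k | (N <= k)%N]].
  by exists N => // k /= Nk; exists k.
have hB : nbhs l (ball l e) by apply: nbhsx_ballx.
have [_ [[k /= Nk <-] lk]] := cl _ _ hF hB.
have [a' [b' [z [hD ha hb hz]]]] := hu k.
have le (x : R) : x < Num.min e0 (2 ^+ k)^-1 -> x < e.
  rewrite lt_min => /andP [_ h1]; apply: lt_trans h1 _; apply: le_lt_trans hN.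
  by rewrite lef_pV2 ?posrE ?exprn_gt0 //; apply: ler_weXn2l => //; rewrite ler1n.
exists a', b', z, (u k); split => //; split; first exact: le.
split; first exact: le.
split; first by move=> be; apply: le.
by rewrite distrC.
Qed.

End PhiLinear.

(** The powers of one coordinate already give [p.+1] multi-indices, provided there is a
    coordinate. *)
Lemma rdim_gt n p : (p < rdim n.+1 p)%N.
Proof.
rewrite /rdim -[leqLHS](card_ord p.+1).
pose g (k : 'I_p.+1) : {ffun 'I_n.+1 -> 'I_p.+1} := [ffun i => if i == ord0 then k else ord0].
have gp k : (\sum_(i < n.+1) (g k i : nat) <= p)%N.
  rewrite (bigD1 ord0) //= ffunE eqxx big1 ?addn0; first by rewrite -ltnS.
  by move=> i /negPf ni; rewrite ffunE ni.
apply: (@leq_card _ _ (fun k => exist _ (g k) (gp k) : mi n.+1 p)).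
by move=> k k' /(congr1 val) /ffunP /(_ ord0); rewrite !ffunE.
Qed.

Lemma nabla_function_of_extension (R : realType) (n p : nat) (X : set 'rV[R]_n) (f F : 'rV[R]_n -> R) :
  Ck p setT F -> (forall x, X x -> F x = f x) -> nabla_is_function p X f.
Proof.
move=> cF Ff a Xa xi txi; exists (pairing xi (jetpoly p F a)); split.
  have le : (2 * rdim n p <= 2 * (rdim n p).+1)%N by lia.
  exact: (@Phi_mono R n p X f _ _ a xi _ Xa le (Phi_exists cF Ff txi)).
by move=> l /(Phi_value cF Ff) ->.
Qed.

(** * The Whitney field of a function with single-valued gradient *)

Lemma list_min (R : realType) (n p : nat) (Q : seq 'I_n -> R -> Prop) :
  (forall l, (size l <= p)%N -> exists2 d, 0 < d & Q l d) ->
  (forall l d d', 0 < d' -> d' <= d -> Q l d -> Q l d') ->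
  exists2 d, 0 < d & forall l, (size l <= p)%N -> Q l d.
Proof.
move=> h m; have [|l C C' CC' [C0 q]|C [C1 hC]] :=
  @list_bound R n p (fun l C => 0 < C /\ Q l C^-1).
- move=> l /h [d d0 Qd]; exists d^-1; by rewrite invr_gt0 invrK.
- have C'0 := lt_le_trans C0 CC'; split => //; apply: m q; first by rewrite invr_gt0.
  by rewrite lef_pV2.
- have C0 := lt_le_trans ltr01 C1; exists C^-1; first by rewrite invr_gt0.
  by move=> l /hC [].
Qed.

Lemma locally_bounded (R : realType) (n : nat) (F : 'rV[R]_n -> R) x :
  {for x, continuous F} -> exists C : R, 0 < C /\
    exists2 d : R, 0 < d & forall y, `|y - x| < d -> `|F y| <= C.
Proof.
move=> /continuous_edP /(_ _ ltr01) [d d0 hd]; exists (`|F x| + 1); split.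
  by rewrite ltr_wpDl.
exists d => // y /hd; have := ler_normD (F y - F x) (F x); rewrite subrK; lra.
Qed.

Lemma Ck_vec_continuous (R : realType) (n q : nat) U (phi : 'rV[R]_n -> 'rV[R]_n) x :
  (forall j, Ck q U (fun y => phi y ord0 j)) -> U x ->
  forall e : R, 0 < e -> exists2 r : R, 0 < r & forall y, `|y - x| < r -> `|phi y - phi x| < e.
Proof.
move=> h Ux e e0; have [r r0 hr] := @fin_min R 'I_n
   (fun j r => forall z, `|z - x| < r -> `|phi z ord0 j - phi x ord0 j| < e)
   (fun j => (continuous_edP _ _).1 (Ck_cont (h j) Ux) e e0)
   (fun j d d' _ dd' hd z zd => hd z (lt_le_trans zd dd')).
by exists r => // z zr; apply: norm_lt_coord => // j; have := hr j z zr; rewrite !mxE.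
Qed.

(** * Derivative functionals pulled back through a parametrisation *)

Section PullbackField.
Variables (R : realType) (n p : nat) (X : set 'rV[R]_n) (f : 'rV[R]_n -> R).
Variables (V : set 'rV[R]_n) (psi : 'rV[R]_n -> 'rV[R]_n) (Y : set 'rV[R]_n).
Hypothesis V_open : open V.
Hypothesis psi_Ck : forall j, Ck p V (fun y => psi y ord0 j).
Hypothesis Y_sub : Y `<=` V.
Hypothesis psi_Y : forall y, Y y -> X (psi y).
Hypothesis Phi_unique : forall a, X a -> forall (la : R),
  Phi_iter (p := p) X f p.+2 a (fun=> 0) la -> la = 0.
Implicit Types (x y z a b : 'rV[R]_n) (l t : seq 'I_n) (ga be : mi n p) (xi eta : Dual R n p).

Local Notation Phi := (Phi_iter (p := p) X f).

Definition inner y := exists2 r : R, 0 < r & forall z, `|z - y| < r -> Y z.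

Lemma inner_Y y : inner y -> Y y.
Proof. by move=> [r r0 h]; apply: h; rewrite subrr normr0. Qed.

(* The functional P |-> D^l (P o psi) (y); note that [delta (psi z) be] is (psi z)^be. *)
Definition zeta l y : Dual R n p := fun be => pder (fun z => delta (psi z) be) l y.

Lemma Ck_monomial be : Ck p V (fun z => delta (psi z) be).
Proof. by apply: (Ck_prod _ V_open) => i _; apply: (Ck_exp _ V_open). Qed.

Lemma xi_at_zeta l y ga b : V y -> (size l <= p)%N ->
  xi_at (zeta l y) ga b = (\prod_(i < n) ((val ga i : nat)`!)%:R)^-1 *
    pder (fun z => \prod_i (psi z ord0 i - b ord0 i) ^+ (val ga i : nat)) l y.
Proof.
move=> Vy sl; rewrite /xi_at; congr (_ * _).
rewrite (pder_eq (G := fun z => \sum_(be : mi n p | [forall i, (val be i <= val ga i)%N])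
     (\prod_(i < n) (('C(val ga i, val be i))%:R * (- b ord0 i) ^+ (val ga i - val be i)%N))
     * delta (psi z) be) l V_open _ Vy); last by move=> z _; apply: shifted_monomial.
have cm be : Ck (size l) V (fun z => delta (psi z) be) by apply: Ck_le (Ck_monomial be).
rewrite (pder_sum _ V_open) //; last by move=> be _; apply: (Ck_scale _ V_open).
by apply: eq_bigr => be _; rewrite (pder_scale _ V_open).
Qed.

(** The product of the powers of [psi z - psi y] vanishes at [y] to order [mdeg ga]. Smallness of
    multiples of [zeta l] is thereby a condition on multi-indices of degree at most [size l]
    only. *)
Lemma xi_at_zeta_vanish l y ga : V y -> (size l <= p)%N -> (size l < mdeg ga)%N ->
  xi_at (zeta l y) ga (psi y) = 0.
Proof.
move=> Vy sl slt; rewrite xi_at_zeta //.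
pose D i z := psi z ord0 i - psi y ord0 i.
have cD i : Ck p V (D i) := Ck_sub_fun V_open (psi_Ck i) (Ck_cst _ _ V_open).
have pw i k t : (size t <= p)%N -> (size t < k)%N -> pder (fun z => D i z ^+ k) t y = 0.
  elim: k t => [//|k IH] t st stk.
  rewrite (pder_eq (G := fun z => D i z * D i z ^+ k) t V_open) //.
  apply: (pder_mul_vanish (j := 1) (k := k) V_open Vy (cD i) (Ck_exp k V_open (cD i))) => //.
    by move=> [|//] _ _; rewrite /= /D subrr.
  by move=> z _; rewrite exprS.
have pp : forall (s t : seq 'I_n), (size t <= p)%N -> (size t < \sum_(i <- s) (val ga i : nat))%N ->
    pder (fun z => \prod_(i <- s) D i z ^+ (val ga i : nat)) t y = 0.
  elim=> [|i s IH] t st; first by rewrite big_nil.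
  rewrite big_cons => stk.
  rewrite (pder_eq (G := fun z => D i z ^+ (val ga i : nat) * \prod_(i <- s) D i z ^+ (val ga i : nat)) t V_open) //.
    apply: (pder_mul_vanish V_open Vy (Ck_exp _ V_open (cD i)) _ (pw i _) IH) => //.
    by apply: (Ck_prod _ V_open) => j _; apply: (Ck_exp _ V_open).
  by move=> z _; rewrite big_cons.
by rewrite [X in _ * X]pp ?mulr0.
Qed.

Lemma enorm_continuous y : V y -> forall e : R, 0 < e ->
  exists2 d : R, 0 < d & forall z, `|z - y| < d -> enorm (psi z - psi y) < e.
Proof.
move=> Vy e e0; have n1 : 0 < n%:R + 1 :> R by rewrite ltr_wpDl.
have [d d0 hd] := Ck_vec_continuous psi_Ck Vy (divr_gt0 e0 n1).
exists d => // z /hd; rewrite ltr_pdivlMr // => h.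
apply: le_lt_trans (enorm_le _) _; apply: le_lt_trans h.
by rewrite mulrDr mulr1 mulrC lerDl.
Qed.

(** One number [d] serves as radius and, inverted, as bound: shrinking it weakens both requirements,
    so finite minima can be taken. *)
Lemma xi_at_zeta_bounded y0 : V y0 -> exists2 d : R, 0 < d &
  forall l, (size l <= p)%N -> forall ga z, `|z - y0| < d -> `|xi_at (zeta l z) ga (psi z)| <= d^-1.
Proof.
move=> Vy0.
have key l ga : (size l <= p)%N -> exists2 d : R, 0 < d &
    forall z, `|z - y0| < d -> `|xi_at (zeta l z) ga (psi z)| <= d^-1.
  move=> sl; have [|C [C0 [d d0 hd]]] := @locally_bounded R n (fun z => xi_at (zeta l z) ga (psi z)) y0.
    apply: (@Ck_cont _ _ 0 V) => //; apply: (Ck_scale _ V_open).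
    apply: (Ck_sum _ V_open) => be _; apply: (Ck_mul V_open).
      apply: (Ck_prod _ V_open) => i _; apply: (Ck_scale _ V_open); apply: (Ck_exp _ V_open).
      apply: (@Ck_eq _ _ _ _ (fun z => (-1) * psi z ord0 i)) => //; first by move=> z _; rewrite mulN1r.
      by apply: (Ck_scale _ V_open); apply: Ck_le (psi_Ck i).
    by apply: Ck_pder; apply: Ck_le (Ck_monomial be).
  have C10 : 0 < C^-1 by rewrite invr_gt0.
  exists (Num.min d C^-1) => [|z]; first by rewrite lt_min d0.
  rewrite lt_min => /andP [/hd h _]; apply: le_trans h _.
  by rewrite -[leLHS]invrK lef_pV2 ?posrE ?lt_min ?d0 // ge_min lexx orbT.
apply: (@list_min R n p (fun l d => forall ga z, `|z - y0| < d -> `|xi_at (zeta l z) ga (psi z)| <= d^-1)).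
  move=> l sl.
  apply: (@fin_min R (mi n p) (fun ga (d : R) => forall z, `|z - y0| < d -> `|xi_at (zeta l z) ga (psi z)| <= d^-1)).
    by move=> ga; apply: key.
  move=> ga d d' d'0 dd' h z zd; apply: le_trans (h z (lt_le_trans zd dd')) _.
  by rewrite lef_pV2 ?posrE //; apply: lt_le_trans dd'.
move=> l d d' d'0 dd' h ga z zd; apply: le_trans (h ga z (lt_le_trans zd dd')) _.
by rewrite lef_pV2 ?posrE //; apply: lt_le_trans dd'.
Qed.

(** Stated for powers [q <= p] to include [p = 0], where [psi] is merely continuous and only the
    exponent 0 occurs. *)
Lemma psi_lipschitz y0 : V y0 -> exists L : R, 1 <= L /\ exists2 d : R, 0 < d & forall y z, `|y - y0| < d -> `|z - y0| < d ->
    forall q, (q <= p)%N -> enorm (psi y - psi z) ^+ q <= (L * `|z - y|) ^+ q.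
Proof.
move=> Vy0; case: (posnP p) => [p0|p_gt0].
  exists 1; split => //; exists 1 => // y z _ _ q; rewrite p0 leqn0 => /eqP ->.
  by rewrite !expr0.
have c1 j : Ck 1 V (fun y => psi y ord0 j) by apply: Ck_le (psi_Ck j).
have [r r0 hr] := open_ball_sub V_open Vy0.
have [d d0 hd] : exists2 d : R, 0 < d & forall ij : 'I_n * 'I_n, forall z, `|z - y0| < d ->
    `|'D_(ei R ij.1) (fun y => psi y ord0 ij.2) z| <= d^-1.
  apply: (@fin_min R ('I_n * 'I_n)%type (fun ij (d : R) => forall z, `|z - y0| < d ->
    `|'D_(ei R ij.1) (fun y => psi y ord0 ij.2) z| <= d^-1)).
    move=> [i j]; have [C [C0 [d d0 hd]]] := locally_bounded (Ck_cont (Ck_D i (c1 j)) Vy0).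
    have C10 : 0 < C^-1 by rewrite invr_gt0.
    exists (Num.min d C^-1) => [|z]; first by rewrite lt_min d0.
    rewrite lt_min => /andP [/hd h _]; apply: le_trans h _.
    by rewrite -[leLHS]invrK lef_pV2 ?posrE ?lt_min ?d0 // ge_min lexx orbT.
  move=> ij d d' d'0 dd' h z zd; apply: le_trans (h z (lt_le_trans zd dd')) _.
  by rewrite lef_pV2 ?posrE //; apply: lt_le_trans dd'.
have dV0 : 0 <= d^-1 by rewrite invr_ge0 ltW.
exists (n%:R * (n%:R * d^-1) + 1); split.
  by rewrite lerDr !mulr_ge0.
pose m := Num.min d r; have m0 : 0 < m by rewrite lt_min d0.
exists (m / 3) => [|y z yd zd q _]; first by rewrite divr_gt0.
have hm w : `|w - y| <= `|z - y| -> `|w - y0| < m.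
  move=> wy; have := ler_distD y w y0; have := ler_distD y0 z y.
  by rewrite (distrC y0 y); lra.
apply: lerXn2r; rewrite ?nnegrE ?enorm_ge0 // ?mulr_ge0 ?addr_ge0 ?mulr_ge0 //.
apply: le_trans (enorm_le _) _; rewrite distrC mulrDl mul1r -mulrA.
apply: le_trans (_ : n%:R * (n%:R * d^-1 * `|z - y|) <= _); last by rewrite lerDl.
apply: ler_wpM2l => //; apply: norm_le_coord => [|j]; first by rewrite !mulr_ge0.
rewrite !mxE; apply: (@mvt_bound _ _ (fun y => psi y ord0 j) y `|z - y|) => // w wy i.
have := hm w wy; rewrite lt_min => /andP [wd wr]; split; last exact: (hd (i, j)).
by have [] := Ck_is_derive i (c1 j) (hr w wr).
Qed.

(** For [mdeg ga <= size l] the power [p - mdeg ga] of the distance splits as [p - size l], paid for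
    by the bound on [c], plus [size l - mdeg ga], at most 1 at short distance; the remaining
    multi-indices contribute 0. The constant divides out the Lipschitz factor and the bound on
    [xi_at]. *)
Lemma small_zeta y0 : V y0 -> exists s : R, 0 < s /\ exists2 d : R, 0 < d & forall y z, `|y - y0| < d -> `|z - y0| < d ->
    forall l (c : R), (size l <= p)%N -> `|c| * `|z - y| ^+ (p - size l) <= s ->
    small (psi y) (psi z) (fun be => c * zeta l z be).
Proof.
move=> Vy0; have [L [L1 [d1 d10 h1]]] := psi_lipschitz Vy0.
have [d2 d20 h2] := xi_at_zeta_bounded Vy0.
have [r r0 hr] := open_ball_sub V_open Vy0.
have L0 : 0 < L := lt_le_trans ltr01 L1.
exists (d2 / L ^+ p); split; first by rewrite divr_gt0 // exprn_gt0.
(* The 1/2 keeps [y] and [z] within distance 1 of each other. *)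
pose m := Num.min (Num.min d1 d2) (Num.min r (1 / 2)).
exists m => [|y z]; first by rewrite !lt_min d10 d20 r0 divr_gt0.
rewrite !lt_min => /andP [/andP [y1 y2] /andP [yr yh]] /andP [/andP [z1 z2] /andP [zr zh]].
move=> l c sl hc ga; rewrite xi_at_scale.
have [lt|le] := ltnP (size l) (mdeg ga).
  by rewrite xi_at_zeta_vanish ?mulr0 ?normr0 ?mulr0 //; apply: hr.
have zy1 : `|z - y| <= 1.
  by have := ler_distD y0 z y; rewrite (distrC y0 y); lra.
have q1 : (p - mdeg ga = (p - size l) + (size l - mdeg ga))%N by rewrite addnBA ?subnK.
have H1 := h1 y z y1 z1 (p - mdeg ga)%N (leq_subr _ _).
have H2 := h2 l sl ga z z2.
have Lq : L ^+ (p - mdeg ga) <= L ^+ p by apply: ler_weXn2l => //; apply: leq_subr.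
rewrite normrM; set e := enorm _ in H1 *; set w := `|xi_at _ _ _| in H2 *.
set rho := `|z - y| in hc zy1 H1.
have rho0 : 0 <= rho by apply: normr_ge0.
have c0 := normr_ge0 c.
have w0 : 0 <= w by apply: normr_ge0.
apply: (@le_trans _ _ ((L ^+ p * (rho ^+ (p - size l) * rho ^+ (size l - mdeg ga))) * (`|c| * w))).
  apply: ler_wpM2r; first exact: mulr_ge0.
  apply: le_trans H1 _; rewrite exprMn q1 [X in _ * X]exprD -q1.
  by apply: ler_wpM2r => //; rewrite mulr_ge0 // exprn_ge0.
have -> : (L ^+ p * (rho ^+ (p - size l) * rho ^+ (size l - mdeg ga))) * (`|c| * w) =
   L ^+ p * ((`|c| * rho ^+ (p - size l)) * (rho ^+ (size l - mdeg ga) * w)) by ring.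
apply: (@le_trans _ _ (L ^+ p * ((d2 / L ^+ p) * (1 * d2^-1)))).
  apply: ler_wpM2l; first by rewrite exprn_ge0 // ltW.
  apply: ler_pM => //; [by rewrite mulr_ge0 // exprn_ge0|by rewrite mulr_ge0 // exprn_ge0|].
  by apply: ler_pM => //; [exact: exprn_ge0|exact: exprn_ile1].
by rewrite le_eqVlt; apply/orP; left; apply/eqP; field; rewrite expf_neq0 ?gt_eqF.
Qed.

Lemma zeta_derive l i y be : V y -> (size l < p)%N ->
  is_derive y (ei R i) (fun z => zeta l z be) (zeta (i :: l) y be).
Proof.
move=> Vy sl; apply: (@Ck_is_derive _ _ 0 V) => //; apply: Ck_pder.
by apply: Ck_le (Ck_monomial be); rewrite add1n.
Qed.

Lemma zeta_continuous l y be : V y -> (size l <= p)%N ->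
  {for y, continuous (fun z => zeta l z be)}.
Proof.
move=> Vy sl; apply: (@Ck_cont _ _ 0 V) => //; apply: Ck_pder.
exact: Ck_le (Ck_monomial be).
Qed.

Lemma Phi_prime_unique j a (la : R) : (j < p.+2)%N -> X a ->
  Phiprime X (Phi j) a (fun=> 0) la -> la = 0.
Proof.
move=> jp Xa /Phi_prime_sub h; apply: (Phi_unique Xa); exact: (Phi_mono Xa jp h).
Qed.

Lemma Phi_zeta_inner l y : inner y -> (size l <= p)%N ->
  exists la, Phi (size l) (psi y) (zeta l y) la.
Proof.
elim: l y => [|i l IH] y iy sl.
  exists (f (psi y)); split; first exact/psi_Y/inner_Y.
  by exists 1; split => [be|]; rewrite mul1r.
have Yy := inner_Y iy; have Vy := Y_sub Yy; have Xy := psi_Y Yy.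
have [s [s0 [d1 d10 h1]]] := small_zeta Vy.
have sV0 : s != 0 by rewrite gt_eqF.
(* The multiple by [s] is reached first: the difference quotient then has coefficient [s / t], whose
   product with the distance to the power [p - size l] is at most [s] since [size l < p]. The factor
   is removed at the end by linearity. *)
have [la hla] : exists la, Phiprime X (Phi (size l)) (psi y) (fun be => s * zeta (i :: l) y be) la.
  apply: Phi_closure => [la|e e0]; first by apply: Phi_prime_unique => //; apply: ltn_trans sl _.
  have [r r0 hr] := iy.
  have [d2 d20 h2] := enorm_continuous Vy e0.
  have e20 : 0 < e / 2 / s by rewrite !divr_gt0.
  have [d3 d30 h3] : exists2 d : R, 0 < d & forall be (t : R), `|t| < d ->
      `|zeta l (t *: ei R i + y) be - zeta l y be - t * zeta (i :: l) y be| <= e / 2 / s * `|t|.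
    apply: (@fin_min R (mi n p) (fun be (d : R) => forall t : R, `|t| < d ->
      `|zeta l (t *: ei R i + y) be - zeta l y be - t * zeta (i :: l) y be| <= e / 2 / s * `|t|)).
      by move=> be; apply: (is_derive_edP (fun z => zeta l z be) _ _ _).1 => //; apply: zeta_derive.
    by move=> be d d' _ dd' h t td; apply: h; apply: lt_le_trans dd'.
  pose m := Num.min (Num.min d1 d2) (Num.min d3 (Num.min r 1)).
  have m0 : 0 < m by rewrite !lt_min d10 d20 d30 r0 ltr01.
  pose t := m / 2; have t0 : 0 < t by rewrite divr_gt0.
  have : t < m by rewrite /t; lra.
  rewrite /m !lt_min => /andP [/andP [t1 t2] /andP [t3 /andP [tr tt1]]].
  pose y' := t *: ei R i + y.
  have yy' : `|y' - y| <= t.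
    by rewrite /y' addrK normrZ gtr0_norm // ler_piMr ?norm_ei_le // ltW.
  have iy' : inner y'.
    exists (r - t) => [|z zy]; first by rewrite subr_gt0.
    by apply: hr; have := ler_distD y' z y; lra.
  have [l1 hl1] := IH y iy (ltnW sl).
  have [l2 hl2] := IH y' iy' (ltnW sl).
  have ts : `|s / t| = s / t by rewrite gtr0_norm // divr_gt0.
  exists (- (s / t) * l1 + s / t * l2), (psi y), (psi y'),
    (fun be => - (s / t) * zeta l y be + s / t * zeta l y' be); split.
  - exists (fun be => - (s / t) * zeta l y be), (- (s / t) * l1),
      (fun be => s / t * zeta l y' be), (s / t * l2).
    split => //; split; first exact/psi_Y/inner_Y.
    split; first exact: Phi_scale.
    split; first exact: Phi_scale.
    split => //; apply: h1 => //; [by rewrite subrr normr0|exact: le_lt_trans t1|exact: ltnW|].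
    rewrite ts -(subnSK sl) exprS mulrA; apply: (@le_trans _ _ (s * 1)); last by rewrite mulr1.
    apply: ler_pM; [by rewrite mulr_ge0 // ltW // divr_gt0|exact: exprn_ge0| |].
      by rewrite mulrAC ler_pdivrMr // ler_wpM2l // ltW.
    by apply: exprn_ile1 => //; apply: le_trans yy' (ltW tt1).
  - by rewrite subrr enorm0.
  - by apply: h2; apply: le_lt_trans t2.
  - move=> be; have := h3 be t; rewrite (gtr0_norm t0) => /(_ t3) h.
    have -> : - (s / t) * zeta l y be + s / t * zeta l y' be - s * zeta (i :: l) y be =
       s / t * (zeta l y' be - zeta l y be - t * zeta (i :: l) y be).
      by field; rewrite gt_eqF.
    rewrite normrM ts; apply: (@le_lt_trans _ _ (s / t * (e / 2 / s * t))).
      by apply: ler_wpM2l => //; rewrite ltW // divr_gt0.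
    have -> : s / t * (e / 2 / s * t) = e / 2 by field; rewrite sV0 gt_eqF.
    lra.
exists (s^-1 * la); have := Phi_scale s^-1 (Phi_prime_sub hla).
congr (Phi_iter _ _ _ _ _ _); apply/funext => be.
by rewrite mulrA mulVf // mul1r.
Qed.

(* Difference quotients give zeta l y after |l| iterations at interior points, and one more
   iteration reaches the closure; this leaves one iteration for Whitney's condition. *)
Hypothesis Y_dense : forall y, Y y -> forall e : R, 0 < e -> exists2 z, inner z & `|z - y| < e.

Lemma Phi_zeta l y : Y y -> (size l <= p)%N -> exists la, Phi p.+1 (psi y) (zeta l y) la.
Proof.
move=> Yy sl; have Vy := Y_sub Yy; have Xy := psi_Y Yy.
have [la hla] : exists la, Phiprime X (Phi p) (psi y) (zeta l y) la; last first.
  by exists la; apply: Phi_prime_sub.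
apply: Phi_closure => [la|e e0]; first exact: Phi_prime_unique.
have [d2 d20 h2] := enorm_continuous Vy e0.
have [d3 d30 h3] : exists2 d : R, 0 < d & forall be z, `|z - y| < d ->
    `|zeta l z be - zeta l y be| < e.
  apply: (@fin_min R (mi n p) (fun be (d : R) => forall z, `|z - y| < d ->
    `|zeta l z be - zeta l y be| < e)).
    by move=> be; apply: (continuous_edP _ _).1 => //; apply: zeta_continuous.
  by move=> be d d' _ dd' h t td; apply: h; apply: lt_le_trans dd'.
have [|z iz] := Y_dense Yy (_ : 0 < Num.min d2 d3); first by rewrite lt_min d20.
rewrite lt_min => /andP [z2 z3]; have Xz : X (psi z) by apply/psi_Y/inner_Y.
have [l1 hl1] := Phi_zeta_inner iz sl.
exists (l1 + 0), (psi z), (psi z), (fun be => zeta l z be + 0); split; try exact: h2.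
  exists (zeta l z), l1, (fun=> 0), 0; do 2 (split => //).
  split; first exact: (Phi_mono Xz sl hl1).
  split; first exact: Phi_zero.
  by split; first exact: small0.
by move=> be; rewrite addr0; apply: h3.
Qed.

Lemma Phi_value_unique a xi (l1 l2 : R) : X a -> Phi p.+1 a xi l1 -> Phi p.+1 a xi l2 -> l1 = l2.
Proof.
move=> Xa h1 h2; apply/eqP; rewrite -subr_eq0; apply/eqP; apply: (Phi_unique Xa).
apply: (Phi_mono1 Xa); have := Phi_add h1 (Phi_scale (-1) h2); rewrite mulN1r.
by congr (Phi_iter _ _ _ _ _ _); apply/funext => be; rewrite mulN1r subrr.
Qed.

Definition pull_jet y l : R :=
  if (size l <= p)%N then xget 0 [set la | Phi p.+1 (psi y) (zeta l y) la] else 0.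

Lemma pull_jetP y l : Y y -> (size l <= p)%N -> Phi p.+1 (psi y) (zeta l y) (pull_jet y l).
Proof. by move=> Yy sl; rewrite /pull_jet sl; apply: xgetPex; apply: Phi_zeta. Qed.

(** Permuting the word does not change the functional, so both values are chosen from the same
    set. *)
Lemma pull_jet_sym y : Y y -> sym_jet p (pull_jet y).
Proof.
move=> Yy l t lt sl; rewrite /pull_jet -(perm_size lt) sl.
suff -> : zeta l y = zeta t y by [].
by apply/funext => be; apply: (pder_perm V_open (Y_sub Yy) (Ck_monomial be)).
Qed.

Lemma pull_jet_nil y : Y y -> pull_jet y [::] = f (psi y).
Proof.
move=> Yy; apply: (Phi_value_unique (psi_Y Yy) (pull_jetP Yy (leq0n p : (size [::] <= p)%N))).
apply: (@Phi_mono _ _ _ _ _ 0) => //; first exact: psi_Y.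
by split; [apply: psi_Y|exists 1; split => [be|]; rewrite mul1r].
Qed.

Lemma Phi_sum j a k (Z : 'I_k -> Dual R n p) (G : 'I_k -> R) : X a ->
  (forall i, Phi j a (Z i) (G i)) -> Phi j a (fun be => \sum_i Z i be) (\sum_i G i).
Proof.
move=> Xa; elim: k Z G => [|k IH] Z G h.
  rewrite big_ord0; have := @Phi_zero R n p X f j a Xa; congr (Phi_iter _ _ _ _ _ _).
  by apply/funext => be; rewrite big_ord0.
rewrite big_ord_recl; have := Phi_add (h ord0) (IH _ _ (fun i => h (lift ord0 i))).
by congr (Phi_iter _ _ _ _ _ _); apply/funext => be; rewrite big_ord_recl.
Qed.

(** A Taylor polynomial with functionals as coefficients is a linear combination of them, so it
    stays in the fibre, with the Taylor polynomial of the values as its value. *)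
Lemma Phi_Tay j a q (Z : seq 'I_n -> Dual R n p) (G : seq 'I_n -> R) y z : X a ->
  (forall t, (size t <= q)%N -> Phi j a (Z t) (G t)) ->
  Phi j a (fun be => Tay q (fun t => Z t be) y z) (Tay q G y z).
Proof.
move=> Xa; have S k : forall Z G, (forall t, size t = k -> Phi j a (Z t) (G t)) ->
    Phi j a (fun be => Sk k (fun t => Z t be) y z) (Sk k G y z).
  elim: k => [|k IH] Z' G' h; first exact: h.
  apply: Phi_sum => // i; apply: Phi_scale; apply: (IH (fun t => Z' (i :: t))) => t st.
  by apply: h; rewrite /= st.
move=> h; apply: Phi_sum => // k; apply: Phi_scale; apply: S => t st.
by apply: h; rewrite st -ltnS.
Qed.

(* A violation of Whitney's condition at (y, z), multiplied by the factor c that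
   normalises it to s e, yields (0, s e) in the limit. *)
Lemma pull_jet_whitney (K : set 'rV[R]_n) : K `<=` Y -> whitney_field p K pull_jet.
Proof.
move=> KY y0 Ky0 e e0.
have Yy0 := KY y0 Ky0; have Vy0 := Y_sub Yy0; have Xy0 := psi_Y Yy0.
suff H : forall l, (size l <= p)%N -> exists2 d : R, 0 < d & forall y z, K y -> K z ->
   `|y - y0| < d -> `|z - y0| < d ->
   `|pull_jet z l - Tay (p - size l) (fun t => pull_jet y (l ++ t)) y z| <= e * `|z - y| ^+ (p - size l).
  have [|d d0 hd] := list_min H; last by exists d => // y z Ky Kz yd zd l sl; apply: hd.
  move=> l d d' _ dd' h y z Ky Kz yd zd.
  by apply: h => //; [apply: lt_le_trans yd _|apply: lt_le_trans zd _].
move=> l sl; apply: contrapT => nd.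
have [s [s0 [d1 d10 h1]]] := small_zeta Vy0.
have se : 0 < s * e by apply: mulr_gt0.
suff /(Phi_prime_unique (ltnSn _) Xy0) /eqP : Phiprime X (Phi p.+1) (psi y0) (fun=> 0) (s * e).
  by rewrite gt_eqF.
move=> e' e'0.
have [d2 d20 h2] := enorm_continuous Vy0 e'0.
have e20 : 0 < e' / 2 / s by rewrite !divr_gt0.
have [d3 d30 h3] : exists2 d : R, 0 < d & forall be, forall y z, `|y - y0| < d -> `|z - y0| < d ->
    `|zeta l z be - Tay (p - size l) (fun t => zeta (l ++ t) y be) y z|
       <= e' / 2 / s * `|z - y| ^+ (p - size l).
  apply: (@fin_min R (mi n p) (fun be (d : R) => forall y z, `|y - y0| < d -> `|z - y0| < d ->
    `|zeta l z be - Tay (p - size l) (fun t => zeta (l ++ t) y be) y z|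
       <= e' / 2 / s * `|z - y| ^+ (p - size l))).
    move=> be; have [d d0 hd] := uniform_taylor V_open Vy0 (Ck_monomial be) e20.
    by exists d => // y z yd zd; have [_ _] := hd y z yd zd; apply.
  by move=> be d d' _ dd' h y z yd zd; apply: h; [apply: lt_le_trans yd _|apply: lt_le_trans zd _].
pose d := Num.min d1 (Num.min d2 d3).
have d0 : 0 < d by rewrite !lt_min d10 d20.
have [y [z [Ky Kz yd zd viol]]] : exists y z, [/\ K y, K z, `|y - y0| < d, `|z - y0| < d &
    e * `|z - y| ^+ (p - size l) <
    `|pull_jet z l - Tay (p - size l) (fun t => pull_jet y (l ++ t)) y z|].
  apply: contrapT => hn; apply: nd; exists d => // y z Ky Kz yd zd.
  by rewrite leNgt; apply/negP => lt; apply: hn; exists y, z.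
have Yy := KY y Ky; have Yz := KY z Kz.
move: yd zd; rewrite !lt_min => /andP [y1 /andP [y2 y3]] /andP [z1 /andP [z2 z3]].
set q := (p - size l)%N in viol h3.
set rho := `|z - y| in viol.
set D := pull_jet z l - _ in viol.
have rho0 : 0 <= rho ^+ q by rewrite exprn_ge0 // normr_ge0.
have D0 : 0 < `|D| by apply: le_lt_trans viol; rewrite mulr_ge0 // ltW.
have Dn : D != 0 by rewrite -normr_gt0.
pose c := s * e / D.
(* The assumed violation is exactly what makes this factor admissible for [small_zeta]. *)
have cq : `|c| * rho ^+ q <= s.
  rewrite /c normrM normfV (gtr0_norm se) mulrAC ler_pdivrMr // -mulrA ler_wpM2l //; exact: ltW.
exists (psi y), (psi z), (fun be => - c * Tay q (fun t => zeta (l ++ t) y be) y z + c * zeta l z be),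
  (- c * Tay q (fun t => pull_jet y (l ++ t)) y z + c * pull_jet z l); split.
  exists (fun be => - c * Tay q (fun t => zeta (l ++ t) y be) y z),
    (- c * Tay q (fun t => pull_jet y (l ++ t)) y z),
    (fun be => c * zeta l z be), (c * pull_jet z l).
  split; first exact: psi_Y.
  split; first exact: psi_Y.
  split.
    apply: Phi_scale; apply: Phi_Tay; first exact: psi_Y.
    by move=> t st; apply: pull_jetP => //; rewrite size_cat -leq_subRL.
  split; first by apply: Phi_scale; apply: pull_jetP.
  by split => //; apply: h1.
split; first exact: h2.
split; first exact: h2.
split; last first.
  have -> : - c * Tay q (fun t => pull_jet y (l ++ t)) y z + c * pull_jet z l = c * D.
    by rewrite /D; ring.
  by rewrite /c divfK // subrr normr0.
move=> be; have -> : - c * Tay q (fun t => zeta (l ++ t) y be) y z + c * zeta l z be - 0 =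
   c * (zeta l z be - Tay q (fun t => zeta (l ++ t) y be) y z) by ring.
rewrite normrM; apply: (@le_lt_trans _ _ (`|c| * (e' / 2 / s * rho ^+ q))).
  by apply: ler_wpM2l => //; apply: h3.
rewrite mulrCA; apply: (@le_lt_trans _ _ (e' / 2 / s * s)).
  by apply: ler_wpM2l => //; apply: ltW.
by rewrite divfK ?gt_eqF //; lra.
Qed.

End PullbackField.

(** * Charts *)

Section Chart.
Variables (R : realType) (n p d : nat).
Implicit Types (x y z a b : 'rV[R]_n) (X M U V : set 'rV[R]_n).

(* Composing the inverse chart with this projection turns the field on X into one on a
   subset of R^n with dense interior, so that the dimension d plays no further role. *)
Definition coord_proj y : 'rV[R]_n := \row_j (if (j < d)%N then y ord0 j else 0).

Lemma coord_proj_dist y z : `|coord_proj y - coord_proj z| <= `|y - z|.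
Proof.
apply: norm_le_coord => // j; rewrite !mxE; case: ifP => _; last by rewrite subrr normr0.
by have := coord_le_norm (y - z) j; rewrite !mxE.
Qed.

Lemma coord_proj_id y : (forall j : 'I_n, (d <= j)%N -> y ord0 j = 0) -> coord_proj y = y.
Proof.
move=> h; apply/rowP => j; rewrite mxE; case: ltnP => // dj.
by rewrite (h j dj).
Qed.

Lemma coord_proj_tail y (j : 'I_n) : (d <= j)%N -> coord_proj y ord0 j = 0.
Proof. by move=> dj; rewrite mxE ltnNge dj. Qed.

Lemma Ck_coord_proj q V (j : 'I_n) : open V -> Ck q V (fun y => coord_proj y ord0 j).
Proof.
move=> oV; apply: (@Ck_eq _ _ _ _ (fun y : 'rV[R]_n => if (j < d)%N then y ord0 j else 0)) => //.
  by move=> y _; rewrite mxE.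
by case: (j < d)%N; [apply: Ck_coord|apply: Ck_cst].
Qed.

(** The bump vanishes beyond [r / 2], so the product is smooth everywhere although [F] is controlled
    only on [U]; it is 1 up to [r / 3]. *)
Lemma Ck_cutoff U F x : open U -> U x -> Ck p U F -> exists (r : R) (G : 'rV[R]_n -> R),
  [/\ 0 < r, Ck p setT G & forall y, `|y - x| < r -> U y /\ G y = F y].
Proof.
move=> oU Ux cF; have [r r0 hr] := open_ball_sub oU Ux.
pose chi y := plateau p ((6 / r) *: (y - x)).
have cchi : Ck p setT chi by apply/Ck_affine/Ck_plateau.
have nchi y : `|(6 / r) *: (y - x)| = 6 * `|y - x| / r.
  by rewrite normrZ gtr0_norm ?divr_gt0 // mulrAC.
have chi0 y : r / 2 < `|y - x| -> chi y = 0.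
  by move=> h; apply: plateau0; rewrite nchi ler_pdivlMr //; lra.
exists (r / 3), (fun y => chi y * F y); split; first by rewrite divr_gt0.
  apply: Ck_local => y _; have [h|h] := ltP `|y - x| r.
    exists [set z | `|z - x| < r]; split => //; first exact: open_ball_normr.
    apply: Ck_mul; [exact: open_ball_normr|exact: Ck_sub cchi|].
    by apply: Ck_sub cF => z /hr.
  have oW : open [set z : 'rV[R]_n | r / 2 < `|z - x|].
    apply: open_ballP => z /= rz; exists (`|z - x| - r / 2); first by rewrite subr_gt0.
    by move=> w wz; have := ler_distD w z x; rewrite (distrC z w); lra.
  exists [set z | r / 2 < `|z - x|]; split => //=; first lra.
  by apply: (@Ck_eq _ _ _ _ (fun=> 0)) => //; [move=> z /= /chi0 ->; rewrite mul0r|apply: Ck_cst].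
move=> y yx; split; first by apply: hr; lra.
by rewrite /chi plateau1 ?mul1r // nchi ler_pdivrMr //; lra.
Qed.

Lemma chart_extension X M f x0 : closed X -> X `<=` M -> is_submanifold p d M ->
  X = rel_closure M (rel_interior M X) ->
  (forall a, X a -> forall la : R, Phi_iter (p := p) X f p.+2 a (fun=> 0) la -> la = 0) ->
  X x0 -> extendable_at p X f x0.
Proof.
move=> cX XM [_ hM] Xint uniq Xx0.
have [U [V0 [phi [psi0 [oU [oV0 [Ux0 [UV [VU [psiK [phiK [cphi [cpsi hchart]]]]]]]]]]]]] := hM _ (XM _ Xx0).
have {}cphi j : Ck p U (fun y => phi y ord0 j) by apply/Ck_Cp_on/cphi.
have {}cpsi j : Ck p V0 (fun y => psi0 y ord0 j) by apply/Ck_Cp_on/cpsi.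
pose V := [set y | V0 (coord_proj y)].
have oV : open V.
  apply: open_ballP => y /= Vy; have [r r0 hr] := open_ball_sub oV0 Vy.
  by exists r => // z zy; apply: hr; apply: le_lt_trans zy; apply: coord_proj_dist.
pose psi y := psi0 (coord_proj y).
have cps j : Ck p V (fun y => psi y ord0 j).
  by apply: (@Ck_comp _ _ p V V0 (fun y => psi0 y ord0 j)) => // k; apply: Ck_coord_proj.
have psiM y : V y -> M (psi y).
  move=> Vy; apply/(hchart _ (VU _ Vy)) => j dj.
  by rewrite phiK //; apply: coord_proj_tail.
pose Y := [set y | V y /\ X (psi y)].
have Yd y : Y y -> forall e : R, 0 < e -> exists2 z, inner Y z & `|z - y| < e.
  move=> [Vy Xy] e e0.
  have Uy : U (psi y) by apply: VU.
  have ephi : phi (psi y) = coord_proj y by rewrite phiK.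
  have [r1 r10 h1] := open_ball_sub oU Uy.
  have [r3 r30 h3] := Ck_vec_continuous cphi Uy e0.
  have [My hcl] : rel_closure M (rel_interior M X) (psi y) by rewrite -Xint.
  have m1 : 0 < Num.min r1 r3 by rewrite lt_min r10.
  have [x [[Xx [e1 [e10 hx]]] xy]] := hcl _ m1.
  have {}xy : `|x - psi y| < Num.min r1 r3.
    by rewrite distrC; apply: le_lt_trans (norm_le_enorm _) xy.
  move: xy; rewrite lt_min => /andP [xr1 xr3].
  have Ux := h1 x xr1.
  have px : coord_proj (phi x) = phi x.
    by apply: coord_proj_id; apply/(hchart _ Ux)/XM.
  (* A point [x] of the relative interior near [psi y] is lifted to a point near [y]: the
     coordinates from [d] on keep their values in [y], and the others become those of [phi x]. *)
  pose z := y + (phi x - phi (psi y)).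
  have pz : coord_proj z = phi x.
    rewrite -[RHS]px /z ephi; apply/rowP => j; rewrite !mxE.
    by case: (j < d)%N => //; ring.
  have zy : `|z - y| < e by rewrite /z addrC addKr; apply: h3.
  have Vz : V z by rewrite /V /= pz; apply: UV.
  have psz : psi z = x by rewrite /psi pz psiK.
  exists z => //.
  (* [psi] sends a full neighbourhood of [z] into [M] and close to [x], hence into [X]; so [z] is
     interior in all [n] dimensions. *)
  have [r4 r40 h4] := enorm_continuous cps Vz e10.
  have [r5 r50 h5] := open_ball_sub oV Vz.
  exists (Num.min r4 r5) => [|w]; first by rewrite lt_min r40.
  rewrite lt_min => /andP [w4 w5]; have Vw := h5 w w5; split => //.
  by apply: hx; [apply: psiM|rewrite -psz; apply: h4].
have YV : Y `<=` V by move=> y [].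
have YX y : Y y -> X (psi y) by move=> [].
pose y0 := phi x0.
have py0 : coord_proj y0 = y0 by apply: coord_proj_id; apply/(hchart _ Ux0)/XM.
have Vy0 : V y0 by rewrite /V /= py0; apply: UV.
have [r r0 hr] := open_ball_sub oV Vy0.
(* [Y] is closed only relative to [V]; intersecting with a closed ball inside [V] gives a compact
   set to which Whitney's theorem applies. *)
pose K := [set y | Y y /\ `|y - y0| <= r / 2].
have KY : K `<=` Y by move=> y [].
have cK : closed K.
  rewrite -openC; apply: open_ballP => y nKy.
  have [h|h] := ltP (r / 2) `|y - y0|.
    exists (`|y - y0| - r / 2); first by rewrite subr_gt0.
    move=> z zy [_ hz]; have := ler_distD z y y0; rewrite (distrC y z); lra.
  have Vy : V y by apply: hr; lra.
  have nX : ~ X (psi y) by move=> Xy; apply: nKy; split.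
  have oX : open (~` X) by rewrite openC.
  have [r1 r10 h1] := open_ball_sub oX nX.
  have [r2 r20 h2] := Ck_vec_continuous cps Vy r10.
  by exists r2 => // z /h2 /h1 nXz [[_ Xz] _].
have bK : exists B : nat, forall a, K a -> `|a| <= B%:R.
  have b0 : 0 <= `|y0| + r by rewrite addr_ge0 // ltW.
  exists (Num.bound (`|y0| + r)) => a [_ ha].
  have := archi_boundP b0; have := ler_normD (a - y0) y0; rewrite subrK; lra.
pose J := pull_jet p X f psi.
have [H [cH hH]] := whitney_extension cK bK
  (fun a Ka => pull_jet_sym X f oV cps YV (KY _ Ka))
  (pull_jet_whitney oV cps YV YX uniq Yd KY).
have cHphi : Ck p U (fun x => H (phi x)).
  by apply: (@Ck_comp _ _ p U setT H phi) => //; exact: openT.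
have [s [G [s0 cG hG]]] := Ck_cutoff oU Ux0 cHphi.
have [s' s'0 hs'] := Ck_vec_continuous cphi Ux0 (divr_gt0 r0 (ltr0n R 2)).
exists (Num.min s s'), G; split => //; first by rewrite lt_min s0.
move=> y Xy; rewrite lt_min => /andP [/hG [Uy ->] /hs' ys'].
have py : coord_proj (phi y) = phi y by apply: coord_proj_id; apply/(hchart _ Uy)/XM.
have psy : psi (phi y) = y by rewrite /psi py psiK.
have Yy : Y (phi y) by split; [rewrite /V /= py; apply: UV|rewrite psy].
have Ky : K (phi y) by split => //; apply: ltW.
by rewrite hH // (pull_jet_nil oV cps YV YX uniq Yd Yy) psy.
Qed.

End Chart.

Theorem theorem1p2 (R : realType) (n p d : nat) (X M : set 'rV[R]_n) :
  closed X -> X `<=` M -> is_submanifold p d M ->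
  X = rel_closure M (rel_interior M X) ->
  forall f : 'rV[R]_n -> R,
    (exists F : 'rV[R]_n -> R, Cp_on p setT F /\ (forall x, X x -> F x = f x))
    <-> nabla_is_function p X f.
Proof.
move=> cX XM hM Xint f; split.
  by move=> [F [/Ck_Cp_on cF Ff]]; apply: nabla_function_of_extension cF Ff.
move=> hN; case: n X M cX XM hM Xint f hN => [|n'] X M cX XM hM Xint f hN.
  exists f; split => // l _; have -> : l = [::] by case: l => [//|[]].
  split => [x _|_ x _ []//] /=; apply/continuous_edP => e e0; exists 1 => // y _.
  by rewrite (_ : y = x) ?subrr ?normr0 //; apply/rowP; case.
have uniq a : X a -> forall la : R, Phi_iter (p := p) X f p.+2 a (fun=> 0) la -> la = 0.
  move=> Xa la h.
  have t0 : tau X a (fun _ : mi n'.+1 p => 0 : R).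
    rewrite /tau; case: (2 * _)%N => [|k]; first by split => //; exists 0 => be; rewrite mul0r.
    by exists 0%N, (fun=> 0), (fun _ _ => 0); split => [[]//|be]; rewrite big_ord0.
  have [l [_ ul]] := hN a Xa _ t0.
  have le : (p.+2 <= 2 * (rdim n'.+1 p).+1)%N by have := rdim_gt n' p; lia.
  have <- := ul la (Phi_mono Xa le h).
  by apply: ul; apply: (Phi_zero p f (2 * (rdim n'.+1 p).+1) Xa).
have [F [cF hF]] := extend_global cX (fun x Xx => chart_extension cX XM hM Xint uniq Xx).
by exists F; split => //; apply/Ck_Cp_on.
Qed.
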